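(* Let $r\in\mathbb{N}$, $1>\beta\ge\frac{\max(0,r-2)}{r}$ and $\kappa_{0,r}\in(E_{\mathbb{C}}^{\otimes r})^*_{sym}$. Then each $\varphi\in(E)_\beta$ has a unique decomposition $$\varphi(x)=\sum_{n=0}^\infty\big\langle:x^{\otimes n}:_{\kappa_{0,r}},(\psi_n)_{\kappa_{0,r}}\big\rangle\qquad\text{for all }x\in E^*,$$ with $(\psi_n)_{\kappa_{0,r}}\in(E_{\mathbb{C}}^{\otimes n})_{sym}$ for all $n$, where the series is understood as converging in $(E)_\beta$.
   Context: White noise spaces. Let $H=L^2(\mathbb{R},dt)$ (real-valued) with norm $|\cdot|_0$, and let $A$ be a positive self-adjoint operator on $H$ with $\inf\sigma(A)>1$ and Hilbert-Schmidt inverse. Put $|\xi|_p=|A^p\xi|_0$, and let $E=\{\xi\in H:|\xi|_p<\infty\ \forall p\}$, a nuclear Fréchet space dense in $H$; $E^*$ is its strong dual, $E_{\mathbb{C}}$ the complexification. $\langle\cdot,\cdot\rangle$ denotes the canonical $\mathbb{C}$-bilinear pairings; $|\cdot|_p$ also denotes the corresponding norms on tensor powers; the subscript ''sym'' denotes symmetric elements, $\widehat\otimes$ the symmetric tensor product. The trace $\tau\in(E_{\mathbb{C}}^{\otimes 2})^*$ is $\langle\tau,\xi\otimes\eta\rangle=\langle\xi,\eta\rangle$, and $:x^{\otimes n}:=\sum_{k=0}^{\lfloor n/2\rfloor}\frac{n!}{(n-2k)!k!}(-\tfrac12)^k x^{\otimes(n-2k)}\widehat\otimes\tau^{\widehat\otimes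 k}$ for $x\in E^*$. For $0\le\beta<1$, $(E)_\beta$ is the space of $\varphi(x)=\sum_{n\ge0}\langle:x^{\otimes n}:,f_n\rangle$, $f_n\in(E_{\mathbb{C}}^{\otimes n})_{sym}$, with $|\varphi|_{p,\beta}^2=\sum_n(n!)^{1+\beta}|f_n|_p^2<\infty$ for all $p$; with these norms it is a nuclear Fréchet space. Its elements are taken in their continuous versions on $E^*$. Generalized Wick tensors. For $m\in\mathbb{N}=\{1,2,\dots\}$, $\kappa_{0,m}\in(E_{\mathbb{C}}^{\otimes m})^*_{sym}$ (possibly zero), $x\in E^*$: $$:x^{\otimes n}:_{\kappa_{0,m}}=\sum_{k=0}^{\lfloor n/m\rfloor}\frac{n!}{(n-mk)!\,k!}\Big(-\frac12\Big)^k x^{\otimes(n-mk)}\,\widehat\otimes\,\kappa_{0,m}^{\widehat\otimes k}.$$ *)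

(* Defs.v *)
From HB Require Import structures.
From mathcomp Require Import all_boot all_order all_algebra perm generic_quotient.
From mathcomp Require Import complex.
From mathcomp Require Import all_classical all_reals all_analysis measurable_realfun.
From mathcomp Require Import ring lra.

Set Implicit Arguments.
Unset Strict Implicit.
Unset Printing Implicit Defensive.

Import Order.TTheory GRing.Theory Num.Theory.
Import numFieldNormedType.Exports.

Local Open Scope classical_set_scope.
Local Open Scope ring_scope.

(* The library provides L^2(mu) as the type LspaceType2 mu of classes modulo
   equality a.e., but no vector space structure on it; we transport the one of
   LfunType (square integrable functions) along ofL, and add the inner product. *)
Section L2space.
Context d (T : measurableType d) (R : realType).
Variable mu : {measure set T -> \bar R}.

Definition L2space := LspaceType2 mu.

Local Notation L := (LfunType mu (lee1n 2)).
Local Notation M := {mfun T >-> measurableTypeR R}.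
Local Notation aeM := {mfun_ mu, T >-> measurableTypeR R}.
Implicit Types (f g : L) (u v : L2space).

Lemma finite_norm_ae (f g : M) :
  f = g %[ae mu] -> finite_norm mu 2%:R%:E f -> finite_norm mu 2%:R%:E g.
Proof.
move=> fg; rewrite /finite_norm; apply: le_lt_trans.
have mP (h : M) : measurable_fun [set: T] (fun x => (`|(h x : R)%:E| `^ 2%:R)%E).
  apply: (measurableT_comp (measurable_poweR _)).
  apply: (@measurableT_comp _ _ _ _ _ _ (@abse R)) => //.
  by apply/measurable_EFinP; exact: (@measurable_funPT _ _ _ _ h).
rewrite unlock.
suff -> : (\int[mu]_x `|(EFin \o f) x| `^ 2%:R =
           \int[mu]_x `|(EFin \o g) x| `^ 2%:R)%E by [].
apply: ge0_ae_eq_integral => //; [exact: (mP f)|exact: (mP g)| | |].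
- by move=> x _; exact: poweR_ge0.
- by move=> x _; exact: poweR_ge0.
- by apply: filterS fg => x /= fgx _; rewrite fgx.
Qed.

Lemma L_measurable f : measurable_fun [set: T] (f : T -> measurableTypeR R).
Proof. exact: (@measurable_funPT _ _ _ _ f). Qed.

Definition mfun_of f : M := HB.pack (f : T -> measurableTypeR R)
  (isMeasurableFun.Build _ _ _ _ _ (L_measurable f)).

Definition ae_class f : aeM := (\pi_aeM (mfun_of f))%qT.

Lemma ae_classE f : (f : T -> R) = ae_class f %[ae mu].
Proof.
have : (\pi_aeM (repr (ae_class f)) = ae_class f)%qT by rewrite reprK.
by move=> /eqP; rewrite /ae_class eqmodE => /asboolP/ae_eq_sym.
Qed.

Lemma ae_class_finite f : finite_norm mu 2%:R%:E (ae_class f).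
Proof.
have H := @finite_norm_ae (mfun_of f) (repr (ae_class f)) (ae_classE f).
have h : finite_norm mu 2%:R%:E f := Lfunction_finite _ f.
exact: (H h).
Qed.

Definition ofL f : L2space := HB.pack_for (LspaceType2 mu) (ae_class f)
  (isFinLebesgue.Build _ _ _ _ _ (lee1n 2) (ae_class f) (ae_class_finite f)).

Lemma ofLE f : ofL f = f %[ae mu].
Proof. exact/ae_eq_sym/(ae_classE f). Qed.

Lemma L2_measurable u : measurable_fun [set: T] (u : T -> R).
Proof. exact: (@measurable_funPT _ _ _ _ (repr (u : aeM))). Qed.

Lemma L2_finite u : finite_norm mu 2%:R%:E (u : T -> R).
Proof. exact: Lebesgue_finite. Qed.

Lemma L2_Lfun u : (u : T -> R) \in Lfun mu 2%:R%:E.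
Proof.
by apply/andP; split; rewrite inE; [exact: L2_measurable|exact: L2_finite].
Qed.

Definition toL u : L := Lfun_Sub (lee1n 2) (L2_Lfun u).

Lemma toLE u : toL u = u :> (T -> R). Proof. by []. Qed.

Lemma L2P u v : u = v %[ae mu] -> u = v.
Proof.
have inj u' v' : (u' : aeM) = v' -> u' = v'.
  case: u' v' => [u' [[cu]]] [v' [[cv]]] /= uv; subst v'.
  by congr LebesgueSpace.Pack; rewrite (Prop_irrelevance cu cv).
move=> uv; apply: inj; rewrite -[LHS]reprK -[RHS]reprK; apply/eqmodP.
exact/asboolP.
Qed.

Lemma ofL_ae f g : f = g %[ae mu] -> ofL f = ofL g.
Proof.
move=> fg; apply: L2P; apply: ae_eq_trans (ofLE f) _.
by apply: ae_eq_trans fg _; exact/ae_eq_sym/ofLE.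
Qed.

Lemma toLK u : ofL (toL u) = u.
Proof. by apply: L2P; exact: ofLE. Qed.

HB.instance Definition _ := gen_eqMixin L2space.
HB.instance Definition _ := gen_choiceMixin L2space.

Let zero : L2space := ofL 0.
Let opp u : L2space := ofL (- toL u).
Let add u v : L2space := ofL (toL u + toL v).
Let scale (a : R) u : L2space := ofL (a *: toL u).

Let addE f g : add (ofL f) (ofL g) = ofL (f + g).
Proof.
apply: ofL_ae; have [hf hg] := (ofLE f, ofLE g).
by apply: filterS2 hf hg => x /= h1 h2 _; rewrite !fctE /= h1 ?h2.
Qed.

Let scaleE a f : scale a (ofL f) = ofL (a *: f).
Proof.
apply: ofL_ae; have hf := ofLE f.
by apply: filterS hf => x /= h1 _; rewrite !fctE /= h1.
Qed.

Let oppE f : opp (ofL f) = ofL (- f).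
Proof. by rewrite -scaleN1r -scaleE /scale scaleN1r. Qed.

Let addA : associative add.
Proof. by move=> u v w; rewrite -(toLK u) -(toLK v) -(toLK w) !addE addrA. Qed.
Let addC : commutative add.
Proof. by move=> u v; rewrite /add addrC. Qed.
Let add0 : left_id zero add.
Proof. by move=> u; rewrite -(toLK u) addE add0r. Qed.
Let addN : left_inverse zero opp add.
Proof. by move=> u; rewrite -(toLK u) oppE addE addNr. Qed.

HB.instance Definition _ := GRing.isZmodule.Build L2space addA addC add0 addN.

Lemma ofLD f g : ofL (f + g) = ofL f + ofL g.
Proof. by rewrite -[LHS]addE. Qed.

Let scaleA a b u : scale a (scale b u) = scale (a * b) u.
Proof. by rewrite -(toLK u) !scaleE scalerA. Qed.
Let scale1 : left_id 1 scale.
Proof. by move=> u; rewrite -(toLK u) scaleE scale1r. Qed.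
Let scaleDr : right_distributive scale +%R.
Proof.
by move=> a u v; rewrite -(toLK u) -(toLK v) -ofLD !scaleE -ofLD scalerDr.
Qed.
Let scaleDl u : {morph scale^~ u : a b / a + b}.
Proof. by move=> a b; rewrite -(toLK u) !scaleE -ofLD scalerDl. Qed.

HB.instance Definition _ :=
  GRing.Zmodule_isLmodule.Build R L2space scaleA scale1 scaleDr scaleDl.

Lemma ofLZ a f : ofL (a *: f) = a *: ofL f.
Proof. by rewrite -[LHS]scaleE. Qed.

Lemma L2D_ae u v :
  ((u + v : L2space) : T -> R) = (fun x => (u : T -> R) x + (v : T -> R) x)
  %[ae mu].
Proof. exact: (ofLE (toL u + toL v)). Qed.

Lemma L2Z_ae a u :
  ((a *: u : L2space) : T -> R) = (fun x => a * (u : T -> R) x) %[ae mu].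
Proof. exact: (ofLE (a *: toL u)). Qed.

Definition dot u v : R := \int[mu]_x ((u : T -> R) x * (v : T -> R) x).

Definition norm0 u : R := Num.sqrt (dot u u).

Lemma dotC u v : dot u v = dot v u.
Proof. by rewrite /dot; apply: eq_Rintegral => x _; rewrite mulrC. Qed.

Lemma dot_integrable u v :
  mu.-integrable setT (EFin \o (fun x => (u : T -> R) x * (v : T -> R) x)).
Proof. exact/Lfun1_integrable/Lfun2_mul_Lfun1/L2_Lfun/L2_Lfun. Qed.

Lemma dotDl u u' v : dot (u + u') v = dot u v + dot u' v.
Proof.
rewrite /dot -RintegralD//; try exact: dot_integrable.
rewrite /Rintegral; congr fine; apply: ae_eq_integral => //.
- exact: (measurable_int _ (dot_integrable (u + u') v)).
- apply: (measurable_int mu).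
  exact: (integrableD measurableT (dot_integrable u v) (dot_integrable u' v)).
- have h := L2D_ae u u'.
  by apply: filterS h => x /= -> // _; rewrite mulrDl.
Qed.

Lemma dotZl a u v : dot (a *: u) v = a * dot u v.
Proof.
rewrite /dot -RintegralZl//; last exact: dot_integrable.
rewrite /Rintegral; congr fine; apply: ae_eq_integral => //.
- exact: (measurable_int _ (dot_integrable (a *: u) v)).
- apply: (measurable_int mu).
  exact: (integrableZl measurableT a (dot_integrable u v)).
- have h := L2Z_ae a u.
  by apply: filterS h => x /= -> // _; rewrite mulrA.
Qed.

Lemma dotDr u v v' : dot u (v + v') = dot u v + dot u v'.
Proof. by rewrite dotC dotDl !(dotC _ u). Qed.

Lemma dotZr a u v : dot u (a *: v) = a * dot u v.
Proof. by rewrite dotC dotZl dotC. Qed.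

Lemma dot_ge0 u : 0 <= dot u u.
Proof. by apply: Rintegral_ge0 => x _; rewrite -expr2 sqr_ge0. Qed.

Lemma norm0_ge0 u : 0 <= norm0 u.
Proof. exact: sqrtr_ge0. Qed.

Lemma cauchy_schwarz u v : `|dot u v| <= norm0 u * norm0 v.
Proof.
have key t : 0 <= dot u u + 2 * t * dot u v + t ^+ 2 * dot v v.
  have := dot_ge0 (u + t *: v).
  by rewrite !(dotDl, dotDr, dotZl, dotZr) (dotC v u); congr (0 <= _); ring.
rewrite /norm0 -sqrtrM ?dot_ge0// -sqrtr_sqr; apply: ler_wsqrtr.
have := dot_ge0 v; rewrite le_eqVlt => /predU1P[v0|v_gt0].
  rewrite -v0 mulr0.
  have [->|uv0] := eqVneq (dot u v) 0; first by rewrite expr0n.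
  have := key (- ((dot u u + 1) / (2 * dot u v))).
  rewrite -v0 mulr0 addr0 [X in 0 <= _ + X](_ : _ = - (dot u u + 1)).
    by rewrite opprD addrA subrr add0r oppr_ge0 ler10.
  by field.
have := key (- (dot u v / dot v v)).
rewrite [X in 0 <= X](_ : _ = dot u u - dot u v ^+ 2 / dot v v).
  by rewrite subr_ge0 ler_pdivrMr.
by field; exact: lt0r_neq0.
Qed.

End L2space.

Section Operators.
Context (R : realType).

Definition L2R := L2space (@lebesgue_measure R).
Local Notation H := L2R.

(* Partially defined linear operator on H; op_fun is irrelevant outside op_dom. *)
Record operator := Operator {
  op_dom : set H;
  op_fun :> H -> H;
  op_dom0 : op_dom 0;
  op_domP : forall a u v, op_dom u -> op_dom v -> op_dom (a *: u + v);
  op_linear : forall a u v, op_dom u -> op_dom v ->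
    op_fun (a *: u + v) = a *: op_fun u + op_fun v }.

Definition densely_defined (A : operator) :=
  forall (h : H) e, 0 < e -> exists2 u, op_dom A u & norm0 (h - u) < e.

Definition adjoint_graph (A : operator) (u w : H) :=
  forall v, op_dom A v -> dot (A v) u = dot v w.

Definition self_adjoint (A : operator) := densely_defined A /\
  forall u w, adjoint_graph A u w <-> op_dom A u /\ A u = w.

Definition positive_operator (A : operator) :=
  forall u, op_dom A u -> 0 <= dot (A u) u.

(* B is the inverse of A - l, as a map defined on all of H *)
Definition is_resolvent (A : operator) (l : R) (B : H -> H) :=
  (forall h, op_dom A (B h) /\ A (B h) - l *: B h = h) /\
  (forall u, op_dom A u -> B (A u - l *: u) = u).

(* Real spectrum; for a self-adjoint operator on a real Hilbert space it is the
   spectrum of the complexification. *)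
Definition spectrum (A : operator) : set R := ~` [set l | exists B,
  is_resolvent A l B /\ exists c, forall h, norm0 (B h) <= c * norm0 h].

Definition orthonormal_basis (e : nat -> H) :=
  (forall i j, dot (e i) (e j) = (i == j)%:R) /\
  forall h, (fun n => norm0 (h - \sum_(i < n) dot h (e i) *: e i)) @ \oo --> 0.

Definition hilbert_schmidt (B : H -> H) := exists e,
  orthonormal_basis e /\
  (\sum_(0 <= i <oo) (norm0 (B (e i)) ^+ 2)%:E < +oo)%E.

Record white_noise_operator (A : operator) : Prop := WhiteNoiseOperator {
  wn_self_adjoint : self_adjoint A;
  wn_positive : positive_operator A;
  wn_spectrum : (1 < ereal_inf [set l%:E | l in spectrum A])%E;
  wn_inverse : exists2 B, is_resolvent A 0 B & hilbert_schmidt B }.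

End Operators.

Section TestFunctions.
Context (R : realType) (A : operator R).
Local Notation H := (L2R R).

Definition smooth : {pred H} :=
  [pred xi | `[< forall p, op_dom A (iter p A xi) >]].

Lemma smooth_iter xi : xi \in smooth -> forall p, op_dom A (iter p A xi).
Proof. by move=> /asboolP. Qed.

Lemma iter_linear p a xi eta : xi \in smooth -> eta \in smooth ->
  iter p A (a *: xi + eta) = a *: iter p A xi + iter p A eta.
Proof.
move=> /smooth_iter dxi /smooth_iter deta.
by elim: p => //= p ->; rewrite op_linear.
Qed.

Lemma smooth_submod : submod_closed smooth.
Proof.
have z p : iter p A 0 = 0.
  elim: p => //= p ->; have /eqP := op_linear 1 (op_dom0 A) (op_dom0 A).
  by rewrite !scale1r addr0 -subr_eq0 opprD addrA subrr sub0r oppr_eq0 => /eqP.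
split=> [|a u v su sv]; apply/asboolP => p; first by rewrite z; exact: op_dom0.
by rewrite iter_linear//; apply: op_domP; exact: smooth_iter.
Qed.

HB.instance Definition _ := GRing.isSubmodClosed.Build R H smooth smooth_submod.

(* the space E *)
Record testE := TestE { testE_val :> H; _ : testE_val \in smooth }.
HB.instance Definition _ := [isSub for testE_val].
HB.instance Definition _ := [Choice of testE by <:].
HB.instance Definition _ := [SubChoice_isSubLmodule of testE by <:].

Definition normE p (xi : testE) : R := norm0 (iter p A (xi : H)).

(* Continuity is stated for the topology generated by the seminorms normE. *)
Definition is_distribution : {pred testE -> R} := [pred x : testE -> R | `[<
  (forall a xi eta, x (a *: xi + eta) = a * x xi + x eta) /\
  exists p c, forall xi, `|x xi| <= c * \sum_(q < p.+1) normE q xi >]].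

Lemma is_distribution_submod : submod_closed is_distribution.
Proof.
have mono p p' xi : (p <= p')%N ->
    \sum_(q < p.+1) normE q xi <= \sum_(q < p'.+1) normE q xi.
  move=> pp'; rewrite -!(big_mkord xpredT (fun q => normE q xi)).
  rewrite [leRHS](@big_cat_nat _ _ _ p.+1)//= lerDl.
  by apply: sumr_ge0 => i _; exact: norm0_ge0.
split=> [|a x y].
  apply/asboolP; split=> [b xi eta|]; first by rewrite mulr0 addr0.
  by exists 0%N, 0 => xi; rewrite normr0 mul0r.
move=> /asboolP[lx [p [c xb]]] /asboolP[ly [p' [c' yb]]].
apply/asboolP; split=> [b xi eta|].
  by rewrite !fctE lx ly scalerDr mulrDr addrACA; congr (_ + _ + _);
     rewrite /GRing.scale/=; ring.
exists (maxn p p'), (`|a| * `|c| + `|c'|) => xi; rewrite !fctE.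
apply: le_trans (ler_normD _ _) _; rewrite mulrDl; apply: lerD.
  rewrite normrM -mulrA ler_wpM2l//; apply: le_trans (xb xi) _.
  apply: le_trans (ler_wpM2l _ (mono _ _ xi (leq_maxl p p'))) => //.
  rewrite ler_wpM2r ?ler_norm//.
  by apply: sumr_ge0 => i _; exact: norm0_ge0.
apply: le_trans (yb xi) _.
apply: le_trans (ler_wpM2l _ (mono _ _ xi (leq_maxr p p'))) => //.
rewrite ler_wpM2r ?ler_norm//.
by apply: sumr_ge0 => i _; exact: norm0_ge0.
Qed.

HB.instance Definition _ :=
  GRing.isSubmodClosed.Build R (testE -> R) is_distribution is_distribution_submod.

(* the dual space E^* *)
Record distr := Distr { distr_fun :> testE -> R; _ : distr_fun \in is_distribution }.
HB.instance Definition _ := [isSub for distr_fun].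
HB.instance Definition _ := [Choice of distr by <:].
HB.instance Definition _ := [SubChoice_isSubLmodule of distr by <:].

Definition power_distr_fun p (h : H) (xi : testE) : R := dot h (iter p A (xi : H)).

Lemma power_distr_subproof p h : power_distr_fun p h \in is_distribution.
Proof.
apply/asboolP; split=> [a xi eta|].
  by rewrite /power_distr_fun/= iter_linear ?(valP xi) ?(valP eta)// dotDr dotZr.
exists p, (norm0 h) => xi; apply: le_trans (cauchy_schwarz _ _) _.
rewrite ler_wpM2l ?norm0_ge0// big_ord_recr/= lerDr.
by apply: sumr_ge0 => i _; exact: norm0_ge0.
Qed.

(* A^p h as an element of E^*, for an arbitrary h in H *)
Definition power_distr p (h : H) : distr := Distr (power_distr_subproof p h).

End TestFunctions.

Section Tensors.
Context (R : realType) (A : operator R).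
Local Notation H := (L2R R).
Local Notation E' := (distr A).

(* The n-th tensor power of E_C is the projective limit over p of the n-th Hilbert
   tensor powers of the completions of E_C for |.|_p. An element f of it is
   represented by the R-n-linear form (x_1, ..., x_n) |-> <x_1 (x) ... (x) x_n, f>
   on E^*; those forms are the ones with all norms |.|_p below finite. *)
Definition nform n := ('I_n -> E') -> R[i].

Definition set_arg n (x : 'I_n -> E') (k : 'I_n) (y : E') : 'I_n -> E' :=
  fun j => if j == k then y else x j.

Definition multilinear n (F : nform n) := forall x k a y z,
  F (set_arg x k (a *: y + z)) =
  (a%:C)%C * F (set_arg x k y) + F (set_arg x k z).

Definition orthonormal m (u : 'I_m -> H) :=
  forall i j, dot (u i) (u j) = (i == j)%:R.

(* Squared norm of G in the n-th Hilbert tensor power of H_C (seen as the space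
   of Hilbert-Schmidt forms on H^n): since G (u_1, ..., u_n) is the coefficient
   of G on u_1 (x) ... (x) u_n, this is the supremum of the square sums of the
   coefficients over finite orthonormal product systems. *)
Definition hs_norm2 n (G : ('I_n -> H) -> R[i]) : \bar R :=
  ereal_sup [set s | exists m (u : 'I_n -> 'I_m -> H),
    (forall k, orthonormal (u k)) /\
    s = (\sum_(i : {ffun 'I_n -> 'I_m})
          Normc.normc (G (fun k => u k (i k))) ^+ 2)%:E].

(* |F|_p^2, where |F|_p is the Hilbert norm of (A^p)^{(x) n} F *)
Definition form_norm2 n p (F : nform n) : \bar R :=
  hs_norm2 (fun h => F (fun k => power_distr A p (h k))).

(* the n-th tensor power of E_C, and its symmetric part *)
Definition tensor n (F : nform n) :=
  multilinear F /\ forall p, (form_norm2 p F < +oo)%E.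

Definition permute n (s : 'S_n) (F : nform n) : nform n := fun x => F (x \o s).

Definition sym_tensor n (F : nform n) :=
  tensor F /\ forall s, permute s F = F.

Definition symmetrize n (F : nform n) : nform n :=
  fun x => (n`!%:R)^-1 * \sum_(s : 'S_n) permute s F x.

(* Functionals on the n-th tensor power of E_C; the values outside of tensor
   are irrelevant. *)
Definition functional n := nform n -> R[i].

Definition dual_tensor n (K : functional n) :=
  (forall a F G, tensor F -> tensor G ->
     K (fun x => a * F x + G x) = a * K F + K G) /\
  exists p c, forall F, tensor F ->
    ((Normc.normc (K F) ^+ 2)%:E <= c%:E * \sum_(q < p.+1) form_norm2 q F)%E.

Definition sym_dual_tensor n (K : functional n) :=
  dual_tensor K /\ forall s F, tensor F -> K (permute s F) = K F.

Definition concat (X : Type) a b (x : 'I_a -> X) (y : 'I_b -> X) :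
    'I_(a + b) -> X :=
  fun i => match fintype.split i with inl j => x j | inr j => y j end.

(* K (x) L acts by contracting the last b variables with L, the others with K *)
Definition tprod a b (K : functional a) (L : functional b) :
    functional (a + b) :=
  fun F => K (fun x => L (fun y => F (concat x y))).

Definition sym_tprod a b (K : functional a) (L : functional b) :
    functional (a + b) :=
  fun F => tprod K L (symmetrize F).

Fixpoint sym_power m (K : functional m) k : functional (k * m)%N :=
  match k with
  | 0 => fun F => F (fun=> 0)
  | k'.+1 => sym_tprod K (@sym_power m K k')
  end.
Arguments sym_power {m} K k.

Definition point_power n (x : E') : functional n := fun F => F (fun=> x).
Arguments point_power n x F : clear implicits.

Definition cast_functional a b (e : a = b) (K : functional a) : functional b :=
  fun F => K (fun x => F (fun i => x (cast_ord (esym e) i))).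

Lemma wick_subproof n m (k : 'I_(n %/ m).+1) : (n - k * m + k * m = n)%N.
Proof.
apply: subnK; apply: leq_trans (leq_divM n m).
by rewrite leq_mul2r -ltnS ltn_ord orbT.
Qed.

(* the generalized Wick tensor :x^{(x) n}:_K *)
Definition wick m (K : functional m) n (x : E') : functional n := fun F =>
  \sum_(k < (n %/ m).+1)
    n`!%:R / ((n - k * m)`!%:R * k`!%:R) * (- (1 / 2)) ^+ k *
    cast_functional (wick_subproof k)
      (sym_tprod (point_power (n - k * m) x) (sym_power K k)) F.

Definition trace_spec (tau : functional 2) := dual_tensor tau /\
  forall xi eta : testE A,
    tau (fun x => ((x ord0 xi * x ord_max eta)%:C)%C) = ((dot (xi : H) (eta : H))%:C)%C.

Definition pointwise_sum (u : nat -> E' -> R[i]) (phi : E' -> R[i]) :=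
  forall x, (fun N => Normc.normc (\sum_(n < N) u n x - phi x)) @ \oo --> 0.

Definition chaos_norm2 (beta : R) p (f : forall n, nform n) : \bar R :=
  (\sum_(0 <= n <oo) ((n`!%:R `^ (1 + beta))%R%:E * form_norm2 p (f n)))%E.

(* f is the sequence of coefficients of the element phi of (E)_beta; the function
   phi on E^* is the pointwise sum, i.e. the continuous version *)
Definition chaos (tau : functional 2) (beta : R) (phi : E' -> R[i])
    (f : forall n, nform n) :=
  [/\ forall n, sym_tensor (f n),
      forall p, (chaos_norm2 beta p f < +oo)%E &
      pointwise_sum (fun n x => wick tau x (f n)) phi].

Definition test_space tau beta : set (E' -> R[i]) :=
  [set phi | exists f, chaos tau beta phi f].

(* |phi|_{p,beta}^2. The coefficients f of phi are unique, so that the infimum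
   is over at most one value; it is +oo when phi is not in (E)_beta. *)
Definition test_norm2 tau beta p (phi : E' -> R[i]) : \bar R :=
  ereal_inf [set chaos_norm2 beta p f | f in chaos tau beta phi].

Definition test_cvg tau beta (u : nat -> E' -> R[i]) (phi : E' -> R[i]) :=
  (forall N, test_space tau beta (u N)) /\
  forall p, (fun N => test_norm2 tau beta p (u N - phi)) @ \oo --> 0%E.

End Tensors.

(* Main.v *)
Require Import Defs.
From mathcomp Require Import all_boot all_order all_algebra.
From mathcomp Require Import fingroup perm complex.
From mathcomp Require Import all_classical all_reals all_analysis.
From mathcomp Require Import measurable_realfun ring lra zify.

(** A function on E^* of the form phi(x) = sum_n <x^n, g_n> is determined by its
    Taylor coefficients g = (g_n), and a symmetric functional K on the r-th tensor
    power acts on coefficients by the operator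
    D_K f = ((n + r)! / n!) (contraction of f_(n + r) with K)_n.
    By definition of the Wick tensors, sum_n <:x^n:_K, f_n> has the Taylor
    coefficients exp (- D_K / 2) f. For K = tau this is the definition of (E)_beta,
    and the theorem says that the equation
    exp (- D_kappa / 2) psi = exp (- D_tau / 2) f
    has one solution psi. It is psi = exp (D_kappa / 2) exp (- D_tau / 2) f,
    provided that the exponentials are continuous operators on the space of
    coefficients normed by |.|_(p, beta) and that exp (a D_K) and exp (- a D_K) are
    inverse to each other.

    Continuity ([contraction_exp_bound]) is where r and beta meet. The k-th term of
    exp (a D_K) f in degree n is a^k / k! (n + k r)! / n! times a contraction of
    f_N, with N = n + k r. Relative to the weights (n!)^(1 + beta) of the squared
    norms this leaves the factor (N! / n!)^(1 - beta) / (k!)^2, up to powers of constants,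
    and N! / n! is at most (C^N k!)^r; the condition r (1 - beta) <= 2 says that the
    factorials cancel ([weight_ratio]). The remaining factor L^N is absorbed by
    passing from the norm of order p to the one of order p + q: as the spectrum of A
    lies above some l > 1, this gains l^(- q N) ([tnorm2_shift]). The group law
    ([contraction_exp_inv]) is a binomial identity on finitely many degrees, and
    extends by continuity.

    For uniqueness, the Taylor coefficients of a function are determined by its
    values: replacing x by t x separates the degrees, and polarization separates the
    variables ([diag_sum_inj]). Hence the convergence in (E)_beta of the partial sums
    of a decomposition psi' is convergence of chaos coefficients, and applying
    the continuous operator exp (D_kappa / 2) exp (- D_tau / 2) to them gives
    convergence of the truncations of psi' to psi, in each degree.

    Two facts about operators on L^2 support this. The inverse B of A is bounded
    by some rho < 1, because the supremum M of (Bu, u) over the unit ball satisfies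
    1 / M in the spectrum of A ([contractive_inverse_exists]). Every element of E^* is
    A^p h for some p and some h in L^2, by completeness of L^2 and the Riesz
    representation ([distr_repr]); tensors, which are known through
    their values on such elements, can thus be evaluated and contracted. Norms of
    tensors are computed in one orthonormal basis, as iterated sums over the letters
    of a word of basis vectors ([hs_norm2E]), so that every estimate reduces to
    an estimate in one variable ([slot_bound]). *)

Set Implicit Arguments.
Unset Strict Implicit.
Unset Printing Implicit Defensive.

Import Order.TTheory GRing.Theory Num.Theory.
Import numFieldNormedType.Exports.

Local Open Scope classical_set_scope.
Local Open Scope ring_scope.

Local Notation Re := complex.Re.
Local Notation Im := complex.Im.
Local Notation normc := Normc.normc.

(** * Weighted series of real and complex numbers *)

Section WeightedSeries.
Variable R : realType.
Implicit Types (a : nat -> R) (u : nat -> R[i]).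

(** Cauchy-Schwarz with the weights 2^-(k+1), whose sum is at most 1. Weighted
    sums of squares replace triangle inequalities in all that follows: squares of norms
    commute with sums and integrals, norms do not. *)
Lemma sqr_sum_le a n :
  (\sum_(0 <= k < n) a k) ^+ 2 <= \sum_(0 <= k < n) (2 ^+ k.+1 * a k ^+ 2).
Proof.
elim: n a => [|n IH] a; first by rewrite !big_nil expr0n.
rewrite big_nat_recl// [leRHS]big_nat_recl//.
have := IH (fun k => a k.+1); set S := \sum_(0 <= k < n) _.
have -> : \sum_(0 <= k < n) 2 ^+ k.+2 * a k.+1 ^+ 2
   = 2 * \sum_(0 <= k < n) 2 ^+ k.+1 * a k.+1 ^+ 2.
  by rewrite mulr_sumr; apply: eq_bigr => k _; rewrite [2 ^+ k.+2]exprS mulrA.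
have := sqr_ge0 (a 0%N - S); rewrite sqrrB sqrrD expr1; lra.
Qed.

Definition weighted_sum a : \bar R := (\sum_(0 <= k <oo) (2 ^+ k.+1 * a k ^+ 2)%:E)%E.

(** The partial sums of |a| are bounded, by [sqr_sum_le] applied to |a|. *)
Lemma weighted_sum_cvg a : (weighted_sum a < +oo)%E ->
  exists2 l : R, series a @ \oo --> l & ((l ^+ 2)%:E <= weighted_sum a)%E.
Proof.
move=> afin.
have w0 : (0 <= weighted_sum a)%E.
  by apply: nneseries_ge0 => k _ _; rewrite lee_fin mulr_ge0 ?sqr_ge0 ?exprn_ge0.
have bnd (b : nat -> R) n : (forall k, `|b k| = `|a k|) ->
    series b n ^+ 2 <= fine (weighted_sum a).
  move=> ba; rewrite -lee_fin fineK ?ge0_fin_numE//.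
  have -> : weighted_sum a = weighted_sum b.
    apply: eq_eseriesr => k _.
    by rewrite -(real_normK (num_real (a k))) -ba (real_normK (num_real (b k))).
  apply: le_trans (nneseries_lim_ge n _); last first.
    by move=> k _ _; rewrite lee_fin mulr_ge0 ?sqr_ge0 ?exprn_ge0.
  by rewrite sumEFin lee_fin; exact: sqr_sum_le.
have /cvg_ex[l al] : cvgn (series a).
  apply: (@normed_cvg _ R^o); apply: nondecreasing_is_cvgn.
    by apply: nondecreasing_series => n _ _; exact: normr_ge0.
  exists (1 + fine (weighted_sum a)) => _ [n _ <-].
  have := bnd (fun k => `|a k|) n (fun k => normr_id _).
  have := sqr_ge0 (series (fun k => `|a k|) n - 1).
  rewrite sqrrB expr1n mulr1.
  have : 0 <= series (fun k => `|a k|) n by apply: sumr_ge0.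
  suff: forall S W : R, 0 <= S -> 0 <= S ^+ 2 - S *+ 2 + 1 -> S ^+ 2 <= W ->
    S <= 1 + W by apply.
  by move=> S W; lra.
exists l => //; rewrite -(fineK (_ : weighted_sum a \is a fin_num)) ?ge0_fin_numE//.
rewrite lee_fin expr2; apply: (cvgr_to_le (cvgM al al)).
by near=> n; have := bnd a n (fun=> erefl); rewrite expr2.
Unshelve. all: by end_near. Qed.

Lemma sqr_normc (z : R[i]) : Normc.normc z ^+ 2 = Re z ^+ 2 + Im z ^+ 2.
Proof. by case: z => x y /=; rewrite sqr_sqrtr// addr_ge0 ?sqr_ge0. Qed.

Lemma normc_ge0 (z : R[i]) : 0 <= Normc.normc z.
Proof. by case: z => x y /=; exact: sqrtr_ge0. Qed.

Lemma le_Re_normc (z : R[i]) : `|Re z| <= Normc.normc z.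
Proof.
by rewrite -ler_sqr ?nnegrE ?normc_ge0// sqr_normc real_normK ?num_real// lerDl sqr_ge0.
Qed.

Lemma le_Im_normc (z : R[i]) : `|Im z| <= Normc.normc z.
Proof.
by rewrite -ler_sqr ?nnegrE ?normc_ge0// sqr_normc real_normK ?num_real// lerDr sqr_ge0.
Qed.

Lemma normc_le (z : R[i]) : Normc.normc z <= `|Re z| + `|Im z|.
Proof.
rewrite -ler_sqr ?nnegrE ?normc_ge0 ?addr_ge0// sqr_normc sqrrD !real_normK ?num_real//.
by rewrite lerD2r lerDl mulrn_wge0// mulr_ge0.
Qed.

Lemma ReB (x y : R[i]) : Re (x - y) = Re x - Re y.
Proof. by case: x; case: y. Qed.

Lemma ImB (x y : R[i]) : Im (x - y) = Im x - Im y.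
Proof. by case: x; case: y. Qed.

Lemma Re_sum (I : Type) (r : seq I) (F : I -> R[i]) :
  Re (\sum_(i <- r) F i) = \sum_(i <- r) Re (F i).
Proof. by apply: (big_morph (@Re R)) => // -[? ?] [? ?]. Qed.

Lemma Im_sum (I : Type) (r : seq I) (F : I -> R[i]) :
  Im (\sum_(i <- r) F i) = \sum_(i <- r) Im (F i).
Proof. by apply: (big_morph (@Im R)) => // -[? ?] [? ?]. Qed.

Definition ccvg u (l : R[i]) := (fun n => Normc.normc (u n - l)) @ \oo --> (0 : R).

Lemma ccvgP u l : ccvg u l <->
  ((fun n => Re (u n)) @ \oo --> Re l /\ (fun n => Im (u n)) @ \oo --> Im l).
Proof.
split=> [ul|[ul1 ul2]].
  split; apply/cvgrPdistC_lt => e e0; near=> n.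
    rewrite -ReB; apply: le_lt_trans (le_Re_normc _) _.
    rewrite -[ltLHS]ger0_norm ?normc_ge0//; near: n.
    by move/cvgr0Pnorm_lt: ul => /(_ _ e0).
  rewrite -ImB; apply: le_lt_trans (le_Im_normc _) _.
  rewrite -[ltLHS]ger0_norm ?normc_ge0//; near: n.
  by move/cvgr0Pnorm_lt: ul => /(_ _ e0).
apply: (@squeeze_cvgr _ _ _ _ (fun=> 0) (fun n => `|Re (u n) - Re l| + `|Im (u n) - Im l|)).
- by near=> n; rewrite normc_ge0/= -ReB -ImB normc_le.
- exact: cvg_cst.
- rewrite -[X in _ --> X]addr0; apply: cvgD.
    rewrite -(normr0 R); apply: cvg_norm; rewrite -(subrr (Re l)).
    by apply: cvgB => //; exact: cvg_cst.
  rewrite -(normr0 R); apply: cvg_norm; rewrite -(subrr (Im l)).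
  by apply: cvgB => //; exact: cvg_cst.
Unshelve. all: by end_near. Qed.

Lemma ccvg_unique u l l' : ccvg u l -> ccvg u l' -> l = l'.
Proof.
move=> /ccvgP[a b] /ccvgP[c d]; have := cvg_unique _ a c; have := cvg_unique _ b d.
by case: l {a b} => ? ?; case: l' {c d} => ? ? /= -> // ->.
Qed.

Lemma ccvg_lin (a : R[i]) u v l m : ccvg u l -> ccvg v m ->
  ccvg (fun n => a * u n + v n) (a * l + m).
Proof.
move=> /ccvgP[ur ui] /ccvgP[vr vi].
case: a l m ur ui vr vi => a b [l1 l2] [m1 m2] /= ur ui vr vi; apply/ccvgP.
rewrite (_ : (fun n => Re _) = fun n => a * Re (u n) - b * Im (u n) + Re (v n)); last first.
  by apply/funext => n; case: (u n) => ? ?; case: (v n).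
rewrite (_ : (fun n => Im _) = fun n => a * Im (u n) + b * Re (u n) + Im (v n)); last first.
  by apply/funext => n; case: (u n) => ? ?; case: (v n).
by split; apply: cvgD => //; [apply: cvgB|apply: cvgD]; apply: cvgM => //; exact: cvg_cst.
Qed.

Lemma eq_ccvg u v l : (forall n, u n = v n) -> ccvg u l -> ccvg v l.
Proof. by move=> /funext ->. Qed.

(** The sum of a series, with the default value 0 when the series diverges. *)
Definition complex_series u : R[i] := xget 0 [set l | ccvg (fun n => \sum_(0 <= k < n) u k) l].

Lemma complex_seriesE u l : ccvg (fun n => \sum_(0 <= k < n) u k) l -> complex_series u = l.
Proof.
move=> ul; rewrite /complex_series; case: xgetP => [m _ um|/(_ l)//].
exact: ccvg_unique um ul.
Qed.

Definition weighted_normc u : \bar R := weighted_sum (fun k => Normc.normc (u k)).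

Lemma weighted_normcE u :
  weighted_normc u = (weighted_sum (fun k => Re (u k)) + weighted_sum (fun k => Im (u k)))%E.
Proof.
rewrite /weighted_normc/weighted_sum -nneseriesD.
- by apply: eq_eseriesr => k _; rewrite -EFinD -mulrDr sqr_normc.
- by move=> k _ _; rewrite lee_fin mulr_ge0 ?sqr_ge0 ?exprn_ge0.
- by move=> k _ _; rewrite lee_fin mulr_ge0 ?sqr_ge0 ?exprn_ge0.
Qed.

Lemma weighted_sum_ge0 a : (0 <= weighted_sum a)%E.
Proof.
by apply: nneseries_ge0 => k _ _; rewrite lee_fin mulr_ge0 ?sqr_ge0 ?exprn_ge0.
Qed.

Lemma complex_seriesP u : (weighted_normc u < +oo)%E ->
  ccvg (fun n => \sum_(0 <= k < n) u k) (complex_series u) /\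
  ((Normc.normc (complex_series u) ^+ 2)%:E <= weighted_normc u)%E.
Proof.
rewrite weighted_normcE => ufin.
have [|l1 c1 b1] := @weighted_sum_cvg (fun k => Re (u k)).
  by apply: le_lt_trans ufin; rewrite leeDl ?weighted_sum_ge0.
have [|l2 c2 b2] := @weighted_sum_cvg (fun k => Im (u k)).
  by apply: le_lt_trans ufin; rewrite leeDr ?weighted_sum_ge0.
have c : ccvg (fun n => \sum_(0 <= k < n) u k) (l1 +i* l2)%C.
  apply/ccvgP => /=; split.
    by rewrite (_ : (fun n => _) = series (fun k => Re (u k)))//; apply/funext => n;
       rewrite Re_sum.
  by rewrite (_ : (fun n => _) = series (fun k => Im (u k)))//; apply/funext => n;
     rewrite Im_sum.
rewrite (complex_seriesE c); split=> //.
by rewrite sqr_normc EFinD leeD.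
Qed.

Lemma geometric_eseries_le (c x : R) : 0 <= c -> 0 < x -> x < 1 ->
  (\sum_(0 <= k <oo) (c * x ^+ k)%:E <= (c / (1 - x))%:E)%E.
Proof.
move=> c0 x0 x1.
have := @is_cvg_nneseries R (fun k => (c * x ^+ k)%:E) xpredT 0.
move=> /(_ _)/cvge_to_le; apply.
  by move=> k _ _; rewrite lee_fin mulr_ge0// exprn_ge0// ltW.
apply: nearW => n; rewrite sumEFin lee_fin.
by apply: (@geometric_le_lim R n c x) => //; rewrite gtr0_norm.
Qed.

End WeightedSeries.

(** * Completeness of the space of square integrable functions *)

Section Completeness.
Context d (T : measurableType d) (R : realType).
Variable mu : {measure set T -> \bar R}.
Local Notation H := (L2space mu).
Implicit Types (u v w : H).

Lemma dot0l v : dot 0 v = 0.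
Proof. by have := dotZl 0 0 v; rewrite scale0r mul0r. Qed.

Lemma dotNl u v : dot (- u) v = - dot u v.
Proof. by rewrite -scaleN1r dotZl mulN1r. Qed.

Lemma dotBl u u' v : dot (u - u') v = dot u v - dot u' v.
Proof. by rewrite dotDl dotNl. Qed.

Lemma dotNr u v : dot u (- v) = - dot u v.
Proof. by rewrite dotC dotNl dotC. Qed.

Lemma dotBr u v v' : dot u (v - v') = dot u v - dot u v'.
Proof. by rewrite dotDr dotNr. Qed.

Lemma dot_suml (I : Type) (r : seq I) (F : I -> H) v :
  dot (\sum_(i <- r) F i) v = \sum_(i <- r) dot (F i) v.
Proof. by apply: (big_morph (fun u => dot u v)); [move=> ? ?; exact: dotDl|exact: dot0l]. Qed.

Lemma dot_sumr (I : Type) (r : seq I) (F : I -> H) v :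
  dot v (\sum_(i <- r) F i) = \sum_(i <- r) dot v (F i).
Proof. by rewrite dotC dot_suml; apply: eq_bigr => i _; rewrite dotC. Qed.

Lemma norm0_sq u : norm0 u ^+ 2 = dot u u.
Proof. by rewrite /norm0 sqr_sqrtr// dot_ge0. Qed.

Lemma cauchy_schwarz_sq u v : dot u v ^+ 2 <= dot u u * dot v v.
Proof.
rewrite -!norm0_sq -exprMn -(real_normK (num_real (dot u v))).
by rewrite ler_sqr ?nnegrE ?mulr_ge0 ?norm0_ge0//; exact: cauchy_schwarz.
Qed.

Lemma dot_sqE u : (dot u u)%:E = (\int[mu]_x (((u : T -> R) x) ^+ 2)%:E)%E.
Proof.
rewrite /dot /Rintegral fineK; last exact/integrable_fin_num/dot_integrable.
by apply: eq_integral => x _; rewrite expr2.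
Qed.

Lemma dot_sq_ae u (h : T -> R) : measurable_fun setT h -> (u : T -> R) = h %[ae mu] ->
  (dot u u)%:E = (\int[mu]_x (h x ^+ 2)%:E)%E.
Proof.
move=> mh uh; rewrite dot_sqE; apply: ae_eq_integral => //.
- by apply/measurable_EFinP; apply: measurable_funX; exact: L2_measurable.
- by apply/measurable_EFinP; apply: measurable_funX.
- by apply: filterS uh => x /= -> .
Qed.

Lemma L2N_ae u : ((- u : H) : T -> R) = (fun x => - (u : T -> R) x) %[ae mu].
Proof.
rewrite -scaleN1r; have h := L2Z_ae (-1) u.
by apply: filterS h => x /= -> // _; rewrite mulN1r.
Qed.

Lemma L2B_ae u v : ((u - v : H) : T -> R) = (fun x => (u : T -> R) x - (v : T -> R) x)
  %[ae mu].
Proof.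
have h1 := L2D_ae u (- v); have h2 := L2N_ae v.
by apply: filterS2 h1 h2 => x /= -> // ->.
Qed.

Lemma L2sum_ae (v : nat -> H) n :
  ((\sum_(0 <= k < n) v k : H) : T -> R) = (fun x => \sum_(0 <= k < n) (v k : T -> R) x)
  %[ae mu].
Proof.
elim: n => [|n IH].
  rewrite big_nil; have h := L2Z_ae 0 (0 : H); rewrite scale0r in h.
  by apply: filterS h => x /= -> // _; rewrite mul0r big_nil.
rewrite big_nat_recr//=; have h := L2D_ae (\sum_(0 <= k < n) v k) (v n).
by apply: filterS2 h IH => x /= -> // -> // _; rewrite big_nat_recr.
Qed.

Lemma Lfun2P (g : T -> R) : measurable_fun setT g ->
  (\int[mu]_x (g x ^+ 2)%:E < +oo)%E -> g \in Lfun mu 2%:R%:E.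
Proof.
move=> mg gfin; apply/andP; split; rewrite inE//=.
rewrite /finite_norm unlock; apply: poweR_lty.
rewrite (_ : (\int[mu]_x _)%E = (\int[mu]_x (g x ^+ 2)%:E)%E)//.
by apply: eq_integral => x _ /=; rewrite powR_mulrn// real_normK ?num_real.
Qed.

(** Where the weighted sum of the squares of the v k t is finite, the series of
    the v k t converges, and its n-th tail is bounded by the weighted sum of the squares
    of the tail. That sum has a finite integral, so it is finite almost everywhere;
    integrating the bound on the tail gives the estimate. *)
Lemma riesz_fischer (v : nat -> H) : (forall k, dot (v k) (v k) <= 8^-1 ^+ k) ->
  exists g : H, forall n, dot (g - \sum_(0 <= k < n) v k) (g - \sum_(0 <= k < n) v k)
     <= 4 * 8^-1 ^+ n.
Proof.
move=> vb; pose V k : T -> R := v k.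
have mV k : measurable_fun setT (V k) by exact: L2_measurable.
(* Weighted squares of the terms of index N and above; W N is their sum. *)
pose F N k x : \bar R := (2 ^+ k.+1 * V (N + k)%N x ^+ 2)%:E.
have F0 N k x : (0 <= F N k x)%E by rewrite lee_fin mulr_ge0 ?sqr_ge0 ?exprn_ge0.
have mF N k : measurable_fun setT (F N k).
  apply/measurable_EFinP; apply: measurable_funM => //.
  exact: measurable_funX.
pose W N x := weighted_sum (fun k => V (N + k)%N x).
have mW N : measurable_fun setT (W N).
  by apply: (@ge0_emeasurable_sum _ _ _ setT (F N) xpredT).
have intW N : (\int[mu]_x W N x <= (4 * 8^-1 ^+ N)%:E)%E.
  rewrite (@integral_nneseries _ _ _ mu setT measurableT (F N))//.
  apply: (@le_trans _ _ (\sum_(0 <= k <oo) (2 * 8^-1 ^+ N * 4^-1 ^+ k)%:E)%E).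
    apply: lee_nneseries => k; first by move=> _ _; apply: integral_ge0.
    move=> _; rewrite /F; under eq_integral do rewrite EFinM.
    rewrite ge0_integralZl_EFin//; last 2 first.
    - by move=> x _; rewrite lee_fin sqr_ge0.
    - by apply/measurable_EFinP; exact: measurable_funX.
    have -> : (\int[mu]_x (V (N + k)%N x ^+ 2)%:E)%E = (dot (v (N + k)%N) (v (N + k)%N))%:E.
      by rewrite dot_sqE.
    rewrite -EFinM lee_fin.
    apply: le_trans (ler_wpM2l _ (vb (N + k)%N)) _; first by rewrite exprn_ge0.
    rewrite exprD exprS -!mulrA ler_pM2l// mulrCA ler_pM2l ?exprn_gt0// -exprMn.
    by rewrite (_ : 2 * 8^-1 = 4^-1)//; field.
  have e0 : 0 <= (8^-1 : R) ^+ N by rewrite exprn_ge0.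
  apply: le_trans (geometric_eseries_le _ _ _) _; rewrite ?mulr_ge0 ?invf_lt1 ?ltr1n//.
  rewrite lee_fin ler_pdivrMr; last by rewrite subr_gt0 invf_lt1 ?ltr1n.
  move: (_ ^+ N) e0 => y; lra.
have tail N x : (W 0%N x < +oo)%E -> (W N x < +oo)%E.
  apply: le_lt_trans; rewrite /W/weighted_sum.
  apply: (@le_trans _ _ (\sum_(0 <= k <oo) F 0%N (k + N)%N x)%E).
    apply: lee_nneseries => k; first by move=> _ _; exact: F0.
    move=> _; rewrite lee_fin /= add0n addnC ler_wpM2r ?sqr_ge0//.
    by rewrite ler_weXn2l ?ler1n// ltnS leq_addr.
  rewrite (@nneseries_addn _ (fun k => F 0%N k x))//.
  by rewrite [leRHS](@nneseries_split _ (fun k => F 0%N k x) 0%N N)// leeDr// sume_ge0.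
pose D := [set x | (W 0%N x < +oo)%E].
have mD : measurable D.
  by rewrite /D -[X in measurable X]setTI; exact: emeasurable_fun_infty_o.
pose s n x := (\sum_(0 <= k < n) V k x) * \1_D x.
pose g x : R := limn (s ^~ x).
have ms n : measurable_fun setT (s n).
  apply: measurable_funM; first exact: measurable_sum.
  by [].
have sD n x : D x -> s n x = series (V ^~ x) n.
  by move=> Dx; rewrite /s indicE mem_set// mulr1.
have sND n x : ~ D x -> s n x = 0.
  by move=> Dx; rewrite /s indicE memNset// mulr0.
have sg x : s ^~ x @ \oo --> g x.
  have [Dx|Dx] := pselect (D x); last first.
    rewrite /g (_ : s ^~ x = fun=> 0); last by apply/funext => n; exact: sND.
    by rewrite lim_cst//; exact: cvg_cst.
  have [l sl _] := weighted_sum_cvg Dx; apply/cvg_ex; exists l.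
  by rewrite (_ : s ^~ x = series (V ^~ x))//; apply/funext => n; exact: sD.
have mg : measurable_fun setT g by apply: (measurable_fun_cvg (h := s)) => [m|x _]; [exact: ms|exact: sg].
have gtail n x : (((g x - s n x) ^+ 2)%:E <= W n x)%E.
  have [Dx|Dx] := pselect (D x); last first.
    have -> : g x = 0.
      rewrite /g (_ : s ^~ x = fun=> 0); first by rewrite lim_cst.
      by apply/funext => m; exact: sND.
    by rewrite sND// subrr expr0n weighted_sum_ge0.
  have [l sl lW] := weighted_sum_cvg (tail n x Dx).
  suff -> : g x - s n x = l by [].
  suff h : series (fun k => V (n + k)%N x) @ \oo --> g x - s n x.
    exact: cvg_unique h sl.
  rewrite sD//.
  rewrite (_ : series (fun k => _) = fun m => series (V ^~ x) (m + n)%N - series (V ^~ x) n).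
    apply: cvgB; last exact: cvg_cst.
    rewrite (cvg_shiftn n (series (V ^~ x))).
    by rewrite (_ : series (V ^~ x) = s ^~ x)//; apply/funext => m; rewrite sD.
  apply/funext => m; rewrite /series/= [in X in X - _]addnC.
  rewrite [in X in X - _](@big_cat_nat _ _ _ n)//= ?leq_addr// addrAC subrr add0r.
  rewrite -[X in _ = \sum_(X <= _ < _) _]add0n big_addn addKn; apply: eq_bigr => k _.
  by rewrite addnC.
have gfin : (\int[mu]_x (g x ^+ 2)%:E < +oo)%E.
  apply: le_lt_trans (ltry (4 * 8^-1 ^+ 0)); apply: le_trans (intW 0%N).
  apply: ge0_le_integral => //.
  - by move=> x _; rewrite lee_fin sqr_ge0.
  - by apply/measurable_EFinP; exact: measurable_funX.
  - by move=> x _; have := gtail 0%N x; rewrite /s big_nil mul0r subr0.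
pose G : H := ofL (Lfun_Sub (lee1n 2) (Lfun2P mg gfin)).
have GE : (G : T -> R) = g %[ae mu] by exact: ofLE.
have aeD : {ae mu, forall x, D x}.
  have : mu.-integrable setT (W 0%N).
    apply/integrableP; split => //.
    under eq_integral do rewrite gee0_abs ?weighted_sum_ge0//.
    exact: le_lt_trans (intW 0%N) (ltry _).
  move=> /(integrable_ae measurableT); apply: filterS => x /(_ I) Wx.
  by rewrite /D/= -ge0_fin_numE ?weighted_sum_ge0.
exists G => n; rewrite -lee_fin.
rewrite (@dot_sq_ae _ (fun x => g x - s n x)).
- apply: le_trans (intW n); apply: ge0_le_integral => //.
  + by move=> x _; rewrite lee_fin sqr_ge0.
  + apply/measurable_EFinP; apply: measurable_funX.
    exact: measurable_funB.
- exact: measurable_funB.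
- have h1 := L2B_ae G (\sum_(0 <= k < n) v k).
  have h2 := L2sum_ae v n.
  have h3 : {ae mu, forall x, D x /\ (G : T -> R) x = g x}.
    by apply: filterS2 aeD GE => x /= Dx ->.
  apply: filterS3 h1 h2 h3 => x /= -> // -> // [Dx ->] _.
  by rewrite sD.
Qed.
End Completeness.

(** * Riesz representation *)

Section Riesz.
Context d (T : measurableType d) (R : realType).
Variable mu : {measure set T -> \bar R}.
Local Notation H := (L2space mu).

Lemma le0_geometric (x K : R) : (forall n, x <= K * 8^-1 ^+ n) -> x <= 0.
Proof.
move=> xK.
have c : geometric K (8^-1 : R) @ \oo --> 0.
  by apply: cvg_geometric; rewrite gtr0_norm ?invf_lt1 ?ltr1n.
by apply: (cvgr_to_ge c); apply: nearW => n; exact: xK.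
Qed.

Lemma L2_complete (u : nat -> H) :
  (forall n, dot (u n.+1 - u n) (u n.+1 - u n) <= 8^-1 ^+ n) ->
  exists g : H, forall n, dot (g - u n) (g - u n) <= 4 * 8^-1 ^+ n.
Proof.
move=> /riesz_fischer[g gb]; exists (g + u 0%N) => n.
have := gb n; rewrite telescope_sumr// opprB addrA addrAC [_ - _ + _]addrAC.
by rewrite -addrA addrC -addrA [- _ + _]addrC addrA addrAC.
Qed.

(** A minimizing sequence of J u = |iota u|^2 - 2 y u is Cauchy in H, by
    the parallelogram identity. The first variation of J vanishes at its limit h in
    the directions iota v, which says that h represents y. *)
Lemma riesz_representation (V : lmodType R) (iota : V -> H) (y : V -> R) (c : R) :
  (forall a u v, iota (a *: u + v) = a *: iota u + iota v) ->
  (forall a u v, y (a *: u + v) = a * y u + y v) ->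
  (forall u, y u ^+ 2 <= c * dot (iota u) (iota u)) ->
  exists h : H, forall u, y u = dot h (iota u).
Proof.
move=> iotaL yL yb.
pose J u := dot (iota u) (iota u) - 2 * y u.
have JE a u v : J (a *: u + v) =
    a ^+ 2 * dot (iota u) (iota u) + 2 * a * (dot (iota v) (iota u) - y u) + J v.
  rewrite /J iotaL yL !dotDl !dotDr !dotZl !dotZr (dotC (iota u) (iota v)); ring.
have JB u : - `|c| <= J u.
  rewrite /J leNgt; apply/negP => h.
  have := yb u; have := dot_ge0 (iota u); have := ler_norm c; have := normr_ge0 c.
  move: (dot _ _) (y u) `|c| h => D Y k h k0 ck iter_contract0 Yb.
  have : (D + k) ^+ 2 < (2 * Y) ^+ 2 by rewrite ltr_sqr ?nnegrE; lra.
  have := sqr_ge0 (D - k); nra.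
have infJ : has_inf (range J).
  by split; [exists (J 0), 0|exists (- `|c|) => _ [u _ <-]].
pose m := inf (range J).
have mJ u : m <= J u by apply: ge_inf; [case: infJ|exists u].
pose dl n : R := 8^-1 ^+ n / 4.
have dl0 n : 0 < dl n by rewrite divr_gt0 ?exprn_gt0.
have uP n : exists u, J u < m + dl n.
  by have [_ [u _ <-] hu] := inf_adherent (dl0 n) infJ; exists u.
have [u uJ] := choice uP.
have [|h hu] := @L2_complete (fun n => iota (u n)).
  move=> n; have dE : iota (u n.+1) - iota (u n) = iota (u n.+1 - u n).
    by rewrite -[u n.+1 - u n]addrC -scaleN1r iotaL scaleN1r addrC.
  rewrite dE; set w := u n.+1 - u n.
  have := JE 1 w (u n); rewrite scale1r subrK => h1.
  have := JE (1 / 2) w (u n); have := mJ ((1 / 2) *: w + u n).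
  move: (dot (iota (u n)) _) (uJ n) (uJ n.+1) h1 => D; rewrite /dl exprS.
  have : 0 <= (8^-1 : R) ^+ n by rewrite exprn_ge0.
  move: (_ ^+ n) (J (_ + _)) => *; lra.
exists h => v; apply/eqP; rewrite -subr_eq0 -sqrf_eq0 eq_le sqr_ge0 andbT.
set e := dot (iota v) (iota v).
have e0 : 0 <= e by exact: dot_ge0.
apply: (@le0_geometric _ (2 * (e + 1) + 8 * e)) => n.
set x := dot (iota (u n)) (iota v) - y v.
have x1 : x ^+ 2 <= dl n * (e + 1).
  have := mJ (- (x / (e + 1)) *: v + u n); rewrite JE -/e -/x.
  have := uJ n; set t := x / (e + 1).
  have -> : x = t * (e + 1) by rewrite divfK// gt_eqF// ltr_wpDl.
  move: (m) (J _) => M j h1 h2.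
  have h3 : 0 <= dl n - t ^+ 2 * (e + 1) - t ^+ 2 by nra.
  nra.
have x2 : (dot h (iota v) - y v - x) ^+ 2 <= 4 * 8^-1 ^+ n * e.
  apply: le_trans (ler_wpM2r e0 (hu n)).
  by rewrite -[_ - x](_ : dot (h - iota (u n)) (iota v) = _) ?cauchy_schwarz_sq// dotBl /x; ring.
move: x1 x2; rewrite /dl; move: (dot h _) (y v) (8^-1 ^+ n) x e e0 => a b w x e e0 x1 x2.
have := sqr_ge0 (2 * x - (a - b)); nra.
Qed.

End Riesz.

(** * Orthonormal bases and the inverse operator *)

Section OrthonormalBasis.
Context (R : realType).
Local Notation H := (L2R R).
Variables (e : nat -> H) (he : orthonormal_basis e).

Lemma dot_basis_sum (c : nat -> R) n j :
  dot (\sum_(i < n) c i *: e i) (e j) = if (j < n)%N then c j else 0.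
Proof.
rewrite dot_suml; under eq_bigr do rewrite dotZl he.1.
case: ltnP => jn.
  rewrite (bigD1 (Ordinal jn))//= eqxx mulr1 big1 ?addr0// => i ij.
  rewrite (_ : (i == j :> nat) = false) ?mulr0//; apply/negP => /eqP E.
  by case/eqP: ij; exact: val_inj.
rewrite big1// => i _; rewrite (_ : (i == j :> nat) = false) ?mulr0//.
by apply/negP => /eqP E; move: (ltn_ord i); rewrite E ltnNge jn.
Qed.

Lemma dot_basis_sum2 (c : nat -> R) n :
  dot (\sum_(i < n) c i *: e i) (\sum_(i < n) c i *: e i) = \sum_(i < n) c i ^+ 2.
Proof.
rewrite dot_sumr.
by apply: eq_bigr => i _; rewrite dotZr dot_basis_sum ltn_ord expr2.
Qed.

Definition partial_proj n (h : H) : H := \sum_(i < n) dot h (e i) *: e i.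

Lemma dot_sub_partial_proj n h :
  dot (h - partial_proj n h) (h - partial_proj n h) = dot h h - \sum_(i < n) dot h (e i) ^+ 2.
Proof.
rewrite /partial_proj dotBl !dotBr (dot_basis_sum2 (fun i => dot h (e i))) (dotC _ h) dot_sumr.
under eq_bigr do rewrite dotZr -expr2.
by rewrite subrr subr0.
Qed.

(** Bessel's inequality: the difference is the squared norm of h - partial_proj n h. *)
Lemma bessel n h : \sum_(i < n) dot h (e i) ^+ 2 <= dot h h.
Proof. by rewrite -subr_ge0 -dot_sub_partial_proj dot_ge0. Qed.

Lemma partial_proj_cvg h : (fun n => dot (h - partial_proj n h) (h - partial_proj n h)) @ \oo --> 0.
Proof.
rewrite (_ : (fun n => _) =
    (fun n => norm0 (h - partial_proj n h)) \* (fun n => norm0 (h - partial_proj n h))).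
  by rewrite -[X in _ --> X](mulr0 0); apply: cvgM; exact: he.2.
by apply/funext => n /=; rewrite -expr2 norm0_sq.
Qed.

Lemma parseval h : (fun n => \sum_(i < n) dot h (e i) ^+ 2) @ \oo --> dot h h.
Proof.
rewrite (_ : (fun n => _) = fun n => dot h h - dot (h - partial_proj n h) (h - partial_proj n h)).
  rewrite -[X in _ --> X]subr0; apply: cvgB; first exact: cvg_cst.
  exact: partial_proj_cvg.
by apply/funext => n; rewrite dot_sub_partial_proj opprB addrC subrK.
Qed.

End OrthonormalBasis.
Arguments partial_proj_cvg {R e} he h.
Arguments parseval {R e} he h.

Section InverseOperator.
Context (R : realType) (A : operator R).
Local Notation H := (L2R R).

(** What the proof uses of a white noise operator: its inverse B, with a bound
    rho < 1 of its norm, and an orthonormal basis e. *)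
Record contractive_inverse (B : H -> H) (e : nat -> H) (rho : R) : Prop := ContractiveInverse {
  ci_dom : forall h, op_dom A (B h);
  ci_AB : forall h, A (B h) = h;
  ci_BA : forall u, op_dom A u -> B (A u) = u;
  ci_linear : forall a u v, B (a *: u + v) = a *: B u + B v;
  ci_sym : forall u v, dot (B u) v = dot u (B v);
  ci_rho_gt0 : 0 < rho;
  ci_rho_lt1 : rho < 1;
  ci_bound : forall h, dot (B h) (B h) <= rho ^+ 2 * dot h h;
  ci_basis : orthonormal_basis e }.

(** Expanding Bh in the basis and moving B onto the basis vectors bounds
    B by its Hilbert-Schmidt norm. Let M be the supremum of (Bu, u) over the unit ball;
    it bounds the norm of B. If 1 / M were outside of the spectrum, A - 1 / M would have
    a bounded inverse; but A - 1 / M maps Bu to (M u - Bu) / M, which is small when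
    (Bu, u) is close to M, whereas Bu is not. Hence 1 / M > 1. *)
Lemma contractive_inverse_exists : white_noise_operator A ->
  exists B e rho, contractive_inverse B e rho.
Proof.
case=> -[dA sA] pA spA [B [rB1 rB2] [e [eb HS]]].
have AB h : A (B h) = h by have := (rB1 h).2; rewrite scale0r subr0.
have dB h : op_dom A (B h) := (rB1 h).1.
have BA u : op_dom A u -> B (A u) = u.
  by move=> du; have := rB2 u du; rewrite scale0r subr0.
have lB a u v : B (a *: u + v) = a *: B u + B v.
  by rewrite -{1}(AB u) -{1}(AB v) -op_linear// BA//; exact: op_domP.
have symA u v : op_dom A u -> op_dom A v -> dot (A u) v = dot u (A v).
  by move=> du dv; have /(_ u du) := (sA v (A v)).2 (conj dv erefl).
have symB u v : dot (B u) v = dot u (B v).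
  by rewrite -{1}(AB v) -symA// AB.
have posB u : 0 <= dot (B u) u by rewrite -{2}(AB u) dotC; exact: pA.
have [K bK] : exists K, forall h, dot (B h) (B h) <= K * dot h h.
  have fK : (\sum_(0 <= i <oo) (norm0 (B (e i)) ^+ 2)%:E)%E \is a fin_num.
    by rewrite ge0_fin_numE// nneseries_ge0// => i _ _; rewrite lee_fin sqr_ge0.
  exists (fine (\sum_(0 <= i <oo) (norm0 (B (e i)) ^+ 2)%:E)%E) => h.
  apply: (cvgr_to_le (parseval eb (B h))); apply: nearW => n.
  apply: (@le_trans _ _ (\sum_(i < n) dot (B (e i)) (B (e i)) * dot h h)).
    apply: ler_sum => i _; rewrite symB dotC.
    by apply: le_trans (cauchy_schwarz_sq _ _) _; rewrite mulrC.
  rewrite -mulr_suml ler_wpM2r ?dot_ge0// -lee_fin fineK//.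
  apply: le_trans (nneseries_lim_ge n _); last by move=> i _ _; rewrite lee_fin sqr_ge0.
  rewrite sumEFin lee_fin -(big_mkord xpredT (fun i => dot (B (e i)) (B (e i)))).
  by apply: ler_sum => i _; rewrite norm0_sq.
have e00 : dot (e 0%N) (e 0%N) = 1 by rewrite eb.1.
(* M is the supremum of the numerical range of B. *)
pose S := [set dot (B u) u | u in [set u | dot u u <= 1]].
have supS : has_sup S.
  split; first by exists (dot (B (e 0%N)) (e 0%N)), (e 0%N) => //=; rewrite e00.
  exists (`|K| + 1) => _ [u u1 <-] /=.
  have := cauchy_schwarz_sq (B u) u; have := bK u; have := ler_norm K.
  have := dot_ge0 (B u); have := dot_ge0 u; have := normr_ge0 K; move: u1 => /=.
  move: (dot _ u) (dot u u) (dot (B u) (B u)) `|K| => x y z k y1 k0 y0 z0 Kk zK xz.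
  rewrite leNgt; apply/negP => h; clear - y1 k0 y0 z0 Kk zK xz h.
  have z2 : z <= k by nra.
  have x2 : x ^+ 2 <= k by nra.
  nra.
pose M := sup S.
have BZ a u : B (a *: u) = a *: B u.
  have B0 : B 0 = 0.
    by have := lB 1 0 0; rewrite !scale1r addr0 => /eqP; rewrite -subr_eq0 opprD addrA subrr sub0r oppr_eq0 => /eqP.
  by have := lB a u 0; rewrite B0 !addr0.
have BM u : dot (B u) u <= M * dot u u.
  have := dot_ge0 u; rewrite le_eqVlt => /predU1P[u0|u0].
    have := cauchy_schwarz_sq (B u) u; rewrite -u0 !mulr0 => h.
    suff /eqP -> : dot (B u) u == 0 by [].
    by rewrite -sqrf_eq0 eq_le h sqr_ge0.
  rewrite -ler_pdivrMr//.
  have -> : dot (B u) u / dot u u = dot (B ((norm0 u)^-1 *: u)) ((norm0 u)^-1 *: u).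
    by rewrite BZ dotZl dotZr -norm0_sq -exprVn expr2 mulrC mulrA.
  apply: sup_upper_bound => //; exists ((norm0 u)^-1 *: u) => //=.
  by rewrite dotZl dotZr -norm0_sq mulrA -invfM -expr2 mulVf// norm0_sq gt_eqF.
have M_ge0 : 0 <= M.
  by apply: le_trans (posB (e 0%N)) _; have := BM (e 0%N); rewrite e00 mulr1.
have M0 : 0 < M.
  rewrite lt_neqAle M_ge0 andbT eq_sym; apply/eqP => M0.
  have Bz u : dot (B u) u = 0.
    by apply/eqP; rewrite eq_le posB andbT; have := BM u; rewrite M0 mul0r.
  have Bz2 u v : dot (B u) v = 0.
    have := Bz (u + v); rewrite -[in B _](scale1r u) lB scale1r dotDl !dotDr !Bz.
    rewrite (symB v u) (dotC v); lra.
  have [v dv] := dA (e 0%N) 1 ltr01; rewrite -(BA v dv) => h.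
  have := cauchy_schwarz (e 0%N - B (A v)) (e 0%N).
  rewrite dotBl Bz2 e00 subr0 normr1 {2}/norm0 e00 sqrtr1 mulr1.
  by rewrite leNgt h.
have BM2 x : dot (M *: x - B x) (M *: x - B x) <= M * (M * dot x x - dot (B x) x).
  set w := M *: x - B x.
  have ww : dot w w = M * dot x w - dot (B x) w by rewrite {1}/w dotBl dotZl.
  clearbody w.
  (* Positivity of M - B at the minimizer - w / M + x along the line of direction w. *)
  have := BM (- M^-1 *: w + x).
  rewrite lB !(dotDl, dotDr, dotZl, dotZr) (symB w x) (dotC w (B x)) (dotC w x).
  have := posB w; rewrite -(ler_pM2l (exprn_gt0 2 M0)) mulr0.
  set Bww := dot (B w) w; set Bxw := dot (B x) w; set Bxx := dot (B x) x.
  set xw := dot x w in ww *; set xx := dot x x.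
  move=> Bww0 h.
  have : M * (- M^-1 * (- M^-1 * Bww) + - M^-1 * Bxw + (- M^-1 * Bxw + Bxx)) <=
    M * (M * (- M^-1 * (- M^-1 * dot w w) + - M^-1 * xw + (- M^-1 * xw + xx))).
    by rewrite ler_pM2l// -mulrDr.
  have -> : M * (- M^-1 * (- M^-1 * Bww) + - M^-1 * Bxw + (- M^-1 * Bxw + Bxx)) =
     M^-1 * Bww - 2 * Bxw + M * Bxx by field; rewrite gt_eqF.
  have -> : M * (M * (- M^-1 * (- M^-1 * dot w w) + - M^-1 * xw + (- M^-1 * xw + xx))) =
     dot w w - 2 * (M * xw) + M ^+ 2 * xx by field; rewrite gt_eqF.
  have : 0 <= M^-1 * Bww by rewrite mulr_ge0 ?invr_ge0 ?posB.
  rewrite -/Bxw in ww; rewrite ww (_ : M * (M * xx - Bxx) = M ^+ 2 * xx - M * Bxx); last by ring.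
  move: (M^-1 * Bww) (M * xw) (M ^+ 2 * xx) (M * Bxx) => *; lra.
have BB u : dot (B u) (B u) <= M ^+ 2 * dot u u.
  have := BM2 u; have := BM u; rewrite !(dotBl, dotBr, dotZl, dotZr) (dotC u (B u)).
  nra.
have M1 : M < 1.
  rewrite ltNge; apply/negP => M1.
  have : ~ spectrum A M^-1.
    move=> sM; have : (1 < M^-1%:E)%E.
      by apply: lt_le_trans spA _; apply: ereal_inf_lbound; exists M^-1.
    by rewrite lte_fin invf_gt1// ltNge M1.
  move=> /contrapT[S' [[_ S'A] [c cS']]].
  (* With this eps, (Bu, u) > M - eps >= 3/4 contradicts (Bu, u)^2 <= c^2 eps <= 1/4. *)
  pose eps := (4 * (1 + c ^+ 2))^-1.
  have eps0 : 0 < eps by rewrite invr_gt0 mulr_gt0// ltr_wpDr ?sqr_ge0.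
  have ceps : eps * (4 * (1 + c ^+ 2)) = 1.
    by rewrite mulVf// gt_eqF// -invr_gt0.
  have [_ [u /= u1 <-] hu] := sup_adherent eps0 supS.
  rewrite -/M in hu; have := S'A _ (dB u); rewrite AB => Ev.
  have := cS' (u - M^-1 *: B u); rewrite Ev => nv.
  have Ew : u - M^-1 *: B u = M^-1 *: (M *: u - B u).
    by rewrite scalerBr scalerA mulVf ?scale1r// gt_eqF.
  have h1 : dot (B u) (B u) <= c ^+ 2 * dot (u - M^-1 *: B u) (u - M^-1 *: B u).
    by rewrite -!norm0_sq -exprMn ler_sqr ?nnegrE ?norm0_ge0//; apply: le_trans nv; exact: norm0_ge0.
  have h2 : dot (u - M^-1 *: B u) (u - M^-1 *: B u) <= eps.
    rewrite Ew dotZl dotZr mulrA.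
    apply: (@le_trans _ _ (M^-1 * M^-1 * (M * (M * dot u u - dot (B u) u)))).
      by rewrite ler_wpM2l ?mulr_ge0 ?invr_ge0.
    rewrite mulrA -(mulrA M^-1) mulVf ?gt_eqF// mulr1.
    have : M * dot u u - dot (B u) u <= eps by nra.
    move=> h; apply: le_trans h; rewrite ler_piMl ?invf_le1//.
    by rewrite subr_ge0.
  have h3 := cauchy_schwarz_sq (B u) u.
  have h4 : dot (B u) u ^+ 2 <= 1 / 4.
    apply: le_trans h3 _; apply: (@le_trans _ _ (c ^+ 2 * eps)).
      have : dot (B u) (B u) <= c ^+ 2 * eps.
        by apply: le_trans h1 _; rewrite ler_wpM2l ?sqr_ge0.
      have := dot_ge0 (B u); have := dot_ge0 u; nra.
    by clear -ceps; nra.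
  have h5 : eps <= 1 / 4 by have := sqr_ge0 c; nra.
  have h6 : 3 / 4 < dot (B u) u by lra.
  by move: h4 h6; move: (dot _ u) => x a b; clear -a b; nra.
by exists B, e, M; split.
Qed.

End InverseOperator.

(** * Distributions as powers of the operator applied to vectors *)

Section Distributions.
Context (R : realType) (A : operator R) (B : L2R R -> L2R R) (e : nat -> L2R R) (rho : R).
Hypothesis ci : contractive_inverse A B e rho.
Local Notation H := (L2R R).
Local Notation E := (testE A).

Lemma power_distr_shift p h : power_distr A p h = power_distr A p.+1 (B h).
Proof.
apply: val_inj; apply/funext => xi /=; rewrite /power_distr_fun.
have dxi := smooth_iter (valP xi) p.
by rewrite /= (ci_sym ci) (ci_BA ci).
Qed.

Lemma power_distr_add p k h : power_distr A p h = power_distr A (p + k) (iter k B h).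
Proof.
by elim: k => [|k IH]; rewrite ?addn0// addnS IH power_distr_shift.
Qed.

Lemma power_distr_linear p a (u v : H) :
  power_distr A p (a *: u + v) = a *: power_distr A p u + power_distr A p v.
Proof.
apply: val_inj; apply/funext => xi /=; rewrite /power_distr_fun !fctE.
by rewrite dotDl dotZl.
Qed.

Lemma le_normE p (xi : E) : normE p xi <= normE p.+1 xi.
Proof.
rewrite /normE -ler_sqr ?nnegrE ?norm0_ge0// !norm0_sq.
have dxi := smooth_iter (valP xi) p.
rewrite -{1 2}(ci_BA ci dxi); apply: le_trans (ci_bound ci _) _.
rewrite ler_piMl ?dot_ge0// expr_le1 ?ltW// ?(ci_rho_gt0 ci)// ?(ci_rho_lt1 ci)//.
Qed.

Lemma smooth_iterB k (u : H) : u \in smooth A -> iter k B u \in smooth A.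
Proof.
move=> su; elim: k => //= k /smooth_iter IH; apply/asboolP => -[|q].
  exact: (ci_dom ci).
by rewrite iterSr (ci_AB ci).
Qed.

Lemma smooth_iterA k (u : H) : u \in smooth A -> iter k A u \in smooth A.
Proof.
move=> /smooth_iter su; apply/asboolP => q; rewrite -iterD; exact: su.
Qed.

Lemma iterAB k (u : H) : iter k A (iter k B u) = u.
Proof. by elim: k => //= k IH; rewrite -iterS iterSr (ci_AB ci). Qed.

Lemma iterBA k (u : H) : u \in smooth A -> iter k B (iter k A u) = u.
Proof.
move=> su; elim: k => //= k IH; rewrite -iterS iterSr.
by rewrite (ci_BA ci)//; exact: smooth_iter.
Qed.

Lemma iterB_linear k a (u v : H) : iter k B (a *: u + v) = a *: iter k B u + iter k B v.
Proof. by elim: k => //= k ->; rewrite (ci_linear ci). Qed.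

(** The functional x is bounded for some norm |.|_p, so u |-> x (B^p u) is
    bounded for the norm of H and is represented by a vector h. *)
Lemma distr_repr (x : distr A) : exists p h, x = power_distr A p h.
Proof.
have /asboolP[lx [p [c xb]]] := valP x.
pose iB (u : E) : E := TestE (smooth_iterB p (valP u)).
have iBL a (u v : E) : iB (a *: u + v) = a *: iB u + iB v.
  by apply: val_inj; rewrite /= iterB_linear.
have [|||h yh] := @riesz_representation _ _ _ (@lebesgue_measure R) E (fun u => u : H)
    (fun u => x (iB u)) ((c * p.+1%:R) ^+ 2).
- by move=> a u v.
- by move=> a u v; rewrite iBL lx.
- move=> u.
  have le_norm q : (q <= p)%N -> normE q (iB u) <= normE p (iB u).
    move=> /subnKC <-; elim: (p - q)%N => [|k IH]; rewrite ?addn0// addnS.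
    exact: le_trans IH (le_normE _ _).
  have nE : normE p (iB u) = norm0 (u : H) by rewrite /normE /= iterAB.
  have := xb (iB u).
  have h1 : \sum_(q < p.+1) normE q (iB u) <= p.+1%:R * norm0 (u : H).
    rewrite -nE -[leRHS](_ : \sum_(q < p.+1) normE p (iB u) = _).
      by apply: ler_sum => q _; apply: le_norm; rewrite -ltnS.
    by rewrite sumr_const card_ord mulr_natl.
  have h0 : 0 <= \sum_(q < p.+1) normE q (iB u).
    by apply: sumr_ge0 => q _; exact: norm0_ge0.
  move=> h2; rewrite -[x _ ^+ 2](real_normK (num_real (x (iB u)))) -norm0_sq -exprMn.
  rewrite -[leRHS](real_normK (num_real _)) ler_sqr ?nnegrE// !normrM.
  rewrite (ger0_norm (norm0_ge0 _)) (ger0_norm (ler0n _ _)).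
  apply: le_trans h2 _; apply: (@le_trans _ _ (`|c| * \sum_(q < p.+1) normE q (iB u))).
    by rewrite ler_wpM2r// ler_norm.
  by rewrite -mulrA ler_wpM2l.
exists p, h; apply: val_inj; apply/funext => xi /=; rewrite /power_distr_fun.
have := yh (TestE (smooth_iterA p (valP xi))) => /= <-; congr (x _).
by apply: val_inj; rewrite /= iterBA// (valP xi).
Qed.

Lemma distr_word_repr (s : seq (distr A)) : exists p hs, s = map (power_distr A p) hs.
Proof.
elim: s => [|x s [p [hs ->]]]; first by exists 0%N, [::].
have [q [h ->]] := distr_repr x; exists (p + q)%N, (iter p B h :: map (iter q B) hs).
rewrite /= addnC -power_distr_add -map_comp; congr cons; apply: eq_map => k /=.
by rewrite addnC -power_distr_add.
Qed.

End Distributions.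

(** * Iterated sums over families of vectors *)

Section IteratedSums.
Context (R : realType).
Implicit Types (X : Type).

(** Summing letter by letter is what lets an estimate in one variable be
    extended to all variables by induction on the list of families. *)
Fixpoint isum X (V : seq (nat -> X)) (phi : seq X -> \bar R) : \bar R :=
  if V is v :: V' then (\sum_(0 <= i <oo) isum V' (fun s => phi (v i :: s)))%E
  else phi [::].

Fixpoint fisum X (m : nat) (V : seq (nat -> X)) (phi : seq X -> \bar R) : \bar R :=
  if V is v :: V' then (\sum_(0 <= i < m) fisum m V' (fun s => phi (v i :: s)))%E
  else phi [::].

Lemma isum_ge0 X (V : seq (nat -> X)) phi : (forall s, (0 <= phi s)%E) -> (0 <= isum V phi)%E.
Proof.
elim: V phi => [|v V IH] phi p0 //=; apply: nneseries_ge0 => i _ _; exact: IH.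
Qed.

Lemma fisum_ge0 X m (V : seq (nat -> X)) phi : (forall s, (0 <= phi s)%E) -> (0 <= fisum m V phi)%E.
Proof.
elim: V phi => [|v V IH] phi p0 //=; apply: sume_ge0 => i _; exact: IH.
Qed.

Lemma le_isum X (V : seq (nat -> X)) phi psi : (forall s, (0 <= phi s)%E) ->
  (forall s, size s = size V -> (phi s <= psi s)%E) -> (isum V phi <= isum V psi)%E.
Proof.
elim: V phi psi => [|v V IH] phi psi p0 h; first exact: h.
apply: lee_nneseries => i; first by move=> _ _; exact: isum_ge0.
by move=> _; apply: IH => // s sV; apply: h; rewrite /= sV.
Qed.

Lemma eq_isum X (V : seq (nat -> X)) phi psi :
  (forall s, size s = size V -> phi s = psi s) -> isum V phi = isum V psi.
Proof.
elim: V phi psi => [|v V IH] phi psi h; first exact: h.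
apply: eq_eseriesr => i _; apply: IH => s sV; apply: h; by rewrite /= sV.
Qed.

Lemma isum_nneseries X (V : seq (nat -> X)) (phi : nat -> seq X -> \bar R) :
  (forall k s, (0 <= phi k s)%E) ->
  isum V (fun s => \sum_(0 <= k <oo) phi k s)%E = (\sum_(0 <= k <oo) isum V (phi k))%E.
Proof.
elim: V phi => [|v V IH] phi p0 //=.
under eq_eseriesr do rewrite IH//.
by rewrite nneseries_interchange// => i j; apply: isum_ge0.
Qed.

Lemma isum_sum X (V : seq (nat -> X)) (phi : nat -> seq X -> \bar R) N :
  (forall k s, (0 <= phi k s)%E) ->
  isum V (fun s => \sum_(0 <= k < N) phi k s)%E = (\sum_(0 <= k < N) isum V (phi k))%E.
Proof.
elim: V phi => [|v V IH] phi p0 //=.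
under eq_eseriesr do rewrite IH//.
by rewrite nneseries_sum// => i j _; apply: isum_ge0.
Qed.

Lemma isumZl X (V : seq (nat -> X)) (c : R) phi : (forall s, (0 <= phi s)%E) ->
  isum V (fun s => c%:E * phi s)%E = (c%:E * isum V phi)%E.
Proof.
elim: V phi => [|v V IH] phi p0 //=.
by rewrite -nneseriesZl => [|i _]; [apply: eq_eseriesr => i _; rewrite IH|exact: isum_ge0].
Qed.

Lemma isum_cat X (V W : seq (nat -> X)) phi :
  isum (V ++ W) phi = isum V (fun s => isum W (fun t => phi (s ++ t))).
Proof. by elim: V phi => [|v V IH] phi //=; apply: eq_eseriesr => i _; rewrite IH. Qed.

Lemma isum_map X Y (g : X -> Y) (V : seq (nat -> X)) phi :
  isum (map (fun v i => g (v i)) V) phi = isum V (fun s => phi (map g s)).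
Proof. by elim: V phi => [|v V IH] phi //=; apply: eq_eseriesr => i _; rewrite IH. Qed.

Lemma fisum_mono X m m' (V : seq (nat -> X)) phi : (m <= m')%N ->
  (forall s, (0 <= phi s)%E) -> (fisum m V phi <= fisum m' V phi)%E.
Proof.
move=> mm; elim: V phi => [|v V IH] phi p0 //=.
apply: (@le_trans _ _ (\sum_(0 <= i < m) fisum m' V (fun s => phi (v i :: s)))%E).
  by apply: lee_sum => i _; apply: IH.
by apply: lee_sum_nneg_natr => // i _ _; apply: fisum_ge0.
Qed.

Lemma fisum_sum X m (V : seq (nat -> X)) (phi : nat -> seq X -> \bar R) N :
  fisum m V (fun s => \sum_(0 <= k < N) phi k s)%E = (\sum_(0 <= k < N) fisum m V (phi k))%E.
Proof.
elim: V phi => [|v V IH] phi //=.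
by under eq_bigr do rewrite IH//; rewrite exchange_big.
Qed.

Lemma fisum_le_isum X m (V : seq (nat -> X)) phi : (forall s, (0 <= phi s)%E) ->
  (fisum m V phi <= isum V phi)%E.
Proof.
elim: V phi => [|v V IH] phi p0 //=.
apply: (@le_trans _ _ (\sum_(0 <= i < m) isum V (fun s => phi (v i :: s)))%E).
  by apply: lee_sum => i _; apply: IH.
by apply: nneseries_lim_ge => i _ _; apply: isum_ge0.
Qed.

(** The first sum is a limit of finite sums, which can be moved inside the other
    ones; the truncation of the first sum and that of the others are then replaced by
    their maximum. *)
Lemma isum_le X (V : seq (nat -> X)) phi M : (forall s, (0 <= phi s)%E) ->
  (forall m, (fisum m V phi <= M)%E) -> (isum V phi <= M)%E.
Proof.
elim: V phi => [|v V IH] phi p0 hM; first exact: (hM 0%N).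
have /cvge_to_le : (fun n => \sum_(0 <= i < n) isum V (fun s => phi (v i :: s)))%E @ \oo
    --> isum (v :: V) phi.
  by apply: is_cvg_nneseries => i _ _; apply: isum_ge0.
apply; apply: nearW => N; rewrite -isum_sum//; apply: IH.
  by move=> s; apply: sume_ge0.
move=> m; rewrite fisum_sum; apply: le_trans (hM (maxn m N)) => /=.
apply: (@le_trans _ _ (\sum_(0 <= k < N) fisum (maxn m N) V (fun s => phi (v k :: s)))%E).
  by apply: lee_sum => k _; apply: fisum_mono => //; exact: leq_maxl.
apply: lee_sum_nneg_natr; last exact: leq_maxr.
by move=> k _ _; exact: fisum_ge0.
Qed.

(** A function on 'I_n.+1 is a pair of its value at 0 and its values at the
    successors. *)
Lemma enum_ffunS n m (F : {ffun 'I_n.+1 -> 'I_m} -> \bar R) :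
  (\sum_(f : {ffun 'I_n.+1 -> 'I_m}) F f =
   \sum_(i < m) \sum_(f : {ffun 'I_n -> 'I_m})
     F [ffun k => if unlift ord0 k is Some k' then f k' else i])%E.
Proof.
rewrite pair_big/=.
pose h (x : 'I_m * {ffun 'I_n -> 'I_m}) : {ffun 'I_n.+1 -> 'I_m} :=
  [ffun k => if unlift ord0 k is Some k' then x.2 k' else x.1].
pose h' (f : {ffun 'I_n.+1 -> 'I_m}) := (f ord0, [ffun k => f (lift ord0 k)]).
rewrite (reindex h)//; exists h' => [[i f] _|f _].
  rewrite /h' /h; congr pair; first by rewrite ffunE unlift_none.
  by apply/ffunP => k; rewrite !ffunE liftK.
apply/ffunP => k; rewrite !ffunE.
by case: unliftP => [k' ->|->] //=; rewrite ffunE.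
Qed.

(** Relates the sums that define [hs_norm2] to iterated sums. *)
Lemma sum_ffun_fisum X m n (u : 'I_n -> nat -> X) phi :
  (\sum_(i : {ffun 'I_n -> 'I_m}) phi [seq u k (i k) | k <- enum 'I_n] =
   fisum m [seq u k | k <- enum 'I_n] phi)%E.
Proof.
elim: n u phi => [|n IH] u phi.
  have -> : enum 'I_0 = [::] by apply/nilP; rewrite /nilp size_enum_ord.
  rewrite /= (eq_bigr (fun=> phi [::]))// big_const card_ffun !card_ord expn0/=.
  by rewrite adde0.
rewrite enum_ffunS enum_ordSl /= big_mkord; apply: eq_bigr => i _.
rewrite -map_comp -(IH (fun k => u (lift ord0 k)) (fun s => phi (u ord0 i :: s))).
apply: eq_bigr => f _; rewrite ffunE unlift_none; congr (phi (_ :: _)).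
by rewrite -map_comp; apply: eq_map => k /=; rewrite ffunE liftK.
Qed.

End IteratedSums.

(** * Multilinear forms on Bessel families *)

Section Contraction.
Context (R : realType).
Local Notation H := (L2R R).
Variables (e : nat -> H) (he : orthonormal_basis e).

Definition sqnormc (z : R[i]) : \bar R := (normc z ^+ 2)%:E.

Lemma sqnormc_ge0 z : (0 <= sqnormc z)%E.
Proof. by rewrite lee_fin sqr_ge0. Qed.

Definition mlinear (X : lmodType R) n (f : seq X -> R[i]) := forall s t a y z,
  (size s + size t).+1 = n ->
  f (s ++ (a *: y + z) :: t) = (a%:C)%C * f (s ++ y :: t) + f (s ++ z :: t).

(** Equivalently, the operator that maps the i-th basis vector to v i has a
    norm with square at most r. *)
Definition bessel_family (v : nat -> H) (r : R) := 0 <= r /\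
  forall n h, \sum_(0 <= i < n) dot (v i) h ^+ 2 <= r * dot h h.

Definition bounded_form n (g : seq H -> R[i]) := exists c, 0 <= c /\
  forall s, size s = n -> normc (g s) ^+ 2 <= c * \prod_(h <- s) dot h h.

Section Slot.
Variables (g : H -> R[i]).
Hypothesis glin : forall a y z, g (a *: y + z) = (a%:C)%C * g y + g z.
Variable (c : R).
Hypothesis gb : forall h, normc (g h) ^+ 2 <= c * dot h h.

Let g0 : g 0 = 0.
Proof.
have := glin (-1) 0 0; rewrite scaler0 addr0 => ->.
by rewrite rmorphN rmorph1 mulN1r addNr.
Qed.

Let gB y z : g (y - z) = g y - g z.
Proof. by rewrite addrC -scaleN1r glin rmorphN rmorph1 mulN1r addrC. Qed.

Let gsum n (a : nat -> R) (w : nat -> H) :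
  g (\sum_(0 <= i < n) a i *: w i) = \sum_(0 <= i < n) (a i)%:C%C * g (w i).
Proof.
elim: n => [|n IH]; first by rewrite !big_nil.
by rewrite !big_nat_recr//= addrC glin IH addrC.
Qed.

Let ReM (a : R) (z : R[i]) : Re (a%:C%C * z) = a * Re z.
Proof. by case: z => x y /=; rewrite mul0r subr0. Qed.

Let ImM (a : R) (z : R[i]) : Im (a%:C%C * z) = a * Im z.
Proof. by case: z => x y /=; rewrite mul0r addr0. Qed.

Let proj_nat n h : partial_proj e n h = \sum_(0 <= j < n) dot h (e j) *: e j.
Proof. by rewrite /partial_proj big_mkord. Qed.

(** If v i is replaced by its projection on the first N basis vectors, the real
    parts of the values of g become the inner products of the v i with the sum of the
    Re (g (e j)) e j, to which the hypothesis on v applies; likewise for the imaginary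
    parts. Then N tends to infinity, g being continuous. *)
Lemma slot_bound v r n (K : R) : bessel_family v r ->
  (forall N, \sum_(0 <= j < N) normc (g (e j)) ^+ 2 <= K) ->
  \sum_(0 <= i < n) normc (g (v i)) ^+ 2 <= r * K.
Proof.
move=> [r0 vb] gK.
have c_ge0 : 0 <= c.
  by have := gb (e 0%N); rewrite he.1 mulr1; apply: le_trans; exact: sqr_ge0.
have trunc N : \sum_(0 <= i < n) normc (g (partial_proj e N (v i))) ^+ 2 <= r * K.
  apply: (@le_trans _ _ (r * \sum_(0 <= j < N) normc (g (e j)) ^+ 2)); last first.
    by rewrite ler_wpM2l.
  pose w (F : R[i] -> R) := \sum_(0 <= j < N) F (g (e j)) *: e j.
  have wF (F : R[i] -> R) : dot (w F) (w F) = \sum_(0 <= j < N) F (g (e j)) ^+ 2.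
    by rewrite /w !big_mkord (dot_basis_sum2 he (fun j => F (g (e j)))).
  have -> : \sum_(0 <= j < N) normc (g (e j)) ^+ 2 = dot (w (@Re R)) (w (@Re R)) + dot (w (@Im R)) (w (@Im R)).
    by rewrite !wF -big_split/=; apply: eq_bigr => j _; rewrite sqr_normc.
  rewrite mulrDr; apply: le_trans (lerD (vb n (w (@Re R))) (vb n (w (@Im R)))).
  rewrite -big_split/=; apply: ler_sum => i _; rewrite sqr_normc proj_nat gsum Re_sum Im_sum.
  rewrite /w !dot_sumr; apply: lerD; rewrite le_eqVlt; apply/orP; left; apply/eqP;
  congr (_ ^+ 2); apply: eq_bigr => j _.
    by rewrite dotZr ReM mulrC.
  by rewrite dotZr ImM mulrC.
have cv i : (fun N => normc (g (partial_proj e N (v i))) ^+ 2) @ \oo --> normc (g (v i)) ^+ 2.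
  have cg : ccvg (fun N => g (partial_proj e N (v i))) (g (v i)).
    have h0 : (fun N => Num.sqrt (c * dot (v i - partial_proj e N (v i)) (v i - partial_proj e N (v i)))) @ \oo --> (0 : R).
      rewrite -(sqrtr0 R); apply: (@continuous_cvg _ _ _ _ _ _ (@Num.sqrt R)).
        exact: sqrt_continuous.
      rewrite -[X in _ --> X](mulr0 c); apply: cvgM; first exact: cvg_cst.
      exact: (partial_proj_cvg he).
    apply: (squeeze_cvgr _ (cvg_cst (0 : R)) h0).
    apply: nearW => N; rewrite normc_ge0/= -gB -[leLHS]ger0_norm ?normc_ge0// -sqrtr_sqr.
    by apply: ler_wsqrtr; rewrite -[in leRHS]opprB dotNl dotNr opprK; exact: gb.
  case/ccvgP : cg => c1 c2; rewrite sqr_normc.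
  rewrite (_ : (fun N => _) = (fun N => Re (g (partial_proj e N (v i))) * Re (g (partial_proj e N (v i))) +
    Im (g (partial_proj e N (v i))) * Im (g (partial_proj e N (v i))))).
    by rewrite !expr2; apply: cvgD; apply: cvgM.
  by apply/funext => N; rewrite sqr_normc !expr2.
have /cvgr_to_le : (fun N => \sum_(0 <= i < n) normc (g (partial_proj e N (v i))) ^+ 2) @ \oo -->
    \sum_(0 <= i < n) normc (g (v i)) ^+ 2.
  elim: n {trunc} => [|n IH].
    rewrite big_nil (_ : (fun N => _) = fun=> 0); first exact: cvg_cst.
    by apply/funext => N; rewrite big_nil.
  rewrite big_nat_recr//= (_ : (fun N => _) =
    (fun N => \sum_(0 <= i < n) normc (g (partial_proj e N (v i))) ^+ 2 + normc (g (partial_proj e N (v n))) ^+ 2)).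
    by apply: cvgD.
  by apply/funext => N; rewrite big_nat_recr.
by apply; apply: nearW.
Qed.

Lemma slot_contract v r : bessel_family v r ->
  (\sum_(0 <= i <oo) sqnormc (g (v i)) <= r%:E * \sum_(0 <= j <oo) sqnormc (g (e j)))%E.
Proof.
move=> vr; have [r0 vb] := vr.
have s0 : (0 <= \sum_(0 <= j <oo) sqnormc (g (e j)))%E.
  by apply: nneseries_ge0 => j _ _; exact: sqnormc_ge0.
have bound M : (forall n, (\sum_(0 <= i < n) sqnormc (g (v i)) <= M)%E) ->
    (\sum_(0 <= i <oo) sqnormc (g (v i)) <= M)%E.
  move=> hM; have /cvge_to_le : (fun n => \sum_(0 <= i < n) sqnormc (g (v i)))%E @ \oo -->
    (\sum_(0 <= i <oo) sqnormc (g (v i)))%E by apply: is_cvg_nneseries => i _ _; exact: sqnormc_ge0.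
  by apply; apply: nearW.
apply: bound => n; rewrite sumEFin.
have [sfin|/eqP] := eqVneq (\sum_(0 <= j <oo) sqnormc (g (e j)))%E +oo%E; last first.
  move=> /eqP sfin; have {}sfin : (\sum_(0 <= j <oo) sqnormc (g (e j)))%E \is a fin_num.
    by rewrite ge0_fin_numE// lt_neqAle sfin leey.
  rewrite -(fineK sfin) -EFinM lee_fin; apply: slot_bound => // N.
  rewrite -lee_fin fineK// -sumEFin; apply: nneseries_lim_ge => j _ _; exact: sqnormc_ge0.
rewrite sfin; move: r0; rewrite le_eqVlt => /predU1P[r0|r0]; last by rewrite gt0_muley// leey.
rewrite -r0 mul0e lee_fin; apply: sumr_le0 => i _.
suff vi : dot (v i) (v i) = 0 by apply: le_trans (gb _) _; rewrite vi mulr0.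
have := vb i.+1 (v i); rewrite -r0 mul0r big_nat_recr//= => h.
apply/eqP; rewrite -sqrf_eq0 eq_le sqr_ge0 andbT; apply: le_trans h.
by rewrite lerDr; apply: sumr_ge0 => k _; rewrite sqr_ge0.
Qed.

End Slot.
Lemma mlinear_cons (X : lmodType R) n (f : seq X -> R[i]) h :
  mlinear n.+1 f -> mlinear n (fun s => f (h :: s)).
Proof. by move=> fl s t a y z st; apply: (fl (h :: s)); rewrite /= -st. Qed.

Lemma bounded_form_cons n (g : seq H -> R[i]) h : bounded_form n.+1 g -> bounded_form n (fun s => g (h :: s)).
Proof.
move=> [c [c0 gb]]; exists (c * dot h h); split; first by rewrite mulr_ge0 ?dot_ge0.
by move=> s sn; have := gb (h :: s); rewrite /= sn big_cons mulrA; apply.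
Qed.

Fixpoint all_bessel (V : seq ((nat -> H) * R)) : Prop :=
  if V is v :: V' then bessel_family v.1 v.2 /\ all_bessel V' else True.

Lemma all_bessel_ge0 V : all_bessel V -> 0 <= \prod_(v <- V) v.2.
Proof.
elim: V => [|v V IH] /=; first by rewrite big_nil.
by move=> [[v0 _] /IH h]; rewrite big_cons mulr_ge0.
Qed.

(** The families are replaced one at a time by the basis: by induction in the last
    variables, and by [slot_contract] in the first one, once its sum is innermost. *)
Lemma isum_contract (V : seq ((nat -> H) * R)) (g : seq H -> R[i]) :
  mlinear (size V) g -> bounded_form (size V) g -> all_bessel V ->
  (isum (map fst V) (fun s => sqnormc (g s)) <=
   (\prod_(v <- V) v.2)%:E * isum (nseq (size V) e) (fun s => sqnormc (g s)))%E.
Proof.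
elim: V g => [|v V IH] g gl gb /=.
  by move=> _; rewrite big_nil mul1e.
move=> [vb Vb]; have P0 := all_bessel_ge0 Vb; have [v0 _] := vb.
apply: (@le_trans _ _ (\sum_(0 <= i <oo) (\prod_(w <- V) w.2)%:E *
    isum (nseq (size V) e) (fun s => sqnormc (g (v.1 i :: s))))%E).
  apply: lee_nneseries => i; first by move=> _ _; apply: isum_ge0 => s; exact: sqnormc_ge0.
  by move=> _; apply: IH => //; [exact: mlinear_cons|exact: bounded_form_cons].
have s0 i (w : nat -> H) : (0 <= isum (nseq (size V) e) (fun s => sqnormc (g (w i :: s))))%E.
  by apply: isum_ge0 => s; exact: sqnormc_ge0.
rewrite nneseriesZl// big_cons mulrC EFinM -muleA lee_wpmul2l ?lee_fin//.
rewrite -!isum_nneseries; try by move=> *; exact: sqnormc_ge0.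
rewrite -isumZl; last by move=> s; apply: nneseries_ge0 => *; exact: sqnormc_ge0.
apply: le_isum => [s|s sV]; first by apply: nneseries_ge0 => *; exact: sqnormc_ge0.
rewrite size_nseq in sV; have [c [c0 gc]] := gb.
apply: (@slot_contract (fun h => g (h :: s)) _ (c * \prod_(h <- s) dot h h)) => //.
  by move=> a y z; apply: (gl [::]); rewrite /= sV.
by move=> h; have := gc (h :: s); rewrite /= sV big_cons mulrA mulrAC; apply.
Qed.

End Contraction.

(** * The Hilbert-Schmidt norm in an orthonormal basis *)

Section HilbertSchmidt.
Context (R : realType).
Local Notation H := (L2R R).
Variables (e : nat -> H) (he : orthonormal_basis e).

Definition word_form (X : Type) n (g : seq X -> R[i]) (x : 'I_n -> X) : R[i] :=
  g [seq x i | i <- enum 'I_n].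

Lemma isum_le_hs_norm2 n (g : seq H -> R[i]) :
  (isum (nseq n e) (fun s => sqnormc (g s)) <= hs_norm2 (word_form (n := n) g))%E.
Proof.
apply: isum_le => [s|m]; first exact: sqnormc_ge0.
apply: ereal_sup_ubound; exists m, (fun (_ : 'I_n) (i : 'I_m) => e i); split.
  by move=> k i j; rewrite he.1.
rewrite -sumEFin (eq_bigr (fun i : {ffun 'I_n -> 'I_m} =>
   sqnormc (g [seq e (i k) | k <- enum 'I_n]))) //.
rewrite (sum_ffun_fisum m (fun=> e) (fun s => sqnormc (g s))); congr fisum.
rewrite -[n in nseq n](size_enum_ord n); elim: (enum 'I_n) => //= _ s ->.
done.
Qed.

(** Bessel's inequality for a finite orthonormal system, which is extended by 0 to
    a sequence. *)
Lemma bessel_orthonormal m (u : 'I_m -> H) : Defs.orthonormal u ->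
  bessel_family (fun i => if insub i is Some j then u j else 0) 1.
Proof.
move=> ou; split=> // n h; rewrite mul1r.
pose v i := if insub i is Some j then u j else 0.
pose N := maxn n m.
apply: (@le_trans _ _ (\sum_(0 <= i < m) dot (v i) h ^+ 2)).
  apply: (@le_trans _ _ (\sum_(0 <= i < N) dot (v i) h ^+ 2)).
    rewrite [leRHS](@big_cat_nat _ _ _ n)//= ?leq_maxl// lerDl.
    by apply: sumr_ge0 => i _; rewrite sqr_ge0.
  rewrite [leLHS](@big_cat_nat _ _ _ m)//= ?leq_maxr// gerDl.
  rewrite big_nat big1// => i /andP[mi _].
  by rewrite /v insubF ?dot0l ?expr0n// ltnNge mi.
rewrite big_mkord -subr_ge0.
rewrite (eq_bigr (fun i : 'I_m => dot (u i) h ^+ 2)); last first.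
  by move=> i _; rewrite /v valK.
pose w := \sum_(i < m) dot (u i) h *: u i.
have wu i : dot w (u i) = dot (u i) h.
  rewrite /w dot_suml (bigD1 i)//= dotZl ou eqxx mulr1 big1 ?addr0// => j ji.
  by rewrite dotZl ou (negbTE ji) mulr0.
have := dot_ge0 (h - w); rewrite dotBl !dotBr [dot w w]dot_sumr.
under [X in _ - (_ - X)]eq_bigr do rewrite dotZr wu.
rewrite (dotC w h) [dot h w]dot_sumr.
under [X in _ - X - _]eq_bigr do rewrite dotZr (dotC h).
under [X in _ - (X - _)]eq_bigr do rewrite dotZr (dotC h).
by rewrite subrr subr0 (eq_bigr (fun i => dot (u i) h ^+ 2)).
Qed.

(** The supremum over all orthonormal systems is reached on the basis, because
    an orthonormal system is a Bessel family with constant 1. *)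
Lemma hs_norm2E n (g : seq H -> R[i]) : mlinear n g -> bounded_form n g ->
  hs_norm2 (word_form (n := n) g) = isum (nseq n e) (fun s => sqnormc (g s)).
Proof.
move=> gl gb; apply/eqP; rewrite eq_le isum_le_hs_norm2 andbT.
apply: ge_ereal_sup => _ [m [u [ou ->]]].
pose v k i := if insub i is Some j then u k j else 0.
rewrite -sumEFin (eq_bigr (fun i : {ffun 'I_n -> 'I_m} =>
   sqnormc (g [seq v k (i k) | k <- enum 'I_n]))); last first.
  by move=> i _; congr (sqnormc (g _)); apply: eq_map => k; rewrite /v valK.
rewrite (sum_ffun_fisum m v (fun s => sqnormc (g s))).
apply: le_trans (fisum_le_isum _ _ _) _; first by move=> s; exact: sqnormc_ge0.
have := @isum_contract _ e he [seq (v k, 1) | k <- enum 'I_n] g.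
rewrite size_map size_enum_ord -[map fst _]map_comp big_map => /(_ gl gb).
rewrite big1_eq mul1e; apply.
by elim: (enum 'I_n) => //= k s IH; split=> //; exact: bessel_orthonormal.
Qed.

(** Systems with a single vector in each variable bound g on unit vectors.
    The letters of an arbitrary word are normalized from left to right. *)
Lemma bounded_form_of_hs_norm2 n (g : seq H -> R[i]) : mlinear n g ->
  (forall s h t, (size s + size t).+1 = n -> dot h h = 0 -> g (s ++ h :: t) = 0) ->
  (hs_norm2 (word_form (n := n) g) < +oo)%E -> bounded_form n g.
Proof.
move=> gl g0 gfin.
have h0 : (0 <= hs_norm2 (word_form (n := n) g))%E.
  by apply: le_trans (isum_le_hs_norm2 _ _); apply: isum_ge0 => s; exact: sqnormc_ge0.
pose S := fine (hs_norm2 (word_form (n := n) g)).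
have SE : hs_norm2 (word_form (n := n) g) = S%:E by rewrite fineK// ge0_fin_numE.
have unit s : size s = n -> (forall i, (i < n)%N -> dot (nth 0 s i) (nth 0 s i) = 1) ->
    normc (g s) ^+ 2 <= S.
  move=> sn s1; rewrite -lee_fin -SE.
  have h1 : ((\sum_(i : {ffun 'I_n -> 'I_1})
      normc (word_form g (fun k : 'I_n => nth 0 s k)) ^+ 2)%:E <= hs_norm2 (word_form (n := n) g))%E.
    apply: ereal_sup_ubound; exists 1%N, (fun (k : 'I_n) (i : 'I_1) => nth 0 s k); split=> //.
    by move=> k i j; rewrite !ord1 s1.
  apply: le_trans h1; rewrite lee_fin sumr_const card_ffun !card_ord exp1n mulr1n.
  rewrite /word_form (_ : [seq _ | _ <- _] = s)//.
  by rewrite -[RHS](mkseq_nth 0) /mkseq -val_enum_ord -map_comp sn.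
exists S; split; first by rewrite -lee_fin -SE.
suff gen s2 s1 : (size s1 + size s2 = n)%N ->
    (forall i, (i < size s1)%N -> dot (nth 0 s1 i) (nth 0 s1 i) = 1) ->
    normc (g (s1 ++ s2)) ^+ 2 <= S * \prod_(h <- s2) dot h h.
  by move=> s sn; apply: (gen s [::]).
elim: s2 s1 => [|h s2 IH] s1 sn s1u.
  rewrite cats0 big_nil mulr1; apply: unit; first by rewrite -sn addn0.
  by move=> i; rewrite -sn addn0; exact: s1u.
have [hh|hh] := eqVneq (dot h h) 0.
  rewrite g0//; last by rewrite -sn addnS.
  by rewrite big_cons hh mul0r mulr0 Normc.normc0 expr0n.
have hp : 0 < dot h h by rewrite lt_neqAle eq_sym hh dot_ge0.
have np : norm0 h != 0 by rewrite /norm0 sqrtr_eq0 -ltNge.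
have := gl s1 s2 (norm0 h) ((norm0 h)^-1 *: h) 0.
rewrite addr0 scalerA mulfV// scale1r [g (s1 ++ 0 :: s2)]g0 ?dot0l ?addr0; last 2 first.
- by rewrite -sn addnS.
- by [].
move=> ->; last by rewrite -sn addnS.
rewrite Normc.normcM exprMn big_cons [leRHS]mulrCA.
have -> : normc (norm0 h)%:C%C ^+ 2 = dot h h.
  by rewrite sqr_normc /= expr0n addr0 norm0_sq.
rewrite ler_wpM2l ?dot_ge0// -cat_rcons; apply: IH; first by rewrite size_rcons addSnnS.
move=> i; rewrite size_rcons nth_rcons ltnS; case: ltngtP => //= [i1|_] _.
  exact: s1u.
by rewrite dotZl dotZr -norm0_sq mulrA -invfM -expr2 mulVf// expf_eq0.
Qed.

End HilbertSchmidt.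

(** * Tensors as functions of words *)

Section Words.
Context (R : realType) (A : operator R).
Local Notation H := (L2R R).
Local Notation E' := (distr A).
Implicit Types (f g : seq E' -> R[i]).

(** A sequence of forms, one for each number of variables, is represented by a
    single function of words. Appending words then plays the part of the tensor product,
    without casts between equal numbers of variables. *)
Definition word_fun (psi : forall n, nform A n) : seq E' -> R[i] :=
  fun s => psi (size s) (fun i => nth 0 s i).

Lemma word_fun_size (psi : forall n, nform A n) n s : size s = n ->
  word_fun psi s = psi n (fun i => nth 0 s i).
Proof. by move=> <-. Qed.

Lemma nth_map_enum n (x : 'I_n -> E') (i : 'I_n) : nth 0 [seq x j | j <- enum 'I_n] i = x i.
Proof. by rewrite (nth_map i) ?size_enum_ord// nth_ord_enum. Qed.

Lemma map_enum_nth n (s : seq E') : size s = n -> [seq nth 0 s (i : 'I_n) | i <- enum 'I_n] = s.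
Proof. by move=> sn; rewrite -[RHS](mkseq_nth 0) /mkseq -val_enum_ord -map_comp sn. Qed.

Lemma word_funK (psi : forall n, nform A n) n : word_form (word_fun psi) = psi n.
Proof.
apply/funext => x; have sz : size [seq x i | i <- enum 'I_n] = n by rewrite size_map size_enum_ord.
rewrite /word_form (word_fun_size psi sz).
by congr (psi n); apply/funext => i; rewrite nth_map_enum.
Qed.

Lemma eq_word_form n f g : (forall s, size s = n -> f s = g s) -> word_form f = word_form g :> nform A n.
Proof. by move=> fg; apply/funext => x; rewrite /word_form fg// size_map size_enum_ord. Qed.

Lemma set_arg_seq n (x : 'I_n -> E') (k : 'I_n) y :
  [seq set_arg x k y i | i <- enum 'I_n] =
  take k [seq x i | i <- enum 'I_n] ++ y :: drop k.+1 [seq x i | i <- enum 'I_n].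
Proof.
set w := [seq x i | i <- enum 'I_n].
have wn : size w = n by rewrite size_map size_enum_ord.
have kn := ltn_ord k.
have tk : size (take k w) = k by rewrite size_take wn kn.
apply: (@eq_from_nth _ 0) => [|i].
  rewrite size_map size_enum_ord size_cat /= size_drop tk wn; lia.
rewrite size_map size_enum_ord => i_n; rewrite (nth_map_enum _ (Ordinal i_n)) /set_arg.
rewrite nth_cat tk; case: ltngtP => ik /=.
- by rewrite nth_take// (nth_map_enum x (Ordinal i_n)) -val_eqE/= ltn_eqF.
- rewrite -val_eqE/= gtn_eqF//; have -> : (i - k = (i - k).-1.+1)%N by lia.
  rewrite /= nth_drop.
  have -> : (k.+1 + (i - k).-1 = Ordinal i_n)%N by rewrite /=; lia.
  by rewrite nth_map_enum.
- by rewrite -val_eqE/= [in (i - k)%N]ik subnn (introT eqP ik).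
Qed.

Lemma mlinear_multilinear n f : multilinear (word_form (n := n) f) <-> mlinear n f.
Proof.
split=> [fl s t a y z st|fl x k a y z]; last first.
  rewrite /word_form !set_arg_seq; apply: fl.
  rewrite size_take size_drop size_map size_enum_ord ltn_ord.
  have := ltn_ord k; lia.
have sn : (size s < n)%N by rewrite -st ltnS leq_addr.
have E w : s ++ w :: t =
  [seq set_arg (fun i : 'I_n => nth 0 (s ++ 0 :: t) i) (Ordinal sn) w i | i <- enum 'I_n].
  rewrite set_arg_seq map_enum_nth; last by rewrite size_cat /= addnS.
  by rewrite /= take_size_cat// drop_cat ltnNge leqnSn /= subSnn /= drop0.
have := fl (fun i : 'I_n => nth 0 (s ++ 0 :: t) i) (Ordinal sn) a y z.
by rewrite /word_form -!E.
Qed.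

Definition symmetric_on n f := forall s t, size s = n -> perm_eq s t -> f s = f t.

Lemma symmetric_on_permute n f : (forall s, permute s (word_form (n := n) f) = word_form f) <-> symmetric_on n f.
Proof.
split=> [fs s t sn st|fs s].
  have tn : size t = n by rewrite -(perm_size st).
  have /tuple_permP[p sE] : perm_eq s (Tuple (introT eqP tn)) by [].
  have := congr1 (fun F : nform A n => F (fun i => nth 0 t i)) (fs p).
  rewrite /permute /word_form map_enum_nth// => <-; congr f.
  by rewrite sE /=; apply: eq_map => i /=; rewrite (tnth_nth 0).
apply/funext => x; rewrite /permute /word_form; apply: fs.
  by rewrite size_map size_enum_ord.
rewrite (map_comp x s); apply: perm_map; apply: uniq_perm.
- by rewrite map_inj_uniq ?enum_uniq//; exact: perm_inj.
- exact: enum_uniq.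
move=> i; rewrite mem_enum; apply/mapP; exists (s^-1 i)%g; first by rewrite mem_enum.
by rewrite permKV.
Qed.

Definition at_level p f : seq H -> R[i] := fun s => f (map (power_distr A p) s).

End Words.

Section Tensors.
Context (R : realType) (A : operator R) (B : L2R R -> L2R R) (e : nat -> L2R R) (rho : R).
Hypothesis ci : contractive_inverse A B e rho.
Local Notation H := (L2R R).
Local Notation E' := (distr A).
Implicit Types (f g : seq E' -> R[i]).

Definition tnorm2 p n f : \bar R := isum (nseq n e) (fun s => sqnormc (at_level p f s)).

(** For tensors, boundedness follows from the finiteness of the norms
    ([tensor_word_form]); it makes the sums over different families comparable. *)
Definition symtensor n f := [/\ mlinear n f, symmetric_on n f, forall p, bounded_form n (at_level p f) &
  forall p, (tnorm2 p n f < +oo)%E].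

Lemma mlinear_at_level p n f : mlinear n f -> mlinear n (at_level p f).
Proof.
move=> fl s t a y z st; rewrite /at_level !map_cat /= power_distr_linear; apply: fl.
by rewrite !size_map.
Qed.

Lemma form_norm2_at_level p n f : form_norm2 p (word_form (n := n) f) = hs_norm2 (word_form (n := n) (at_level p f)).
Proof.
rewrite /form_norm2; congr hs_norm2; apply/funext => h.
by rewrite /word_form /at_level -map_comp.
Qed.

Lemma form_norm2E p n f : mlinear n f -> bounded_form n (at_level p f) ->
  form_norm2 p (word_form (n := n) f) = tnorm2 p n f.
Proof.
by move=> fl fb; rewrite form_norm2_at_level (hs_norm2E (ci_basis ci))//; exact: mlinear_at_level.
Qed.

Lemma mlinear0 (X : lmodType R) n (f : seq X -> R[i]) s t : mlinear n f ->
  (size s + size t).+1 = n -> f (s ++ 0 :: t) = 0.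
Proof.
move=> fl st; have := fl s t (-1) 0 0 st; rewrite scaler0 addr0 => ->.
by rewrite rmorphN rmorph1 mulN1r addNr.
Qed.

(** A vector h with (h, h) = 0 defines the zero distribution, so the forms vanish
    on it, as [bounded_form_of_hs_norm2] requires. *)
Lemma tensor_word_form n f : tensor (word_form (n := n) f) <->
  [/\ mlinear n f, forall p, bounded_form n (at_level p f) & forall p, (tnorm2 p n f < +oo)%E].
Proof.
split=> [[/mlinear_multilinear fl ff]|[fl fb ff]]; last first.
  by split=> [|p]; [exact/mlinear_multilinear|rewrite form_norm2E].
have fb p : bounded_form n (at_level p f).
  apply: (bounded_form_of_hs_norm2 (ci_basis ci)); first exact: mlinear_at_level.
    move=> s h t st h0; rewrite /at_level map_cat /=.
    have -> : power_distr A p h = 0.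
      apply: val_inj; apply/funext => xi /=; rewrite /power_distr_fun.
      apply/eqP; rewrite -sqrf_eq0 eq_le sqr_ge0 andbT.
      by apply: le_trans (cauchy_schwarz_sq _ _) _; rewrite h0 mul0r.
    by apply: (@mlinear0 _ n) => //; rewrite !size_map.
  by rewrite -form_norm2_at_level.
by split=> // p; rewrite -form_norm2E.
Qed.

Lemma sym_tensor_word_form n f : sym_tensor (word_form (n := n) f) <-> symtensor n f.
Proof.
split=> [[/tensor_word_form[fl fb ff] /symmetric_on_permute fs]|[fl fs fb ff]]; first by split.
by split; [apply/tensor_word_form|apply/symmetric_on_permute].
Qed.

End Tensors.

(** * Comparison of the norms of different orders *)

Section NormEstimates.
Context (R : realType) (A : operator R) (B : L2R R -> L2R R) (e : nat -> L2R R) (rho : R).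
Hypothesis ci : contractive_inverse A B e rho.
Local Notation H := (L2R R).
Local Notation E' := (distr A).
Local Notation tnorm2 := (tnorm2 e).
Local Notation symtensor := (symtensor e).
Implicit Types (f g : seq E' -> R[i]).

Lemma tnorm2_ge0 p n f : (0 <= tnorm2 p n f)%E.
Proof. by apply: isum_ge0 => s; exact: sqnormc_ge0. Qed.
Hint Resolve tnorm2_ge0 : core.

Lemma dot_iterB k h : dot (iter k B h) (iter k B h) <= (rho ^+ 2) ^+ k * dot h h.
Proof.
elim: k => [|k IH]; first by rewrite mul1r.
rewrite iterS; apply: le_trans (ci_bound ci _) _.
by rewrite [_ ^+ k.+1]exprS -mulrA ler_wpM2l ?sqr_ge0.
Qed.

Lemma rho2_le1 : rho ^+ 2 <= 1.
Proof. by rewrite expr_le1 ?ltW ?(ci_rho_gt0 ci)// (ci_rho_lt1 ci). Qed.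

Lemma dot_iterB_le k h : dot (iter k B h) (iter k B h) <= dot h h.
Proof.
apply: le_trans (dot_iterB k h) _; rewrite ler_piMl ?dot_ge0//.
by rewrite exprn_ile1 ?sqr_ge0// rho2_le1.
Qed.

Lemma iterB_sym k u v : dot (iter k B u) v = dot u (iter k B v).
Proof. by elim: k v => //= k IH v; rewrite (ci_sym ci) IH -iterS iterSr. Qed.

Lemma bessel_iterB k : bessel_family (fun i => iter k B (e i)) ((rho ^+ 2) ^+ k).
Proof.
split=> [|n h]; first by rewrite exprn_ge0// sqr_ge0.
apply: le_trans (dot_iterB k h).
apply: le_trans (bessel (ci_basis ci) n (iter k B h)).
rewrite big_mkord; apply: ler_sum => i _.
by rewrite iterB_sym dotC.
Qed.

Lemma bessel_iterB1 k : bessel_family (fun i => iter k B (e i)) 1.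
Proof.
have [h1 h2] := bessel_iterB k; split=> // n h; apply: le_trans (h2 n h) _.
by rewrite ler_wpM2r ?dot_ge0// exprn_ile1 ?sqr_ge0// rho2_le1.
Qed.

Lemma bessel_single (h : H) : bessel_family (fun i => if i is 0%N then h else 0) (dot h h).
Proof.
split=> [|n u]; first exact: dot_ge0.
case: n => [|n]; first by rewrite big_nil mulr_ge0 ?dot_ge0.
rewrite big_nat_recl// big1 ?addr0; first exact: cauchy_schwarz_sq.
by move=> i _; rewrite dot0l expr0n.
Qed.

Lemma isum_ge_first X (V : seq (nat -> X)) (phi : seq X -> \bar R) : (forall s, (0 <= phi s)%E) ->
  (phi [seq v 0%N | v <- V] <= isum V phi)%E.
Proof.
elim: V phi => [|v V IH] phi p0 //=.
apply: le_trans (nneseries_lim_ge 1 _); last by move=> i _ _; exact: isum_ge0.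
by rewrite big_nat1; exact: (IH (fun s => phi (v 0%N :: s))).
Qed.

Definition single_families (hs : seq H) : seq ((nat -> H) * R) :=
  [seq ((fun i => if i is 0%N then h else 0), dot h h) | h <- hs].

Lemma all_bessel_cat (V W : seq ((nat -> H) * R)) :
  all_bessel V -> all_bessel W -> all_bessel (V ++ W).
Proof. by elim: V => //= v V IH [vb Vb] Wb; split=> //; exact: IH. Qed.

Lemma all_bessel_single hs : all_bessel (single_families hs).
Proof. by elim: hs => //= h hs IH; split=> //; exact: bessel_single. Qed.

Lemma all_bessel_nseq n (v : nat -> H) (r : R) : bessel_family v r -> all_bessel (nseq n (v, r)).
Proof. by move=> vb; elim: n => //= n IH. Qed.

Lemma prod_single hs : \prod_(v <- single_families hs) v.2 = \prod_(h <- hs) dot h h.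
Proof. by rewrite big_map. Qed.

Lemma prod_nseq n (v : nat -> H) (r : R) : \prod_(w <- nseq n (v, r)) w.2 = r ^+ n.
Proof. by elim: n => [|n IH]; rewrite ?big_nil //= big_cons IH exprS. Qed.

(** A fixed argument is a Bessel family with only one nonzero member, and
    the basis at order p is the Bessel family of the B^k (e i) at order p + k. *)
Lemma at_level_section p k n m f hs : mlinear (n + m) f -> bounded_form (n + m) (at_level p f) -> size hs = n ->
  (isum (nseq m e) (fun t => sqnormc (at_level p f (hs ++ map (iter k B) t))) <=
   (\prod_(h <- hs) dot h h)%:E * tnorm2 p (n + m) f)%E.
Proof.
move=> fl fb hn.
have := @isum_contract _ e (ci_basis ci)
  (single_families hs ++ nseq m ((fun i => iter k B (e i)), 1)) (at_level p f).
rewrite !size_cat size_nseq size_map hn big_cat/= prod_single prod_nseq expr1n mulr1.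
move=> /(_ (mlinear_at_level p fl) fb (all_bessel_cat (all_bessel_single _) (all_bessel_nseq _ (bessel_iterB1 _)))).
apply: le_trans; rewrite map_cat map_nseq isum_cat.
apply: le_trans (isum_ge_first _ _); last first.
  by move=> s; apply: isum_ge0 => t; exact: sqnormc_ge0.
rewrite -!map_comp/= map_id.
by rewrite -(map_nseq m (fun v i => iter k B (v i)) e) isum_map.
Qed.

Lemma at_level_bound p n f hs : mlinear n f -> bounded_form n (at_level p f) -> size hs = n ->
  (sqnormc (at_level p f hs) <= (\prod_(h <- hs) dot h h)%:E * tnorm2 p n f)%E.
Proof.
move=> fl fb hn; rewrite -(addn0 n) in fl fb *.
by have := at_level_section 0 fl fb hn; rewrite /= cats0.
Qed.

Lemma at_level_shift p k f hs : at_level p f hs = at_level (p + k) f (map (iter k B) hs).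
Proof.
rewrite /at_level -map_comp; congr f; apply: eq_map => h /=; exact: (power_distr_add ci).
Qed.

(** Each variable gains a factor rho^k, since A^p h = A^(p + k) (B^k h). The gain
    is exponential in the degree n; it compensates for the constants of
    [weight_ratio]. *)
Lemma tnorm2_shift p k n f : mlinear n f -> bounded_form n (at_level (p + k) f) ->
  (tnorm2 p n f <= (((rho ^+ 2) ^+ k) ^+ n)%:E * tnorm2 (p + k) n f)%E.
Proof.
move=> fl fb; have := @isum_contract _ e (ci_basis ci)
  (nseq n ((fun i => iter k B (e i)), (rho ^+ 2) ^+ k)) (at_level (p + k) f).
rewrite size_nseq prod_nseq => /(_ (mlinear_at_level (p + k) fl) fb (all_bessel_nseq _ (bessel_iterB _))).
apply: le_trans; rewrite map_nseq/= -(map_nseq n (fun v i => iter k B (v i)) e) isum_map.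
by rewrite /tnorm2 (eq_isum (psi := fun s => sqnormc (at_level (p + k) f (map (iter k B) s))))// => s _;
  rewrite -at_level_shift.
Qed.

Lemma tnorm2_mono p q n f : (p <= q)%N -> mlinear n f -> bounded_form n (at_level q f) ->
  (tnorm2 p n f <= tnorm2 q n f)%E.
Proof.
move=> /subnKC <- fl fb; apply: le_trans (tnorm2_shift fl fb) _.
rewrite -[leRHS]mul1e lee_wpmul2r// lee_fin.
have h0 : 0 <= (rho ^+ 2) ^+ (q - p) by rewrite exprn_ge0// sqr_ge0.
have h1 : (rho ^+ 2) ^+ (q - p) <= 1 by rewrite exprn_ile1 ?sqr_ge0// rho2_le1.
by rewrite exprn_ile1.
Qed.

(** The letters of s are A^p h_i for a common p. *)
Lemma word_bound (s : seq E') : exists p c, 0 <= c /\ forall f, symtensor (size s) f ->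
  (sqnormc (f s) <= c%:E * tnorm2 p (size s) f)%E.
Proof.
have [p [hs ->]] := distr_word_repr ci s.
exists p, (\prod_(h <- hs) dot h h); split.
  by apply: prodr_ge0 => h _; exact: dot_ge0.
by move=> f; rewrite size_map => -[fl _ fb _]; exact: (at_level_bound fl (fb p)).
Qed.

End NormEstimates.

(** * Contraction with a functional *)

Section ContractionOperator.
Context (R : realType) (A : operator R) (B : L2R R -> L2R R) (e : nat -> L2R R) (rho : R).
Hypothesis ci : contractive_inverse A B e rho.
Local Notation H := (L2R R).
Local Notation E' := (distr A).
Local Notation tnorm2 := (tnorm2 e).
Local Notation symtensor := (symtensor e).
Implicit Types (f g : seq E' -> R[i]).
Hint Resolve tnorm2_ge0 : core.

Definition wtensor m g := [/\ mlinear m g, forall p, bounded_form m (at_level p g) &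
  forall p, (tnorm2 p m g < +oo)%E].

Lemma wtensor_section n m f s : symtensor (n + m) f -> size s = n ->
  wtensor m (fun y => f (s ++ y)).
Proof.
move=> [fl _ fb ff] sn; have [p0 [hs sE]] := distr_word_repr ci s.
have hn : size hs = n by rewrite -sn sE size_map.
have E p t : at_level p (fun y => f (s ++ y)) t =
    at_level (p + p0) f (map (iter p B) hs ++ map (iter p0 B) t).
  rewrite /at_level map_cat -!map_comp sE; congr (f (_ ++ _)); apply: eq_map => h /=.
    by rewrite addnC; exact: (power_distr_add ci).
  exact: (power_distr_add ci).
split.
- by move=> t u a y z tu; rewrite !catA; apply: fl; rewrite size_cat sn -tu -addnA addnS.
- move=> p; have [c [c0 fc]] := fb (p + p0)%N.
  exists (c * \prod_(h <- map (iter p B) hs) dot h h); split.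
    by rewrite mulr_ge0// prodr_ge0// => h _; exact: dot_ge0.
  move=> t tm; rewrite E; apply: le_trans (fc _ _) _; first by rewrite size_cat !size_map hn tm.
  rewrite big_cat/= mulrA ler_wpM2l ?mulr_ge0//.
    by rewrite prodr_ge0// => h _; exact: dot_ge0.
  rewrite big_map; apply: ler_prod => h _; rewrite dot_ge0/=; exact: (dot_iterB_le ci).
- move=> p; have hn' : size (map (iter p B) hs) = n by rewrite size_map.
  have -> : tnorm2 p m (fun y => f (s ++ y)) =
     isum (nseq m e) (fun t => sqnormc (at_level (p + p0) f (map (iter p B) hs ++ map (iter p0 B) t))).
    by apply: eq_isum => t _; rewrite E.
  apply: le_lt_trans (at_level_section ci p0 fl (fb (p + p0)%N) hn') _; apply: lte_mul_pinfty => //.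
  by rewrite lee_fin prodr_ge0// => h _; exact: dot_ge0.
Qed.

Section Ctr.
Variables (m : nat) (K : functional A m).
Hypothesis hK : dual_tensor K.

Definition contract f : seq E' -> R[i] := fun s => K (word_form (n := m) (fun y => f (s ++ y))).

Lemma dual_lin a f g : wtensor m f -> wtensor m g ->
  K (word_form (n := m) (fun s => a * f s + g s)) = a * K (word_form (n := m) f) + K (word_form (n := m) g).
Proof.
move=> /(tensor_word_form ci) tf /(tensor_word_form ci) tg; exact: (hK.1 a _ _ tf tg).
Qed.

Lemma dual_bound : exists p c, 0 <= c /\ forall f, wtensor m f ->
  (sqnormc (K (word_form (n := m) f)) <= c%:E * tnorm2 p m f)%E.
Proof.
have [_ [p [c Kb]]] := hK; exists p, (`|c| * p.+1%:R); split; first by rewrite mulr_ge0.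
move=> f wf; have [fl fb ff] := wf; have tf := (tensor_word_form ci _ _).2 wf.
apply: le_trans (Kb _ tf) _.
under eq_bigr do rewrite (form_norm2E ci)//.
apply: (@le_trans _ _ (`|c|%:E * \sum_(q < p.+1) tnorm2 q m f)%E).
  rewrite lee_wpmul2r ?lee_fin ?ler_norm//.
  by apply: sume_ge0 => q _; exact: tnorm2_ge0.
rewrite EFinM -muleA lee_wpmul2l ?lee_fin//.
apply: (@le_trans _ _ (\sum_(q < p.+1) tnorm2 p m f)%E).
  by apply: lee_sum => q _; apply: (tnorm2_mono ci); rewrite // -ltnS.
by rewrite big_const card_ord iter_addr_0 mule_natl.
Qed.

(** The bound of K turns the sum over n variables into one over n + m variables,
    with the basis at order p in the first ones and at order p0 in the last ones. At order
    p the latter is the family of the B^(p - p0) (e i), which is a Bessel family. *)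
Lemma contract_tnorm2_aux p0 c p n f : 0 <= c ->
  (forall f, wtensor m f -> (sqnormc (K (word_form (n := m) f)) <= c%:E * tnorm2 p0 m f)%E) ->
  (p0 <= p)%N -> symtensor (n + m) f -> (tnorm2 p n (contract f) <= c%:E * tnorm2 p (n + m) f)%E.
Proof.
move=> c0 Kb /subnK pE tf; have [fl fs fb ff] := tf.
set k := (p - p0)%N in pE.
have shift t : map (power_distr A p0) t = map (power_distr A p) (map (iter k B) t).
  by rewrite -map_comp -pE addnC; apply: eq_map => h /=; exact: (power_distr_add ci).
apply: (@le_trans _ _ (isum (nseq n e) (fun s => c%:E *
    isum (nseq m e) (fun t => sqnormc (at_level p f (s ++ map (iter k B) t))))%E)).
  apply: le_isum => [s|s]; rewrite ?size_nseq; first exact: sqnormc_ge0.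
  move=> sn; have sn' : size (map (power_distr A p) s) = n by rewrite size_map.
  apply: le_trans (Kb _ (wtensor_section tf sn')) _; rewrite lee_wpmul2l ?lee_fin//.
  by apply: le_isum => [t|t _]; [exact: sqnormc_ge0|rewrite /at_level map_cat shift].
rewrite isumZl; last by move=> s; apply: isum_ge0 => t; exact: sqnormc_ge0.
rewrite lee_wpmul2l ?lee_fin//.
have := @isum_contract _ e (ci_basis ci)
  (nseq n (e, 1) ++ nseq m ((fun i => iter k B (e i)), 1)) (at_level p f).
rewrite size_cat !size_nseq big_cat/= !prod_nseq !expr1n mul1r mul1e => h.
apply: le_trans (h (mlinear_at_level p fl) (fb p) _).
  rewrite map_cat !map_nseq isum_cat/=.
  apply: le_isum => [s|s _]; first by apply: isum_ge0 => t; exact: sqnormc_ge0.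
  by rewrite -(map_nseq m (fun v i => iter k B (v i)) e) isum_map.
by apply: all_bessel_cat; apply: all_bessel_nseq; [exact: (bessel_iterB1 ci 0)|exact: (bessel_iterB1 ci)].
Qed.

Lemma contract_symtensor n f : symtensor (n + m) f -> symtensor n (contract f).
Proof.
move=> tf; have [fl fs fb ff] := tf; have [p0 [c [c0 Kb]]] := dual_bound.
have ctrb p hs : size hs = n -> (sqnormc (at_level p (contract f) hs) <= c%:E *
    ((\prod_(h <- hs) dot h h)%:E * tnorm2 (p + p0) (n + m) f))%E.
  move=> hn; have sn : size (map (power_distr A p) hs) = n by rewrite size_map.
  apply: le_trans (Kb _ (wtensor_section tf sn)) _; rewrite lee_wpmul2l ?lee_fin//.
  have hn' : size (map (iter p0 B) hs) = n by rewrite size_map.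
  have -> : tnorm2 p0 m (fun y => f (map (power_distr A p) hs ++ y)) =
     isum (nseq m e) (fun t => sqnormc (at_level (p + p0) f (map (iter p0 B) hs ++ map (iter p B) t))).
    apply: eq_isum => t _.
    rewrite /at_level map_cat -!map_comp; congr (sqnormc (f (_ ++ _))); apply: eq_map => h /=.
      exact: (power_distr_add ci).
    by rewrite addnC; exact: (power_distr_add ci).
  apply: le_trans (at_level_section ci p fl (fb (p + p0)%N) hn') _.
  rewrite lee_wpmul2r ?tnorm2_ge0// lee_fin big_map.
  by apply: ler_prod => h _; rewrite dot_ge0/=; exact: (dot_iterB_le ci).
have nfin p : tnorm2 p (n + m) f \is a fin_num by rewrite ge0_fin_numE ?tnorm2_ge0.
have cb p : bounded_form n (at_level p (contract f)).
  exists (c * fine (tnorm2 (p + p0) (n + m) f)); split.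
    by rewrite mulr_ge0// fine_ge0.
  move=> hs hn; rewrite -lee_fin; apply: le_trans (ctrb p hs hn) _.
  by rewrite -(fineK (nfin _)) -!EFinM lee_fin [X in c * X <= _]mulrC mulrA.
have cl : mlinear n (contract f).
  move=> s t a y z st; rewrite /contract.
  have w x : wtensor m (fun w => f ((s ++ x :: t) ++ w)).
    by apply: (wtensor_section tf); rewrite size_cat /= addnS.
  rewrite -(dual_lin _ (w y) (w z)); congr K; apply/funext => x; rewrite /word_form.
  rewrite -!catA /=; apply: fl; rewrite size_cat size_map size_enum_ord -st; lia.
split=> //.
- move=> s t sn st; rewrite /contract; congr K; apply/funext => x; rewrite /word_form.
  apply: fs; first by rewrite size_cat sn size_map size_enum_ord.
  by rewrite perm_cat2r.
- move=> p; apply: le_lt_trans (tnorm2_mono ci (leq_addr p0 p) cl (cb _)) _.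
  apply: le_lt_trans (contract_tnorm2_aux c0 Kb (leq_addl p p0) tf) _.
  by apply: lte_mul_pinfty.
Qed.

Lemma contract_tnorm2 : exists p0 c, 0 <= c /\ forall p n f, (p0 <= p)%N -> symtensor (n + m) f ->
  (tnorm2 p n (contract f) <= c%:E * tnorm2 p (n + m) f)%E.
Proof.
have [p0 [c [c0 Kb]]] := dual_bound; exists p0, c; split=> // p n f p0p tf.
exact: contract_tnorm2_aux c0 Kb p0p tf.
Qed.

Lemma iter_contract_symtensor k n f : symtensor (n + k * m) f -> symtensor n (iter k contract f).
Proof.
elim: k n f => [|k IH] n f; first by rewrite addn0.
by move=> tf; rewrite iterS; apply: contract_symtensor; apply: IH; rewrite -addnA -mulSn.
Qed.

Lemma iter_contract_tnorm2 : exists p0 c, 0 <= c /\ forall p k n f, (p0 <= p)%N ->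
  symtensor (n + k * m) f -> (tnorm2 p n (iter k contract f) <= (c ^+ k)%:E * tnorm2 p (n + k * m) f)%E.
Proof.
have [p0 [c [c0 Kb]]] := contract_tnorm2; exists p0, c; split=> // p k n f p0p.
elim: k n f => [|k IH] n f; first by rewrite addn0 mul1e.
move=> tf; have E : (n + k.+1 * m = n + m + k * m)%N by rewrite mulSn addnA.
rewrite iterS; rewrite E in tf *; apply: le_trans (Kb _ _ _ p0p _) _.
  exact: iter_contract_symtensor.
by rewrite exprS EFinM -muleA lee_wpmul2l ?lee_fin//; exact: IH.
Qed.

End Ctr.
End ContractionOperator.

(** * The space of coefficients *)

Section WeightedSpace.
Context (R : realType) (A : operator R) (B : L2R R -> L2R R) (e : nat -> L2R R) (rho : R).
Hypothesis ci : contractive_inverse A B e rho.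
Variable beta : R.
Hypothesis beta0 : 0 <= beta.
Local Notation H := (L2R R).
Local Notation E' := (distr A).
Local Notation tnorm2 := (tnorm2 e).
Local Notation symtensor := (symtensor e).
Implicit Types (f g : seq E' -> R[i]).

Lemma lte_scale (c : R) (x : \bar R) : 0 <= c -> (x < +oo)%E -> (c%:E * x < +oo)%E.
Proof. by move=> c0 x1; apply: lte_mul_pinfty => //; rewrite lee_fin. Qed.

Definition chaos_weight n : R := n`!%:R `^ (1 + beta).

Lemma chaos_weight_ge1 n : 1 <= chaos_weight n.
Proof.
have E : (1 : R) = 1 `^ (1 + beta) by rewrite powR1.
rewrite /chaos_weight [leLHS]E; apply: ge0_ler_powR.
- by rewrite addr_ge0.
- by rewrite nnegrE.
- by rewrite nnegrE.
- by rewrite ler1n fact_gt0.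
Qed.

Lemma chaos_weight_ge0 n : 0 <= chaos_weight n.
Proof. exact: le_trans (chaos_weight_ge1 n). Qed.

(** The squared norm |.|_(p, beta), see [chaos_norm2E]. *)
Definition gnorm2 p f : \bar R := (\sum_(0 <= n <oo) (chaos_weight n)%:E * tnorm2 p n f)%E.

Lemma weighted_tnorm2_ge0 p n f : (0 <= (chaos_weight n)%:E * tnorm2 p n f)%E.
Proof. by rewrite mule_ge0 ?lee_fin ?chaos_weight_ge0// tnorm2_ge0. Qed.

Lemma gnorm2_ge0 p f : (0 <= gnorm2 p f)%E.
Proof. by apply: nneseries_ge0 => n _ _; exact: weighted_tnorm2_ge0. Qed.

Lemma weighted_tnorm2_le_gnorm2 p n f : ((chaos_weight n)%:E * tnorm2 p n f <= gnorm2 p f)%E.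
Proof.
apply: le_trans (nneseries_lim_ge n.+1 _); last by move=> k _ _; exact: weighted_tnorm2_ge0.
by rewrite big_nat_recr//= leeDr// sume_ge0// => k _; exact: weighted_tnorm2_ge0.
Qed.

Lemma tnorm2_le_gnorm2 p n f : (tnorm2 p n f <= gnorm2 p f)%E.
Proof.
apply: le_trans (weighted_tnorm2_le_gnorm2 p n f); rewrite -[leLHS]mul1e lee_wpmul2r ?tnorm2_ge0//.
by rewrite lee_fin chaos_weight_ge1.
Qed.

Definition in_gamma f := (forall n, symtensor n f) /\ forall p, (gnorm2 p f < +oo)%E.

Lemma chaos_norm2E p f : (forall n, symtensor n f) ->
  chaos_norm2 beta p (fun n => word_form f : nform A n) = gnorm2 p f.
Proof.
move=> tf; apply: eq_eseriesr => n _; have [fl _ fb _] := tf n.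
by rewrite (form_norm2E ci).
Qed.

Definition lin_comb (b : R[i]) f g : seq E' -> R[i] := fun s => b * f s + g s.

Lemma sqnormc_lin_comb (b x y : R[i]) : (sqnormc (b * x + y)%R <=
  (2 * normc b ^+ 2)%:E * sqnormc x + 2%:E * sqnormc y)%E.
Proof.
rewrite /sqnormc -!EFinM -EFinD lee_fin.
have h := le_normcD (b * x) y; rewrite Normc.normcM in h.
have := sqr_ge0 (normc b * normc x - normc y).
have : normc (b * x + y) ^+ 2 <= (normc b * normc x + normc y) ^+ 2.
  by rewrite ler_sqr ?nnegrE ?addr_ge0 ?mulr_ge0 ?normc_ge0.
nra.
Qed.

Lemma isum_lin_comb (V : seq (nat -> H)) b (f g : seq H -> R[i]) :
  (isum V (fun s => sqnormc (b * f s + g s)%R) <= (2 * normc b ^+ 2)%:E * isum V (fun s => sqnormc (f s)) +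
    2%:E * isum V (fun s => sqnormc (g s)))%E.
Proof.
have b0 : 0 <= 2 * normc b ^+ 2 by rewrite mulr_ge0 ?sqr_ge0.
apply: (@le_trans _ _ (isum V (fun s => \sum_(0 <= k < 2)
    (if k is 0%N then (2 * normc b ^+ 2)%:E * sqnormc (f s) else 2%:E * sqnormc (g s))%E))).
  apply: le_isum => [s|s _]; first exact: sqnormc_ge0.
  by rewrite big_nat_recl// big_nat1; exact: sqnormc_lin_comb.
rewrite isum_sum; last first.
  by move=> [|k] s; rewrite mule_ge0 ?sqnormc_ge0 ?lee_fin.
by rewrite big_nat_recl// big_nat1 !isumZl// => s; exact: sqnormc_ge0.
Qed.

Lemma tnorm2_lin_comb p n b f g :
  (tnorm2 p n (lin_comb b f g) <= (2 * normc b ^+ 2)%:E * tnorm2 p n f + 2%:E * tnorm2 p n g)%E.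
Proof. exact: isum_lin_comb. Qed.

Lemma symtensor_lin_comb n b f g : symtensor n f -> symtensor n g -> symtensor n (lin_comb b f g).
Proof.
move=> [fl fs fb ff] [gl gs gb gf]; split.
- move=> s t a y z st; rewrite /lin_comb fl// gl//; ring.
- by move=> s t sn st; rewrite /lin_comb (fs s t)// (gs s t).
- move=> p; have [c [c0 hc]] := fb p; have [d [d0 hd]] := gb p.
  exists (2 * normc b ^+ 2 * c + 2 * d); split.
    have nb : 0 <= 2 * normc b ^+ 2 by rewrite mulr_ge0 ?sqr_ge0.
    by apply: addr_ge0; apply: mulr_ge0.
  move=> s sn; have := sqnormc_lin_comb b (at_level p f s) (at_level p g s).
  rewrite /sqnormc -!EFinM -EFinD lee_fin => h; apply: le_trans h _.
  have nb : 0 <= 2 * normc b ^+ 2 by rewrite mulr_ge0 ?sqr_ge0.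
  rewrite [leRHS]mulrDl -[2 * normc b ^+ 2 * c * _]mulrA -[2 * d * _]mulrA.
  by apply: lerD; rewrite ler_wpM2l//; [exact: hc|exact: hd].
- move=> p; apply: le_lt_trans (tnorm2_lin_comb _ _ _ _ _) _.
  have nb : 0 <= 2 * normc b ^+ 2 by rewrite mulr_ge0 ?sqr_ge0.
  by apply: lte_add_pinfty; exact: lte_scale.
Qed.

Lemma gnorm2_lin_comb p b f g :
  (gnorm2 p (lin_comb b f g) <= (2 * normc b ^+ 2)%:E * gnorm2 p f + 2%:E * gnorm2 p g)%E.
Proof.
have b0 : 0 <= 2 * normc b ^+ 2 by rewrite mulr_ge0 ?sqr_ge0.
rewrite /gnorm2 -!nneseriesZl; try by move=> *; exact: weighted_tnorm2_ge0.
rewrite -nneseriesD; try by move=> *; rewrite mule_ge0 ?weighted_tnorm2_ge0 ?lee_fin.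
apply: lee_nneseries => n; first by move=> *; exact: weighted_tnorm2_ge0.
move=> _; apply: le_trans (lee_wpmul2l _ (tnorm2_lin_comb _ _ _ _ _)) _; first by rewrite lee_fin chaos_weight_ge0.
rewrite ge0_muleDr ?mule_ge0 ?lee_fin ?tnorm2_ge0//.
by rewrite !(muleCA (chaos_weight n)%:E).
Qed.

Lemma in_gamma_lin_comb b f g : in_gamma f -> in_gamma g -> in_gamma (lin_comb b f g).
Proof.
move=> [tf ff] [tg gf]; split=> [n|p]; first exact: symtensor_lin_comb.
apply: le_lt_trans (gnorm2_lin_comb _ _ _ _) _.
have nb : 0 <= 2 * normc b ^+ 2 by rewrite mulr_ge0 ?sqr_ge0.
  by apply: lte_add_pinfty; exact: lte_scale.
Qed.

Definition truncate M f : seq E' -> R[i] := fun s => if (size s < M)%N then f s else 0.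

Lemma eq_symtensor n f g : (forall s, size s = n -> f s = g s) -> symtensor n f -> symtensor n g.
Proof.
by move=> fg /(sym_tensor_word_form ci) h; apply/(sym_tensor_word_form ci); rewrite -(eq_word_form fg).
Qed.

Lemma eq_tnorm2 p n f g : (forall s, size s = n -> f s = g s) -> tnorm2 p n f = tnorm2 p n g.
Proof.
by move=> fg; apply: eq_isum => s; rewrite size_nseq /at_level => sn; rewrite fg// size_map.
Qed.

Lemma tnorm2_0 p n : tnorm2 p n ((fun=> 0) : seq E' -> R[i]) = 0%E.
Proof.
apply/eqP; rewrite eq_le tnorm2_ge0 andbT.
rewrite /tnorm2 (eq_isum (psi := fun s => 0%:E * 0)%E).
  by rewrite isumZl// mul0e.
by move=> s _; rewrite mule0 /sqnormc /at_level Normc.normc0 expr0n.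
Qed.

Lemma symtensor_0 n : symtensor n ((fun=> 0) : seq E' -> R[i]).
Proof.
split=> //.
- by move=> s t a y z _; rewrite mulr0 addr0.
- move=> p; exists 0; split=> // s _.
  by rewrite mul0r /at_level Normc.normc0 expr0n.
- by move=> p; rewrite tnorm2_0.
Qed.

Lemma symtensor_truncate M n f : symtensor n f -> symtensor n (truncate M f).
Proof.
have [nM|nM] := ltnP n M; first by apply: eq_symtensor => s sn; rewrite /truncate sn nM.
by move=> _; apply: eq_symtensor (symtensor_0 n) => s sn; rewrite /truncate sn ltnNge nM.
Qed.

Lemma tnorm2_truncate p M n f : tnorm2 p n (truncate M f) = if (n < M)%N then tnorm2 p n f else 0%E.
Proof.
case: ltnP => nM; first by apply: eq_tnorm2 => s sn; rewrite /truncate sn nM.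
by rewrite -(tnorm2_0 p n); apply: eq_tnorm2 => s sn; rewrite /truncate sn ltnNge nM.
Qed.

Lemma gnorm2_truncate p M f : gnorm2 p (truncate M f) = (\sum_(0 <= n < M) (chaos_weight n)%:E * tnorm2 p n f)%E.
Proof.
rewrite /gnorm2 (@nneseries_split _ _ 0%N M); last by move=> *; exact: weighted_tnorm2_ge0.
rewrite add0n [X in (_ + X)%E]eseries0 ?adde0.
  by apply: eq_big_nat => n /andP[_ nM]; rewrite tnorm2_truncate nM.
by move=> n Mn _; rewrite tnorm2_truncate ltnNge Mn mule0.
Qed.

Lemma in_gamma_truncate M f : (forall n, symtensor n f) -> in_gamma (truncate M f).
Proof.
move=> tf; split=> [n|p]; first exact: symtensor_truncate.
rewrite gnorm2_truncate big_seq_cond; elim/big_ind : _ => // [x y hx hy|n _].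
  exact: lte_add_pinfty.
by apply: lte_scale; [exact: chaos_weight_ge0|have [_ _ _] := tf n].
Qed.

Lemma gnorm2_tail p f : in_gamma f -> (fun M => gnorm2 p (lin_comb (-1) (truncate M f) f)) @ \oo --> 0%E.
Proof.
move=> [_ gf].
have -> : (fun M => gnorm2 p (lin_comb (-1) (truncate M f) f)) =
  (fun M => \sum_(M <= n <oo) (chaos_weight n)%:E * tnorm2 p n f)%E.
  apply/funext => M; rewrite /gnorm2 (@nneseries_split _ _ 0%N M); last by move=> *; exact: weighted_tnorm2_ge0.
  rewrite add0n big_nat big1 ?add0e.
    apply: congr_lim; apply/funext => N; apply: eq_big_nat => n /andP[Mn _].
    congr (_ * _)%E; apply: eq_tnorm2 => s sn.
    by rewrite /lin_comb /truncate sn ltnNge Mn mulr0 add0r.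
  move=> n /andP[_ nM]; rewrite (eq_tnorm2 p (g := fun=> 0)) ?tnorm2_0 ?mule0// => s sn.
  by rewrite /lin_comb /truncate sn nM mulN1r addNr.
by apply: nneseries_tail_cvg => [|n _]; [exact: gf|exact: weighted_tnorm2_ge0].
Qed.

Lemma in_gamma_word_bound (s : seq E') : exists p c, 0 <= c /\ forall f, in_gamma f ->
  (sqnormc (f s) <= c%:E * gnorm2 p f)%E.
Proof.
have [p [c [c0 hc]]] := word_bound ci s; exists p, c; split=> // f [tf _].
by apply: le_trans (hc f (tf _)) _; rewrite lee_wpmul2l ?lee_fin// tnorm2_le_gnorm2.
Qed.

End WeightedSpace.

(** * Factorial estimates *)

Section FactorialEstimates.

Lemma leq_expl m n e : (m <= n -> m ^ e <= n ^ e)%N.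
Proof. by case: e => // e mn; rewrite leq_exp2r. Qed.

Lemma bin_le_exp2 n m : ('C(n, m) <= 2 ^ n)%N.
Proof.
elim: n m => [|n IH] [|m]; rewrite ?bin0 ?expn_gt0//.
by rewrite binS expnS mul2n -addnn leq_add.
Qed.

Lemma fact_add_le m r : ((m + r)`! <= m`! * (m + r) ^ r)%N.
Proof.
elim: r => [|r IH]; first by rewrite addn0 expn0 muln1.
rewrite addnS factS expnS mulnCA leq_mul2l /=; apply: leq_trans IH _.
by rewrite leq_mul2l leq_expl ?orbT.
Qed.

Lemma fact_mul_le k r : ((k * r)`! <= (r ^ k * k`!) ^ r)%N.
Proof.
elim: k => [|k IH]; first by rewrite mul0n fact0 expn0 exp1n.
rewrite mulSn addnC; apply: leq_trans (fact_add_le _ _) _.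
apply: (@leq_trans ((r ^ k * k`!) ^ r * (k * r + r) ^ r)); first by rewrite leq_mul2r IH orbT.
by rewrite -expnMn leq_expl // factS expnS; apply/eq_leq; rewrite -mulSnr; lia.
Qed.

(** (n + k r)! is n! (k r)! times a binomial coefficient, which is at most
    2^(n + k r), and (k r)! is at most (r^k k!)^r. *)
Lemma fact_ratio_le n k r : (0 < r)%N ->
  ((n + k * r)`! <= n`! * (2 ^ (n + k * r) * (r ^ k * k`!)) ^ r)%N.
Proof.
move=> r0; have := bin_fact (leq_addr (k * r) n); rewrite addKn => <-.
rewrite mulnCA leq_mul2l -implyNb; apply/implyP => _.
rewrite expnMn leq_mul ?fact_mul_le//; apply: leq_trans (bin_le_exp2 _ _) _.
by rewrite -[leqLHS]expn1 leq_pexp2l// expn_gt0.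
Qed.

Variable R : realType.

Lemma powR_le_sqr (X Y b : R) r : 1 <= X -> 1 <= Y -> X <= Y ^+ r -> 0 <= b ->
  r%:R * b <= 2 -> X `^ b <= Y ^+ 2.
Proof.
move=> X1 Y1 XY b0 rb.
have Y0 : 0 <= Y by exact: le_trans Y1.
apply: (@le_trans _ _ ((Y ^+ r) `^ b)).
  by apply: ge0_ler_powR => //; rewrite nnegrE ?exprn_ge0//; exact: le_trans X1.
rewrite -(powR_mulrn r Y0) -powRrM -(powR_mulrn 2 Y0).
exact: ler_powR.
Qed.

(** With X = (n + k r)! / n!, the square X^2 is the product of X^(1 + beta), which
    changes the weight of degree n into that of degree n + k r, and of X^(1 - beta). By
    [fact_ratio_le] X is at most the r-th power of Y = 2^(n + k r) r^k k!, so
    r (1 - beta) <= 2 bounds X^(1 - beta) by Y^2. The factor k!^2 is the one that the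
    exponential series divides by. *)
Lemma weight_ratio (beta : R) r n k : (0 < r)%N -> beta <= 1 -> r%:R * (1 - beta) <= 2 ->
  chaos_weight beta n * ((n + k * r)`!%:R / n`!%:R) ^+ 2 <=
  chaos_weight beta (n + k * r) * (4 ^+ (n + k * r) * (r%:R ^+ k * k`!%:R) ^+ 2).
Proof.
move=> r0 b1 rb; set N := (n + k * r)%N; set X : R := N`!%:R / n`!%:R.
have nf : (0 : R) < n`!%:R by rewrite ltr0n fact_gt0.
have X1 : 1 <= X.
  rewrite ler_pdivlMr// mul1r ler_nat /N; elim: (k * r)%N => [|j IH]; first by rewrite addn0.
  by rewrite addnS factS; apply: leq_trans IH _; rewrite leq_pmull.
have X0 : 0 < X by exact: lt_le_trans X1.
have NE : N`!%:R = X * n`!%:R :> R by rewrite /X divfK// gt_eqF.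
have wN : chaos_weight beta N = chaos_weight beta n * X `^ (1 + beta).
  by rewrite /chaos_weight NE powRM ?ltW// mulrC.
have XX : X ^+ 2 = X `^ (1 + beta) * X `^ (1 - beta).
  rewrite -powRD; last by rewrite (gt_eqF X0) implybT.
  by rewrite -powR_mulrn ?ltW//; congr (_ `^ _); ring.
rewrite XX wN mulrA ler_wpM2l ?mulr_ge0 ?powR_ge0//.
have -> : 4 ^+ N * (r%:R ^+ k * k`!%:R) ^+ 2 = (2 ^+ N * (r%:R ^+ k * k`!%:R)) ^+ 2 :> R.
  by rewrite [RHS]exprMn; congr (_ * _); rewrite -exprM mulnC exprM; congr (_ ^+ _); ring.
apply: (@powR_le_sqr _ _ _ r) => //.
- rewrite -!natrX -!natrM ler1n !muln_gt0 !expn_gt0 r0 fact_gt0//.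
- rewrite ler_pdivrMr// -!natrX -!natrM -!natrX -natrM ler_nat mulnC.
  exact: fact_ratio_le.
- by rewrite subr_ge0.
Qed.

End FactorialEstimates.

(** * The exponential of a contraction *)

Section Exponential.
Context (R : realType) (A : operator R) (B : L2R R -> L2R R) (e : nat -> L2R R) (rho : R).
Hypothesis ci : contractive_inverse A B e rho.
Variable beta : R.
Hypotheses (beta0 : 0 <= beta) (beta1 : beta <= 1).
Variable r : nat.
Hypotheses (r0 : (0 < r)%N) (rb : r%:R * (1 - beta) <= 2).
Variable K : functional A r.
Hypothesis hK : dual_tensor K.
Local Notation H := (L2R R).
Local Notation E' := (distr A).
Local Notation tnorm2 := (tnorm2 e).
Local Notation symtensor := (symtensor e).
Local Notation in_gamma := (in_gamma e beta).
Local Notation gnorm2 := (gnorm2 e beta).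
Local Notation chaos_weight := (chaos_weight beta).
Local Notation D k := (iter k (contract K)).
Implicit Types (f g : seq E' -> R[i]).

(** The factor a^k / k! is the one of the exponential. The other one comes from the
    factors (n + r)! / n! of the operator D_K, multiplied along the degrees n + k r, ...,
    n + r. *)
Definition exp_coef (a : R) n k : R := a ^+ k / k`!%:R * ((n + k * r)`!%:R / n`!%:R).

(** The operator exp (a D_K), where D_K f is (n + r)! / n! times the contraction of
    f with K in degree n. *)
Definition contraction_exp a f : seq E' -> R[i] :=
  fun s => complex_series (fun k => (exp_coef a (size s) k)%:C%C * D k f s).

(** The weighted sum of squares that bounds the squared norm of order p of the
    component of degree n of exp (a D_K) f. *)
Definition exp_majorant a p n f : \bar R :=
  (\sum_(0 <= k <oo) (2 ^+ k.+1 * exp_coef a n k ^+ 2)%:E * tnorm2 p n (D k f))%E.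

Lemma iter_contract_all k n f : (forall n, symtensor n f) -> symtensor n (D k f).
Proof. by move=> tf; apply: (iter_contract_symtensor ci hK). Qed.

Lemma small_power (x eps : R) : 0 <= x -> x < 1 -> 0 < eps -> exists q, x ^+ q <= eps.
Proof.
move=> x0 x1 eps0.
have c : (fun n => x ^+ n) @ \oo --> (0 : R) by apply: cvg_expr; rewrite ger0_norm.
have /cvgr_le/(_ eps eps0)[N _ /(_ N (leqnn N)) h] := c.
by exists N.
Qed.

Lemma exp_coef_sqr_ge0 a n k : 0 <= 2 ^+ k.+1 * exp_coef a n k ^+ 2.
Proof. by rewrite mulr_ge0 ?sqr_ge0 ?exprn_ge0. Qed.

(** The k-th term involves f in degree N = n + k r only. Its coefficient is at most
    (4 L)^N times the quotient of the weights, by [weight_ratio]; raising the order by q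
    gains (rho^(2 q))^N, and q is chosen to leave less than 2^-N. *)
Lemma exp_majorant_bound a p : exists P, forall f n, in_gamma f ->
  ((chaos_weight n)%:E * exp_majorant a p n f <= (4 * 2^-1 ^+ n)%:E * gnorm2 P f)%E.
Proof.
have [p0 [c [c0 Kb]]] := iter_contract_tnorm2 ci hK.
(* L is at least 1, so that its k-th power can be replaced by its N-th power. *)
pose L : R := Num.max 1 (2 * a ^+ 2 * c * r%:R ^+ 2).
have L1 : 1 <= L by rewrite le_max lexx.
have L0 : 0 < L by exact: lt_le_trans L1.
have [|||q hq] := @small_power (rho ^+ 2) (8 * L)^-1; rewrite ?sqr_ge0 ?invr_gt0 ?mulr_gt0//.
  by rewrite expr_lt1 ?(ci_rho_lt1 ci)// ltW// (ci_rho_gt0 ci).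
set th := (rho ^+ 2) ^+ q in hq; have th0 : 0 <= th by rewrite exprn_ge0 ?sqr_ge0.
pose p' := maxn p p0.
exists (p' + q)%N => f n [tf ff].
have term k : ((chaos_weight n)%:E * ((2 ^+ k.+1 * exp_coef a n k ^+ 2)%:E * tnorm2 p n (D k f)) <=
    (2 * 2^-1 ^+ n * 2^-1 ^+ k)%:E * gnorm2 (p' + q) f)%E.
  set N := (n + k * r)%N.
  have [dl _ db _] := iter_contract_all k n tf; have [fl _ fb _] := tf N.
  have h1 : (tnorm2 p n (D k f) <= (c ^+ k * th ^+ N)%:E * tnorm2 (p' + q) N f)%E.
    apply: le_trans (tnorm2_mono ci (leq_maxl p p0) dl (db _)) _.
    apply: le_trans (Kb p' k n f (leq_maxr p p0) (tf _)) _.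
    rewrite EFinM -muleA lee_wpmul2l ?lee_fin ?exprn_ge0//.
    exact: (tnorm2_shift ci fl (fb _)).
  apply: (@le_trans _ _ ((2 * 2^-1 ^+ n * 2^-1 ^+ k)%:E * ((chaos_weight N)%:E * tnorm2 (p' + q) N f))%E); last first.
    by rewrite lee_wpmul2l ?weighted_tnorm2_le_gnorm2// lee_fin !mulr_ge0 ?exprn_ge0.
  rewrite !muleA -!EFinM.
  apply: le_trans (lee_wpmul2l _ h1) _; first by rewrite lee_fin mulr_ge0 ?chaos_weight_ge0 ?exp_coef_sqr_ge0.
  rewrite muleA -EFinM lee_wpmul2r ?tnorm2_ge0// lee_fin.
  have wr := weight_ratio n k r0 beta1 rb; rewrite -/N in wr.
  have kf : (k`!%:R : R) != 0 by rewrite pnatr_eq0 -lt0n fact_gt0.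
  have -> : chaos_weight n * (2 ^+ k.+1 * exp_coef a n k ^+ 2) * (c ^+ k * th ^+ N) =
    (2 * (2 * a ^+ 2 * c) ^+ k / k`!%:R ^+ 2 * th ^+ N) * (chaos_weight n * (N`!%:R / n`!%:R) ^+ 2).
    have E1 : (2 * a ^+ 2 * c) ^+ k = 2 ^+ k * (a ^+ k) ^+ 2 * c ^+ k.
      by rewrite !exprMn.
    rewrite /exp_coef -/N E1 [2 ^+ k.+1]exprS; move: (N`!%:R / n`!%:R) => X.
    by field; exact: kf.
  apply: le_trans (ler_wpM2l _ wr) _.
    have ac0 : 0 <= 2 * a ^+ 2 * c by rewrite mulr_ge0// mulr_ge0// sqr_ge0.
    apply: mulr_ge0; last exact: exprn_ge0.
    by apply: mulr_ge0; [apply: mulr_ge0 => //; exact: exprn_ge0|rewrite invr_ge0 sqr_ge0].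
  have -> : 2 * (2 * a ^+ 2 * c) ^+ k / k`!%:R ^+ 2 * th ^+ N *
      (chaos_weight N * (4 ^+ N * (r%:R ^+ k * k`!%:R) ^+ 2)) =
    2 * ((2 * a ^+ 2 * c * r%:R ^+ 2) ^+ k * (4 * th) ^+ N) * chaos_weight N.
    have E1 : (2 * a ^+ 2 * c * r%:R ^+ 2) ^+ k = (2 * a ^+ 2 * c) ^+ k * (r%:R ^+ k) ^+ 2.
      by rewrite [LHS]exprMn exprAC.
    by rewrite E1 [(4 * th) ^+ N]exprMn; field; exact: kf.
  rewrite ler_wpM2r ?chaos_weight_ge0// -[leRHS]mulrA ler_pM2l//.
  have kN : (k <= N)%N by rewrite /N -[leqLHS]muln1 (leq_trans (leq_mul (leqnn k) r0))// leq_addl.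
  apply: (@le_trans _ _ (L ^+ N * (4 * th) ^+ N)).
    rewrite ler_wpM2r ?exprn_ge0 ?mulr_ge0//.
    apply: (@le_trans _ _ (L ^+ k)); last by rewrite ler_weXn2l.
    apply: lerXn2r; rewrite ?nnegrE; [|exact: ltW|by rewrite le_max lexx orbT].
    by apply: mulr_ge0; [apply: mulr_ge0 => //; apply: mulr_ge0|]; rewrite ?sqr_ge0.
  rewrite -exprMn -exprD.
  have h2 : L * (4 * th) <= 2^-1.
    have : th * (8 * L) <= 1 by rewrite -ler_pdivlMr ?mulr_gt0// mul1r.
    lra.
  apply: (@le_trans _ _ (2^-1 ^+ N)).
    apply: lerXn2r => //; rewrite nnegrE; last by rewrite invr_ge0.
    by apply: mulr_ge0; [exact: ltW|exact: mulr_ge0].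
  rewrite ler_wiXn2l ?invr_ge0 ?invf_le1 ?ler1n// /N leq_add2l.
  by rewrite -[leqLHS]muln1 leq_mul.
have gfin : gnorm2 (p' + q) f \is a fin_num by rewrite ge0_fin_numE ?gnorm2_ge0.
have Qt k : (0 <= (2 ^+ k.+1 * exp_coef a n k ^+ 2)%:E * tnorm2 p n (D k f))%E.
  by rewrite mule_ge0 ?tnorm2_ge0// lee_fin exp_coef_sqr_ge0.
rewrite /exp_majorant -nneseriesZl//.
apply: (@le_trans _ _ (\sum_(0 <= k <oo) (fine (gnorm2 (p' + q) f))%:E * (2 * 2^-1 ^+ n * 2^-1 ^+ k)%:E)%E).
  apply: lee_nneseries => k; first by move=> _ _; rewrite mule_ge0// lee_fin chaos_weight_ge0.
  by move=> _; rewrite fineK// [leRHS]muleC; exact: term.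
rewrite nneseriesZl ?fineK//.
rewrite muleC lee_wpmul2r ?gnorm2_ge0//.
apply: le_trans (geometric_eseries_le _ _ _) _; rewrite ?mulr_ge0 ?exprn_ge0 ?invf_lt1 ?ltr1n//.
rewrite lee_fin ler_pdivrMr; last by rewrite subr_gt0 invf_lt1 ?ltr1n.
by have : 0 <= (2^-1 : R) ^+ n; [rewrite exprn_ge0|move: (_ ^+ n) => y; lra].
Qed.

Lemma exp_majorant_fin a p n f : in_gamma f -> (exp_majorant a p n f < +oo)%E.
Proof.
move=> gf; have [P h] := exp_majorant_bound a p.
apply: (@le_lt_trans _ _ ((chaos_weight n)%:E * exp_majorant a p n f)%E).
  rewrite -[leLHS]mul1e lee_wpmul2r ?lee_fin ?chaos_weight_ge1//.
  by apply: nneseries_ge0 => k _ _; rewrite mule_ge0 ?tnorm2_ge0// lee_fin exp_coef_sqr_ge0.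
apply: le_lt_trans (h f n gf) _; apply: lte_scale; last exact: gf.2.
by rewrite mulr_ge0 ?exprn_ge0.
Qed.

Lemma weighted_normc_exp a f s : weighted_normc (fun k => (exp_coef a (size s) k)%:C%C * D k f s) =
  (\sum_(0 <= k <oo) (2 ^+ k.+1 * exp_coef a (size s) k ^+ 2)%:E * sqnormc (D k f s))%E.
Proof.
apply: eq_eseriesr => k _; rewrite -EFinM Normc.normcM exprMn mulrA.
by rewrite [normc _%:C%C ^+ 2]sqr_normc /= expr0n addr0.
Qed.

Lemma weighted_normc_exp_at_level a p n f hs : in_gamma f -> size hs = n ->
  (weighted_normc (fun k => (exp_coef a n k)%:C%C * D k f (map (power_distr A p) hs))%R <=
   (\prod_(h <- hs) dot h h)%:E * exp_majorant a p n f)%E.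
Proof.
move=> [tf _] hn.
have := weighted_normc_exp a f (map (power_distr A p) hs); rewrite size_map hn => ->.
have P0 : 0 <= \prod_(h <- hs) dot h h by rewrite prodr_ge0// => h _; exact: dot_ge0.
rewrite /exp_majorant -nneseriesZl; last first.
  by move=> k _; rewrite mule_ge0 ?tnorm2_ge0// lee_fin exp_coef_sqr_ge0.
apply: lee_nneseries => k.
  by move=> _ _; rewrite mule_ge0 ?sqnormc_ge0// lee_fin exp_coef_sqr_ge0.
move=> _; rewrite muleCA lee_wpmul2l ?lee_fin ?exp_coef_sqr_ge0//.
have [dl _ db _] := iter_contract_all k n tf; exact: (at_level_bound ci dl (db p) hn).
Qed.

Lemma contraction_exp_cvg a f s : in_gamma f ->
  ccvg (fun n => \sum_(0 <= k < n) (exp_coef a (size s) k)%:C%C * D k f s) (contraction_exp a f s) /\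
  (sqnormc (contraction_exp a f s) <= weighted_normc (fun k => (exp_coef a (size s) k)%:C%C * D k f s)%R)%E.
Proof.
move=> gf; apply: complex_seriesP; have [p [hs sE]] := distr_word_repr ci s.
rewrite sE size_map; apply: le_lt_trans (weighted_normc_exp_at_level _ _ gf erefl) _.
apply: lte_scale; last exact: exp_majorant_fin.
by rewrite prodr_ge0// => h _; exact: dot_ge0.
Qed.

(** Linearity and symmetry hold term by term and pass to the limit; boundedness
    and finite norms come from [exp_majorant]. *)
Lemma contraction_exp_symtensor a f n : in_gamma f -> symtensor n (contraction_exp a f) /\ forall p, (tnorm2 p n (contraction_exp a f) <= exp_majorant a p n f)%E.
Proof.
move=> gf; have [tf ff] := gf.
have nQ p : (tnorm2 p n (contraction_exp a f) <= exp_majorant a p n f)%E.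
  rewrite /exp_majorant /tnorm2.
  apply: (@le_trans _ _ (isum (nseq n e) (fun s => \sum_(0 <= k <oo)
      (2 ^+ k.+1 * exp_coef a n k ^+ 2)%:E * sqnormc (at_level p (D k f) s))%E)).
    apply: le_isum => [s|s]; rewrite ?size_nseq; first exact: sqnormc_ge0.
    move=> sn; rewrite /at_level; have [_] := contraction_exp_cvg a (map (power_distr A p) s) gf.
    by rewrite weighted_normc_exp size_map sn.
  rewrite isum_nneseries; last by move=> k s; rewrite mule_ge0 ?sqnormc_ge0// lee_fin exp_coef_sqr_ge0.
  rewrite le_eqVlt; apply/orP; left; apply/eqP; apply: eq_eseriesr => k _.
  by rewrite isumZl// => s; exact: sqnormc_ge0.
split=> //; split.
- move=> s t x y z st.
  have sz w : size (s ++ w :: t) = n by rewrite size_cat /= addnS.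
  have [cy _] := contraction_exp_cvg a (s ++ y :: t) gf; have [cz _] := contraction_exp_cvg a (s ++ z :: t) gf.
  apply: complex_seriesE; apply: eq_ccvg (ccvg_lin x%:C%C cy cz) => N.
  rewrite mulr_sumr -big_split/=; apply: eq_bigr => k _; rewrite !sz.
  have [dl _ _ _] := iter_contract_all k n tf; rewrite dl//; ring.
- move=> s t sn st; rewrite /contraction_exp; congr complex_series; apply/funext => k.
  have [_ ds _ _] := iter_contract_all k n tf.
  by rewrite -(perm_size st) (ds s t).
- move=> p; have Qf : exp_majorant a p n f \is a fin_num.
    rewrite ge0_fin_numE ?exp_majorant_fin//.
    by apply: nneseries_ge0 => k _ _; rewrite mule_ge0 ?tnorm2_ge0// lee_fin exp_coef_sqr_ge0.
  exists (fine (exp_majorant a p n f)); split.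
    apply: fine_ge0; apply: nneseries_ge0 => k _ _.
    by rewrite mule_ge0 ?tnorm2_ge0// lee_fin exp_coef_sqr_ge0.
  move=> hs hn; rewrite -lee_fin.
  have [_ h] := contraction_exp_cvg a (map (power_distr A p) hs) gf; apply: le_trans h _.
  rewrite size_map hn; apply: le_trans (weighted_normc_exp_at_level _ _ gf hn) _.
  by rewrite -(fineK Qf) -EFinM lee_fin mulrC.
- by move=> p; apply: le_lt_trans (nQ p) _; exact: exp_majorant_fin.
Qed.

(** Continuity of exp (a D_K): the sum over n of [exp_majorant_bound]. *)
Lemma contraction_exp_bound a p : exists P, forall f, in_gamma f -> (gnorm2 p (contraction_exp a f) <= 8%:E * gnorm2 P f)%E.
Proof.
have [P h] := exp_majorant_bound a p; exists P => f gf.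
have gfin : gnorm2 P f \is a fin_num by rewrite ge0_fin_numE ?gnorm2_ge0//; exact: gf.2.
apply: (@le_trans _ _ (\sum_(0 <= n <oo) (fine (gnorm2 P f))%:E * (4 * 2^-1 ^+ n)%:E)%E).
  apply: lee_nneseries => n; first by move=> _ _; exact: weighted_tnorm2_ge0.
  move=> _; have [_ nQ] := contraction_exp_symtensor a n gf.
  apply: le_trans (lee_wpmul2l _ (nQ p)) _; first by rewrite lee_fin chaos_weight_ge0.
  by rewrite fineK// [leRHS]muleC; exact: h.
rewrite nneseriesZl ?fineK//.
rewrite muleC lee_wpmul2r ?gnorm2_ge0//.
apply: le_trans (geometric_eseries_le _ _ _) _; rewrite ?invf_lt1 ?ltr1n//.
by rewrite lee_fin ler_pdivrMr; [lra|rewrite subr_gt0 invf_lt1 ?ltr1n].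
Qed.

Lemma in_gamma_contraction_exp a f : in_gamma f -> in_gamma (contraction_exp a f).
Proof.
move=> gf; split=> [n|p]; first by have [] := contraction_exp_symtensor a n gf.
have [P h] := contraction_exp_bound a p; apply: le_lt_trans (h f gf) _.
by apply: lte_scale => //; exact: gf.2.
Qed.

Lemma iter_contract_lin_comb k b f g s : (forall n, symtensor n f) -> (forall n, symtensor n g) ->
  D k (lin_comb b f g) s = b * D k f s + D k g s.
Proof.
move=> tf tg; elim: k s => [|k IH] s //; rewrite !iterS {1 3 5}/contract.
rewrite -(dual_lin ci hK).
- by congr K; apply/funext => x; rewrite /word_form IH.
- by apply: (wtensor_section ci (n := size s)) => //; exact: iter_contract_all.
- by apply: (wtensor_section ci (n := size s)) => //; exact: iter_contract_all.
Qed.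

Lemma contraction_exp_lin_comb a b f g s : in_gamma f -> in_gamma g ->
  contraction_exp a (lin_comb b f g) s = b * contraction_exp a f s + contraction_exp a g s.
Proof.
move=> gf gg; have [cf1 _] := contraction_exp_cvg a s gf; have [cg1 _] := contraction_exp_cvg a s gg.
apply: complex_seriesE; apply: eq_ccvg (ccvg_lin b cf1 cg1) => N.
rewrite mulr_sumr -big_split/=; apply: eq_bigr => k _.
rewrite iter_contract_lin_comb//; [ring|exact: gf.1|exact: gg.1].
Qed.

End Exponential.

(** * The group law *)

Section BinomialCancellation.

Lemma alternating_factorial (F : numFieldType) l :
  \sum_(0 <= j < l.+1) ((-1) ^+ j / (j`!%:R * (l - j)`!%:R) : F) = (l == 0%N)%:R.
Proof.
have lf : (l`!%:R : F) != 0 by rewrite pnatr_eq0 -lt0n fact_gt0.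
apply: (mulIf lf); rewrite mulr_suml.
have -> : (l == 0%N)%:R * l`!%:R = (1 - 1) ^+ l :> F.
  by rewrite subrr expr0n; case: l {lf} => [|l]; rewrite ?fact0 ?mulr1 ?mul0r.
rewrite exprDn big_mkord; apply: eq_bigr => j _.
have jl : (j <= l)%N by rewrite -ltnS.
rewrite expr1n mul1r -(bin_fact jl) natrM -mulr_natr.
have h1 : (j`!%:R : F) != 0 by rewrite pnatr_eq0 -lt0n fact_gt0.
have h2 : ((l - j)`!%:R : F) != 0 by rewrite pnatr_eq0 -lt0n fact_gt0.
by rewrite natrM; field; rewrite h1 h2.
Qed.

(** Grouping the terms with the same l = j + k leaves the coefficient
    (1 - 1)^l / l! of I l. *)
Lemma double_alternating (F : numFieldType) (I : nat -> F) M : (0 < M)%N ->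
  (forall l, (M <= l)%N -> I l = 0) ->
  \sum_(0 <= j < M) \sum_(0 <= k < M) ((-1) ^+ j / (j`!%:R * k`!%:R)) * I (j + k)%N = I 0%N.
Proof.
move=> M0 IM.
transitivity (\sum_(0 <= j < M) \sum_(0 <= l < M)
    if (j <= l)%N then ((-1) ^+ j / (j`!%:R * (l - j)`!%:R)) * I l else 0).
  apply: eq_big_nat => j /andP[_ jM].
  rewrite (@big_cat_nat _ _ _ (M - j)) ?leq_subr//= [X in _ + X]big_nat.
  rewrite [X in _ + X]big1 ?addr0; last first.
    by move=> k /andP[h _]; rewrite IM ?mulr0//; lia.
  rewrite [RHS](@big_cat_nat _ _ _ j) ?(ltnW jM)//= [X in _ = X + _]big_nat.
  rewrite [X in _ = X + _]big1 ?add0r; last first.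
    by move=> k /andP[_ h]; rewrite leqNgt h.
  rewrite -[X in _ = \sum_(X <= _ < _) _]add0n big_addn; apply: eq_big_nat => k _.
  by rewrite leq_addl addnK addnC.
rewrite exchange_big_nat/= big_ltn//.
rewrite [X in _ + X]big_nat [X in _ + X]big1 ?addr0 => [|l /andP[l0 lM]].
  rewrite big_ltn// big_nat big1 ?addr0 => [|j /andP[j0 _]].
    by rewrite /= expr0 fact0 mulr1 invr1 !mul1r.
  by rewrite leqn0 gtn_eqF.
rewrite (@big_cat_nat _ _ _ l.+1)//= [X in _ + X]big_nat [X in _ + X]big1 ?addr0; last first.
  by move=> j /andP[jl _]; rewrite leqNgt jl.
transitivity (\sum_(0 <= j < l.+1) ((-1) ^+ j / (j`!%:R * (l - j)`!%:R)) * I l).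
  by apply: eq_big_nat => j /andP[_ jl]; rewrite -ltnS jl.
by rewrite -mulr_suml alternating_factorial gtn_eqF// mul0r.
Qed.

End BinomialCancellation.

Section GroupLaw.
Context (R : realType) (A : operator R) (B : L2R R -> L2R R) (e : nat -> L2R R) (rho : R).
Hypothesis ci : contractive_inverse A B e rho.
Variable beta : R.
Hypotheses (beta0 : 0 <= beta) (beta1 : beta <= 1).
Variable r : nat.
Hypotheses (r0 : (0 < r)%N) (rb : r%:R * (1 - beta) <= 2).
Variable K : functional A r.
Hypothesis hK : dual_tensor K.
Local Notation H := (L2R R).
Local Notation E' := (distr A).
Local Notation tnorm2 := (tnorm2 e).
Local Notation symtensor := (symtensor e).
Local Notation in_gamma := (in_gamma e beta).
Local Notation gnorm2 := (gnorm2 e beta).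
Local Notation D k := (iter k (contract K)).
Local Notation expD := (contraction_exp K).
Implicit Types (f g : seq E' -> R[i]).

Lemma complex_series_finite (u : nat -> R[i]) N : (forall k, (N <= k)%N -> u k = 0) ->
  complex_series u = \sum_(0 <= k < N) u k.
Proof.
move=> u0; apply: complex_seriesE; apply: cvg_near_cst; near=> n.
have Nn : (N <= n)%N by near: n; exact: nbhs_infty_ge.
rewrite (@big_cat_nat _ _ _ N)//= [X in _ + X - _]big_nat [X in _ + X - _]big1; last first.
  by move=> k /andP[Nk _]; exact: u0.
by rewrite addr0 subrr Normc.normc0.
Unshelve. all: by end_near. Qed.

(** The k-th contraction in degree n only sees degree n + k r. *)
Lemma eq_iter_contract k f g s : (forall w, size w = (size s + k * r)%N -> f w = g w) ->
  D k f s = D k g s.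
Proof.
elim: k s => [|k IH] s fg; first by apply: fg; rewrite addn0.
rewrite !iterS {1 3}/contract; congr K; apply/funext => x; rewrite /word_form; apply: IH => w wn.
by apply: fg; rewrite wn size_cat size_map size_enum_ord -addnA -mulSn.
Qed.

Lemma iter_contract0 k s : D k (fun=> 0) s = 0.
Proof.
have -> : D k (fun=> 0) s = D k (lin_comb (-1) ((fun=> 0) : seq E' -> R[i]) (fun=> 0)) s.
  by apply: eq_iter_contract => w _; rewrite /lin_comb mulr0 addr0.
by rewrite (iter_contract_lin_comb ci hK); [rewrite mulN1r addNr|move=> n; exact: symtensor_0..].
Qed.

Lemma iter_contract_truncate0 k M f s : (M <= size s + k * r)%N -> D k (truncate M f) s = 0.
Proof.
by move=> Ms; rewrite -[RHS](iter_contract0 k s); apply: eq_iter_contract => w wn; rewrite /truncate ltnNge wn Ms.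
Qed.

Lemma symtensor_sum n N (c : nat -> R[i]) (F : nat -> seq E' -> R[i]) :
  (forall k, symtensor n (F k)) -> symtensor n (fun s => \sum_(0 <= k < N) c k * F k s).
Proof.
move=> tF; elim: N => [|N IH].
  by apply: (eq_symtensor ci) (symtensor_0 A e n) => s _; rewrite big_nil.
apply: (eq_symtensor ci) (symtensor_lin_comb (c N) (tF N) IH) => s _.
by rewrite big_nat_recr//= /lin_comb addrC.
Qed.

Lemma iter_contract_sum j N (c : nat -> R[i]) (F : nat -> seq E' -> R[i]) s :
  (forall k n, symtensor n (F k)) ->
  D j (fun s => \sum_(0 <= k < N) c k * F k s) s = \sum_(0 <= k < N) c k * D j (F k) s.
Proof.
move=> tF; elim: N => [|N IH].
  by rewrite big_nil -[RHS](iter_contract0 j s); apply: eq_iter_contract => w _; rewrite big_nil.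
rewrite big_nat_recr//= addrC -IH -(iter_contract_lin_comb ci hK)//.
  by apply: eq_iter_contract => w _; rewrite big_nat_recr//= /lin_comb addrC.
by move=> n; apply: symtensor_sum.
Qed.

Lemma contraction_exp_truncate a M f s :
  expD a (truncate M f) s = \sum_(0 <= k < M) (exp_coef r a (size s) k)%:C%C * D k (truncate M f) s.
Proof.
apply: complex_series_finite => k Mk; rewrite iter_contract_truncate0 ?mulr0//.
by rewrite (leq_trans Mk)// -[leqLHS]muln1 (leq_trans (leq_mul (leqnn k) r0))// leq_addl.
Qed.

Lemma exp_coef_mul (a : R) n j k : (exp_coef r (- a) n j)%:C%C * (exp_coef r a (n + j * r) k)%:C%C =
  ((-1) ^+ j / (j`!%:R * k`!%:R)) *
    (a ^+ (j + k) * ((n + (j + k) * r)`!%:R / n`!%:R))%:C%C :> R[i].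
Proof.
have -> : (-1) ^+ j / (j`!%:R * k`!%:R) = ((-1) ^+ j / (j`!%:R * k`!%:R))%:C%C :> R[i].
  by rewrite rmorphM/= fmorphV/= rmorphM rmorphXn/= rmorphN1 !rmorph_nat.
rewrite -!rmorphM; congr (_%:C)%C; rewrite /exp_coef.
have nz m : (m`!%:R : R) != 0 by rewrite pnatr_eq0 -lt0n fact_gt0.
have -> : (n + j * r + k * r = n + (j + k) * r)%N by rewrite mulnDl addnA.
rewrite (exprNn a j) exprD; field.
by rewrite !nz.
Qed.

(** On finitely many degrees the series are finite sums, and the product is computed
    by [double_alternating]. *)
Lemma contraction_exp_inv_truncate a M f s : (forall n, symtensor n f) ->
  expD (- a) (expD a (truncate M f)) s = truncate M f s.
Proof.
move=> tf; set h := truncate M f; set n := size s.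
have th m : symtensor m h by exact: (symtensor_truncate ci).
have E j : D j (expD a h) s = \sum_(0 <= k < M) (exp_coef r a (n + j * r) k)%:C%C * D (j + k) h s.
  rewrite (@eq_iter_contract j _ (fun w => \sum_(0 <= k < M) (exp_coef r a (n + j * r) k)%:C%C * D k h w)).
    by rewrite iter_contract_sum => [|k m]; [apply: eq_bigr => k _; rewrite iterD|exact: (iter_contract_all ci hK)].
  by move=> w wn; rewrite contraction_exp_truncate wn.
have big0 l : (M <= l)%N -> D l h s = 0.
  move=> Ml; apply: iter_contract_truncate0.
  by rewrite (leq_trans Ml)// -[leqLHS]muln1 (leq_trans (leq_mul (leqnn l) r0))// leq_addl.
rewrite /contraction_exp (complex_series_finite (N := M)); last first.
  move=> j Mj; rewrite E big1 ?mulr0// => k _.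
  by rewrite big0 ?mulr0// (leq_trans Mj)// leq_addr.
have [M0|M0] := posnP M; first by rewrite M0 big_nil /h /truncate M0.
pose I l := (a ^+ l * ((n + l * r)`!%:R / n`!%:R))%:C%C * D l h s.
transitivity (I 0%N).
  rewrite -(double_alternating M0 (I := I)); last by move=> l Ml; rewrite /I big0 ?mulr0.
  apply: eq_bigr => j _; rewrite -/n E mulr_sumr; apply: eq_bigr => k _.
  by rewrite /I mulrA exp_coef_mul [RHS]mulrA.
by rewrite /I mul0n addn0 divff ?pnatr_eq0 -?lt0n ?fact_gt0// !mul1r.
Qed.

Lemma gnorm2_tail_eq0 n (z : R[i]) (c : R) p f : in_gamma f ->
  (forall M, (n < M)%N -> (sqnormc z <= c%:E * gnorm2 p (lin_comb (-1)%R (truncate M f) f))%E) -> z = 0.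
Proof.
move=> gf h; have t := cvgeZl (isT : c%:E \is a fin_num) (gnorm2_tail beta0 p gf).
have z0 : (sqnormc z <= 0)%E.
  rewrite -[leRHS](mule0 c%:E); apply: (cvge_to_ge t).
  by near=> M; apply: h; near: M; exact: nbhs_infty_gt.
apply: Normc.eq0_normc; apply/eqP; rewrite -sqrf_eq0 eq_le sqr_ge0 andbT.
by rewrite -lee_fin.
Unshelve. all: by end_near. Qed.

Lemma truncate_split M f : f = lin_comb 1 (truncate M f) (lin_comb (-1) (truncate M f) f).
Proof. by apply/funext => s; rewrite /lin_comb mul1r mulN1r addrA subrr add0r. Qed.

(** Both sides are continuous in f, and truncations are dense. *)
Lemma contraction_exp_inv a f s : in_gamma f -> expD (- a) (expD a f) s = f s.
Proof.
move=> gf; apply/eqP; rewrite -subr_eq0; apply/eqP.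
have [p [c [c0 hc]]] := in_gamma_word_bound ci beta0 s.
have [P hP] := contraction_exp_bound ci beta0 beta1 r0 rb hK (- a) p.
have [P' hP'] := contraction_exp_bound ci beta0 beta1 r0 rb hK a P.
apply: (@gnorm2_tail_eq0 (size s) _ (c * (8 * 8)) P' f) => // M Ms.
have gt : in_gamma (truncate M f) by apply: (in_gamma_truncate ci beta0) => //; exact: gf.1.
have gd : in_gamma (lin_comb (-1) (truncate M f) f) by exact: (in_gamma_lin_comb beta0).
have gE g : in_gamma g -> in_gamma (expD a g) by move=> ?; exact: (in_gamma_contraction_exp ci beta0 beta1 r0 rb hK).
have -> : expD (- a) (expD a f) s - f s = expD (- a) (expD a (lin_comb (-1) (truncate M f) f)) s.
  set d := lin_comb _ _ f.
  have -> : expD a f = lin_comb 1 (expD a (truncate M f)) (expD a d).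
    apply/funext => w; rewrite {1}(truncate_split M f).
    exact: (contraction_exp_lin_comb ci beta0 beta1 r0 rb hK).
  rewrite (contraction_exp_lin_comb ci beta0 beta1 r0 rb hK); [|exact: gE|exact: gE].
  by rewrite mul1r contraction_exp_inv_truncate; [rewrite /truncate Ms addrAC subrr add0r|exact: gf.1].
apply: le_trans (hc _ (in_gamma_contraction_exp ci beta0 beta1 r0 rb hK _ (gE _ gd))) _.
rewrite EFinM -muleA lee_wpmul2l ?lee_fin//.
apply: le_trans (hP _ (gE _ gd)) _.
by rewrite EFinM -muleA lee_wpmul2l ?lee_fin//; exact: hP'.
Qed.

End GroupLaw.

(** * Evaluation on the diagonal *)

Section PowerSeries.
Variable R : realType.
Implicit Types (c : nat -> R[i]).

Lemma normc_scale (t : R) (z : R[i]) : normc (t%:C%C * z) = `|t| * normc z.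
Proof. by rewrite Normc.normcM /= expr0n addr0 sqrtr_sqr. Qed.

(** If c k is the first nonzero coefficient, the sum divided by t^k tends to c k as t
    tends to 0. *)
Lemma power_series_zero c M : (forall N, \sum_(0 <= n < N) normc (c n) <= M) ->
  (forall t : R, ccvg (fun N => \sum_(0 <= n < N) (t ^+ n)%:C%C * c n) 0) ->
  forall k, c k = 0.
Proof.
move=> cM ct k; have M0 : 0 <= M by have := cM 0%N; rewrite big_nil.
elim/ltn_ind: k => k IH.
set a := normc (c k); have a0 : 0 <= a by exact: normc_ge0.
apply: Normc.eq0_normc; rewrite -/a; apply/eqP; rewrite eq_le a0 andbT.
have key (t : R) : 0 < t -> t <= 1 -> a <= t * M.
  move=> t0 t1; have tk : 0 < t ^+ k by rewrite exprn_gt0.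
  rewrite -(ler_pM2l tk).
  have h N : (k < N)%N -> t ^+ k * a - t ^+ k * (t * M) <=
      normc (\sum_(0 <= n < N) (t ^+ n)%:C%C * c n - 0).
    move=> kN; rewrite subr0 lerBlDr.
    rewrite (@big_cat_nat _ _ _ k)//= ?(ltnW kN)// big_nat big1 ?add0r; last first.
      by move=> n /andP[_ nk]; rewrite IH// mulr0.
    rewrite big_ltn//; set S := \sum_(k.+1 <= n < N) _.
    have -> : t ^+ k * a = normc ((t ^+ k)%:C%C * c k) by rewrite normc_scale gtr0_norm.
    set v := _ * c k; rewrite -[X in normc X <= _](addrK S v).
    apply: le_trans (le_normcD _ _) _; rewrite lerD2l normcN.
    apply: (@le_trans _ _ (\sum_(k.+1 <= n < N) normc ((t ^+ n)%:C%C * c n))).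
      rewrite /S; elim/big_ind2 : _ => [|x1 x2 y1 y2 h1 h2|//]; first by rewrite Normc.normc0.
      by apply: le_trans (le_normcD _ _) _; exact: lerD.
    apply: (@le_trans _ _ (\sum_(k.+1 <= n < N) t ^+ k.+1 * normc (c n))).
      rewrite big_nat [leRHS]big_nat; apply: ler_sum => n /andP[kn _].
      rewrite normc_scale gtr0_norm ?exprn_gt0// ler_wpM2r ?normc_ge0//.
      by apply: ler_wiXn2l => //; exact: ltW.
    rewrite -mulr_sumr mulrA -exprSr; apply: ler_wpM2l; first by apply: exprn_ge0; exact: ltW.
    apply: le_trans (cM N); rewrite [leRHS](@big_cat_nat _ _ _ k.+1)//= lerDr.
    by apply: sumr_ge0 => n _; exact: normc_ge0.
  rewrite -subr_le0; apply: (cvgr_to_ge (ct t)); near=> N; apply: h.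
  by near: N; exact: nbhs_infty_gt.
have [->//|an0] := eqVneq a 0.
have ap : 0 < a by rewrite lt_neqAle eq_sym an0.
have d0 : 0 < a + M + 1 by lra.
have := key (a / (a + M + 1)) (divr_gt0 ap d0).
rewrite ler_pdivrMr// mul1r => /(_ _); rewrite mulrAC ler_pdivlMr//.
have -> : a <= a + M + 1 by lra.
move=> /(_ isT); nra.
Unshelve. all: by end_near. Qed.

End PowerSeries.

Lemma ccvg_near_cst (R : realType) (u : nat -> R[i]) l N :
  (forall n, (N <= n)%N -> u n = l) -> ccvg u l.
Proof.
move=> h; apply: cvg_near_cst; near=> n; rewrite h ?subrr ?Normc.normc0//.
by near: n; exact: nbhs_infty_ge.
Unshelve. all: by end_near. Qed.

Section Polarization.
Context (R : realType) (A : operator R).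
Local Notation E' := (distr A).
Implicit Types (f : seq E' -> R[i]).

(** Expansion along the line of the points t y + x. Only the coefficients of degrees
    0 and 1 are made explicit, those being the ones that the induction determines from
    each other. *)
Lemma polarization_expand n f x y m w : mlinear n f -> symmetric_on n f -> (m + size w)%N = n ->
  exists d : nat -> R[i], [/\ forall j, (m < j)%N -> d j = 0,
    d 0%N = f (nseq m x ++ w), d 1%N = m%:R * f (y :: nseq m.-1 x ++ w) &
    forall t : R, f (nseq m (t *: y + x) ++ w) = \sum_(0 <= j < m.+1) (t ^+ j)%:C%C * d j].
Proof.
move=> fl fs; elim: m w => [|m IH] w mw.
  exists (fun j => if j is 0%N then f w else 0); split=> //; first by case.
    by rewrite mul0r.
  by move=> t; rewrite big_nat1 expr0 mul1r.
have mw' z : (m + size (z :: w))%N = n by rewrite /= addnS -mw.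
have [dx [dx0 dx1 dx2 dxt]] := IH (x :: w) (mw' x).
have [dy [dy0 dy1 dy2 dyt]] := IH (y :: w) (mw' y).
have cycl u z : f (u :: nseq m z ++ w) = f (nseq m z ++ u :: w).
  apply: fs; first by rewrite /= size_cat size_nseq -mw.
  by apply/seq.permP => a; rewrite /= !count_cat /= !count_nseq; lia.
exists (fun j => dx j + if j is j'.+1 then dy j' else 0); split.
- by move=> [|j] // mj; rewrite dx0 ?dy0 ?addr0// ltnW.
- by rewrite dx1 addr0 -cycl.
- rewrite dx2 dy1 -cycl [m.+1.-1]/= -natr1 mulrDl mul1r; congr (_ + _).
  case: (m) mw => [|m'] mw; first by rewrite !mul0r.
  congr (_ * _); apply: fs; first by rewrite /= size_cat size_nseq /= -mw addnS.
  by apply/seq.permP => a; rewrite /= !count_cat /= !count_nseq; case: (a x); lia.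
move=> t; have := fl [::] (nseq m (t *: y + x) ++ w) t y x.
rewrite !cat0s => -> /=; last by rewrite size_cat size_nseq -mw.
rewrite !cycl dxt dyt.
under [RHS]eq_bigr do rewrite mulrDr.
rewrite big_split/= addrC; congr (_ + _).
  rewrite [RHS]big_nat_recl//= mulr0 add0r mulr_sumr; apply: eq_bigr => j _.
  by rewrite mulrA -rmorphM -exprS.
by rewrite [RHS]big_nat_recr//= dx0// mulr0 addr0.
Qed.

(** The coefficient of degree 1 of f (x + t y, ..., x + t y) in t is n + 1 times
    f (y, x, ..., x). It vanishes, so the form f (y, ...) satisfies the hypothesis too. *)
Lemma polarization n f : mlinear n f -> symmetric_on n f -> (forall x, f (nseq n x) = 0) ->
  forall s, size s = n -> f s = 0.
Proof.
elim: n f => [|n IH] f fl fs fd [|y s]//= => [_|[sn]]; first exact: (fd 0).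
apply: (IH (fun w => f (y :: w))) => //; first exact: mlinear_cons.
  by move=> u v un uv; apply: fs; rewrite /= ?un// perm_cons.
move=> x; have [d [d0 _ d1 dt]] := polarization_expand (m := n.+1) (w := [::]) x y fl fs (addn0 _).
rewrite cats0 [n.+1.-1]/= in d1.
suff : d 1%N = 0.
  by rewrite d1 => /eqP; rewrite mulf_eq0 pnatr_eq0 => /eqP.
apply: (power_series_zero (M := \sum_(0 <= j < n.+2) normc (d j))) => [N|t].
  have [Nn|nN] := leqP N n.+2.
    rewrite [leRHS](@big_cat_nat _ _ _ N)//= lerDl.
    by apply: sumr_ge0 => j _; exact: normc_ge0.
  rewrite (@big_cat_nat _ _ _ n.+2) ?(ltnW nN)//= [X in _ + X]big_nat.
  rewrite [X in _ + X]big1 ?addr0// => j /andP[nj _].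
  by rewrite d0// Normc.normc0.
apply: (@ccvg_near_cst _ _ _ n.+2) => N nN.
rewrite (@big_cat_nat _ _ _ n.+2)//= -dt cats0 fd add0r big_nat big1// => j /andP[nj _].
by rewrite d0// mulr0.
Qed.

End Polarization.

Section Evaluation.
Context (R : realType) (A : operator R) (B : L2R R -> L2R R) (e : nat -> L2R R) (rho : R).
Hypothesis ci : contractive_inverse A B e rho.
Variable beta : R.
Hypotheses (beta0 : 0 <= beta).
Local Notation H := (L2R R).
Local Notation E' := (distr A).
Local Notation tnorm2 := (tnorm2 e).
Local Notation symtensor := (symtensor e).
Local Notation in_gamma := (in_gamma e beta).
Local Notation gnorm2 := (gnorm2 e beta).
Implicit Types (f g : seq E' -> R[i]).

(** The value at x of the function with Taylor coefficients f. *)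
Definition diag_sum (x : E') f : R[i] := complex_series (fun n => f (nseq n x)).

(** If x = A^p h, then f (x, ..., x) is bounded by |h|^n times the norm of order
    p; the power |h|^n is absorbed by raising the order. *)
Lemma diag_sum_weighted x : exists P, forall f, in_gamma f ->
  (weighted_normc (fun n => f (nseq n x)) <= 2%:E * gnorm2 P f)%E.
Proof.
have [p [h xE]] := distr_repr ci x.
pose d := dot h h; have d0 : 0 <= d by exact: dot_ge0.
have [|||q hq] := @small_power R (rho ^+ 2) (2 * (d + 1))^-1.
- exact: sqr_ge0.
- by rewrite expr_lt1 ?(ci_rho_lt1 ci)// ltW// (ci_rho_gt0 ci).
- by rewrite invr_gt0 mulr_gt0// ltr_wpDl.
set th := (rho ^+ 2) ^+ q in hq; have th0 : 0 <= th by rewrite exprn_ge0 ?sqr_ge0.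
exists (p + q)%N => f [tf ff].
rewrite /gnorm2 -nneseriesZl; last by move=> n _; exact: weighted_tnorm2_ge0.
apply: lee_nneseries => n; first by move=> _ _; rewrite lee_fin mulr_ge0 ?sqr_ge0 ?exprn_ge0.
move=> _; have [fl _ fb _] := tf n.
have h1 : (sqnormc (f (nseq n x)) <= (d ^+ n * th ^+ n)%:E * tnorm2 (p + q) n f)%E.
  have := at_level_bound ci fl (fb p) (size_nseq n h).
  rewrite /at_level map_nseq -xE => /le_trans; apply.
  have -> : \prod_(k <- nseq n h) dot k k = d ^+ n.
    by elim: (n) => [|m IHm]; rewrite ?big_nil//= big_cons IHm exprS.
  rewrite EFinM -muleA lee_wpmul2l ?lee_fin ?exprn_ge0//.
  exact: (tnorm2_shift ci fl (fb _)).
rewrite EFinM; apply: le_trans (lee_wpmul2l _ h1) _; first by rewrite lee_fin exprn_ge0.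
rewrite muleA -EFinM muleA; apply: lee_wpmul2r; first exact: tnorm2_ge0.
rewrite -EFinM lee_fin exprS -!mulrA ler_pM2l// -!exprMn.
apply: (@le_trans _ _ 1); last exact: chaos_weight_ge1.
apply: exprn_ile1; first by rewrite !mulr_ge0.
have : th * (2 * (d + 1)) <= 1 by rewrite -ler_pdivlMr ?mul1r// mulr_gt0// ltr_wpDl.
nra.
Qed.

Lemma diag_sum_cvg x f : in_gamma f -> ccvg (fun N => \sum_(0 <= n < N) f (nseq n x)) (diag_sum x f) /\
  (sqnormc (diag_sum x f) <= weighted_normc (fun n => f (nseq n x)))%E.
Proof.
move=> gf; apply: complex_seriesP; have [P h] := diag_sum_weighted x; apply: le_lt_trans (h f gf) _.
by apply: lte_scale => //; exact: gf.2.
Qed.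

Lemma diag_sum_bound x : exists P, forall f, in_gamma f -> (sqnormc (diag_sum x f) <= 2%:E * gnorm2 P f)%E.
Proof.
have [P h] := diag_sum_weighted x; exists P => f gf.
by have [_ h1] := diag_sum_cvg x gf; apply: le_trans h1 (h f gf).
Qed.

Lemma diag_sum_lin_comb x b f g : in_gamma f -> in_gamma g -> diag_sum x (lin_comb b f g) = b * diag_sum x f + diag_sum x g.
Proof.
move=> gf gg; have [cf1 _] := diag_sum_cvg x gf; have [cg1 _] := diag_sum_cvg x gg.
apply: complex_seriesE; apply: eq_ccvg (ccvg_lin b cf1 cg1) => N.
by rewrite mulr_sumr -big_split.
Qed.

(** Replacing x by t x multiplies degree n by t^n, so each degree vanishes on the
    diagonal. *)
Lemma diag_sum_inj f : in_gamma f -> (forall x, diag_sum x f = 0) -> forall s, f s = 0.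
Proof.
move=> gf ef s; have [fl fs _ _] := gf.1 (size s).
apply: (polarization fl fs) => // x.
have scale n (t : R) : f (nseq n (t *: x)) = (t ^+ n)%:C%C * f (nseq n x).
  have [hl hs _ _] := gf.1 n.
  suff gen m w : (m + size w)%N = n -> f (nseq m (t *: x) ++ w) = (t ^+ m)%:C%C * f (nseq m x ++ w).
    by have := gen n [::] (addn0 n); rewrite !cats0.
  elim: m w => [|m IH] w mw; first by rewrite expr0 mul1r.
  have cycl u z : f (u :: nseq m z ++ w) = f (nseq m z ++ u :: w).
    apply: (hs _ _); first by rewrite /= size_cat size_nseq -mw.
    by apply/seq.permP => a; rewrite /= !count_cat /= !count_nseq; lia.
  have := hl [::] (nseq m (t *: x) ++ w) t x 0.
  rewrite !cat0s addr0 [f (0 :: _)](mlinear0 (s := [::]) hl) ?addr0.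
  - move=> -> /=; last by rewrite size_cat size_nseq -mw.
    rewrite !cycl IH; last by rewrite /= addnS -mw.
    by rewrite mulrA -rmorphM -exprS.
  - by rewrite size_cat size_nseq -mw.
have [P h] := diag_sum_weighted x.
have wf : (weighted_normc (fun n => f (nseq n x)) < +oo)%E.
  by apply: le_lt_trans (h f gf) _; apply: lte_scale => //; exact: gf.2.
apply: (power_series_zero (c := fun n => f (nseq n x)) (M := 1 + fine (weighted_normc (fun n => f (nseq n x))))) => [N|t].
  have w0 : (0 <= weighted_normc (fun n => f (nseq n x)))%E by exact: weighted_sum_ge0.
  have : (\sum_(0 <= n < N) normc (f (nseq n x))) ^+ 2 <= fine (weighted_normc (fun n => f (nseq n x))).
    rewrite -lee_fin fineK ?ge0_fin_numE//.
    apply: le_trans (nneseries_lim_ge N _); last first.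
      by move=> k _ _; rewrite lee_fin mulr_ge0 ?sqr_ge0 ?exprn_ge0.
    by rewrite sumEFin lee_fin; exact: sqr_sum_le.
  have : 0 <= \sum_(0 <= n < N) normc (f (nseq n x)).
    by apply: sumr_ge0 => n _; exact: normc_ge0.
  move: (\sum_(0 <= n < N) _) (fine _) => y W y0 yW; nra.
have [c _] := diag_sum_cvg (t *: x) gf; rewrite ef in c.
by apply: eq_ccvg c => N; apply: eq_bigr => n _; rewrite scale.
Qed.

End Evaluation.

(** * Wick tensors *)

Section Wick.
Context (R : realType) (A : operator R) (B : L2R R -> L2R R) (e : nat -> L2R R) (rho : R).
Hypothesis ci : contractive_inverse A B e rho.
Variable r : nat.
Hypothesis r0 : (0 < r)%N.
Variable K : functional A r.
Hypothesis hK : dual_tensor K.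
Local Notation E' := (distr A).
Local Notation symtensor := (symtensor e).
Local Notation D k := (iter k (contract K)).
Local Notation expD := (contraction_exp K).
Implicit Types (f g : seq E' -> R[i]).

Lemma enum_ord_cat a b :
  enum 'I_(a + b) = map (lshift b) (enum 'I_a) ++ map (@rshift a b) (enum 'I_b).
Proof.
apply: (inj_map val_inj); rewrite map_cat val_enum_ord iotaD.
have -> : map val (map (lshift b) (enum 'I_a)) = map val (enum 'I_a).
  by rewrite -[LHS](map_comp val).
have -> : map val (map (@rshift a b) (enum 'I_b)) = map (addn a) (map val (enum 'I_b)).
  by rewrite -[LHS](map_comp val) -[RHS](map_comp (addn a)).
by rewrite !val_enum_ord -iotaDl addn0.
Qed.

Lemma map_concat (X : Type) a b (x : 'I_a -> X) (y : 'I_b -> X) :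
  [seq concat x y i | i <- enum 'I_(a + b)] =
  [seq x i | i <- enum 'I_a] ++ [seq y i | i <- enum 'I_b].
Proof.
rewrite enum_ord_cat map_cat -!map_comp; congr (_ ++ _); apply: eq_map => i /=.
  by rewrite /concat (unsplitK (inl i)).
by rewrite /concat (unsplitK (inr i)).
Qed.

Lemma symmetrize_word_form n f : symtensor n f -> symmetrize (word_form (n := n) f) = word_form f.
Proof.
move=> /(sym_tensor_word_form ci)[_ hs]; apply/funext => x; rewrite /symmetrize.
under eq_bigr do rewrite hs.
by rewrite sumr_const card_Sn -[X in _ * X]mulr_natl mulrA mulVf ?mul1r// pnatr_eq0 -lt0n fact_gt0.
Qed.

Lemma symtensor_section n m f s : symtensor (n + m) f -> size s = n -> symtensor m (fun w => f (s ++ w)).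
Proof.
move=> tf sn; have [h1 h2 h3] := wtensor_section ci tf sn; have [_ fs _ _] := tf.
split=> // u v um uv; apply: fs; first by rewrite size_cat sn um.
by rewrite perm_cat2l.
Qed.

Lemma iter_contract_section k f s t : D k (fun w => f (s ++ w)) t = D k f (s ++ t).
Proof.
elim: k t => [|k IH] t //; rewrite !iterS {1 3}/contract; congr K; apply/funext => x.
by rewrite /word_form IH catA.
Qed.

(** In [sym_power], the outermost copy of K acts on the first block of r variables.
    This is also the block left to the last contraction when blocks are contracted from
    the right. *)
Lemma sym_powerE k g : symtensor (k * r) g -> @sym_power R A r K k (word_form (n := k * r) g) = D k g [::].
Proof.
elim: k g => [|k IH] g tg.
  rewrite /= /word_form; congr g; apply/nilP.
  by rewrite /nilp size_map size_enum_ord.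
have -> : @sym_power R A r K k.+1 (word_form (n := k.+1 * r) g) = K (fun x =>
    @sym_power R A r K k (fun y => symmetrize (word_form (n := r + k * r) g) (concat x y))) by [].
rewrite symmetrize_word_form// iterS [in RHS]/contract; congr K; apply/funext => x.
have sx : size [seq x i | i <- enum 'I_r] = r by rewrite size_map size_enum_ord.
have -> : (fun y => word_form g (concat x y)) =
    word_form (fun w => g ([seq x i | i <- enum 'I_r] ++ w)) :> nform A (k * r).
  by apply/funext => y; rewrite /word_form map_concat.
rewrite IH; last exact: (symtensor_section (n := r)).
by rewrite iter_contract_section cats0.
Qed.

Lemma wick_termE a n k (E : (a + k * r = n)%N) x f : symtensor n f ->
  cast_functional E (sym_tprod (@point_power R A a x) (@sym_power R A r K k)) (word_form f) =
  D k f (nseq a x).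
Proof.
subst n => tf; rewrite /cast_functional.
have -> : (fun y : 'I_(a + k * r) -> E' =>
    word_form f (fun i => y (cast_ord (esym erefl) i))) = word_form f :> nform A (a + k * r).
  apply/funext => y; rewrite (_ : (fun i => y (cast_ord _ i)) = y)//.
  by apply/funext => i; rewrite cast_ord_id.
rewrite /sym_tprod /tprod /point_power symmetrize_word_form//.
have -> : (fun y : 'I_(k * r) -> E' => word_form (n := a + k * r) f (concat (fun=> x) y)) =
    word_form (fun w => f (nseq a x ++ w)) :> nform A (k * r).
  apply/funext => y; rewrite /word_form map_concat; congr (f (_ ++ _)).
  by rewrite -[in RHS](size_enum_ord a); elim: (enum 'I_a) => //= _ s ->.
rewrite sym_powerE; last by apply: (symtensor_section tf); rewrite size_nseq.
by rewrite iter_contract_section cats0.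
Qed.

Definition homogeneous n f : seq E' -> R[i] := fun s => if size s == n then f s else 0.

(** In degree n - k r, the coefficients of exp (- D_K / 2) applied to a form of
    degree n are those of the k-th term of the Wick tensor; the other degrees vanish. *)
Lemma wick_homogeneous n x f : symtensor n f ->
  wick K x (word_form (n := n) f) = diag_sum x (expD (- (1 / 2)) (homogeneous n f)).
Proof.
move=> tf.
have Dh k n' : D k (homogeneous n f) (nseq n' x) = if (n' + k * r == n)%N then D k f (nseq n' x) else 0.
  case: eqP => h.
    by apply: eq_iter_contract => w; rewrite size_nseq h /homogeneous => ->; rewrite eqxx.
  rewrite -[RHS](iter_contract0 ci hK k (nseq n' x)); apply: eq_iter_contract => w; rewrite size_nseq /homogeneous => ->.
  by case: eqP h.
pose G k n' : R[i] := if (n' + k * r == n)%N then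
    (exp_coef r (- (1 / 2)) n' k)%:C%C * D k f (nseq n' x) else 0.
have kr k : (k <= k * r)%N by rewrite -[leqLHS]muln1 leq_mul.
have E n' : expD (- (1 / 2)) (homogeneous n f) (nseq n' x) = \sum_(0 <= k < n.+1) G k n'.
  rewrite /contraction_exp (complex_series_finite (N := n.+1)).
    by apply: eq_bigr => k _; rewrite Dh size_nseq /G; case: ifP => // _; rewrite mulr0.
  move=> k nk; rewrite Dh; case: eqP => h; last by rewrite mulr0.
  by have := kr k; lia.
rewrite /diag_sum (complex_series_finite (N := n.+1)); last first.
  move=> n' nn'; rewrite E big1// => k _; rewrite /G; case: eqP => // h; lia.
under eq_bigr do rewrite E.
rewrite exchange_big_nat/=.
rewrite (@big_cat_nat _ _ _ (n %/ r).+1)//=; last by rewrite ltnS leq_div.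
rewrite [X in _ = _ + X]big_nat [X in _ = _ + X]big1 ?addr0; last first.
  move=> k /andP[nk _]; rewrite big1// => n' _; rewrite /G; case: eqP => // h.
  have : (k <= n %/ r)%N by rewrite leq_divRL// -h leq_addl.
  lia.
rewrite big_mkord /wick; apply: eq_bigr => k _.
have kn : (k * r <= n)%N by rewrite -leq_divRL// -ltnS.
rewrite wick_termE//.
rewrite (bigD1_seq (n - k * r)%N) ?iota_uniq ?mem_index_iota ?ltnS ?leq_subr//=.
rewrite big1 ?addr0 => [|n' nn']; last first.
  by rewrite /G; case: eqP => // h; move/eqP: nn'; lia.
rewrite /G subnK// eqxx; congr (_ * _).
rewrite /exp_coef subnK// !rmorphM/= !fmorphV/= !rmorph_nat rmorphXn/=.
have -> : ((- (1 / 2) : R)%:C)%C = - (1 / 2) :> R[i].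
  by rewrite rmorphN rmorphM/= fmorphV/= rmorph1 rmorph_nat.
have nz m : (m`!%:R : R[i]) != 0 by rewrite pnatr_eq0 -lt0n fact_gt0.
by field; rewrite !nz.
Qed.

Variable beta : R.
Hypotheses (beta0 : 0 <= beta) (beta1 : beta <= 1) (rb : r%:R * (1 - beta) <= 2).
Local Notation in_gamma := (in_gamma e beta).

Lemma in_gamma_homogeneous n f : symtensor n f -> in_gamma (homogeneous n f).
Proof.
move=> tf.
have th m : symtensor m (homogeneous n f).
  have [->|mn] := eqVneq m n; first by apply: (eq_symtensor ci) tf => s sn; rewrite /homogeneous sn eqxx.
  by apply: (eq_symtensor ci) (symtensor_0 A e m) => s sm; rewrite /homogeneous sm (negbTE mn).
have -> : homogeneous n f = truncate n.+1 (homogeneous n f).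
  by apply/funext => s; rewrite /truncate /homogeneous; case: eqP => [->|_]; [rewrite ltnSn|case: ifP].
exact: (in_gamma_truncate ci beta0).
Qed.

Lemma wick_sum N x f : (forall n, symtensor n f) ->
  \sum_(n < N) wick K x (word_form (n := n) f) = diag_sum x (expD (- (1 / 2)) (truncate N f)).
Proof.
move=> tf; have gE g : in_gamma g -> in_gamma (expD (- (1 / 2)) g).
  exact: (in_gamma_contraction_exp ci beta0 beta1 r0 rb hK).
elim: N => [|N IH].
  rewrite big_ord0 /diag_sum (complex_series_finite (N := 0%N)) ?big_nil// => n _.
  by rewrite (contraction_exp_truncate ci r0 hK) big_nil.
have gt : in_gamma (truncate N f) by exact: (in_gamma_truncate ci beta0).
have gh : in_gamma (homogeneous N f) by exact: in_gamma_homogeneous.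
rewrite big_ord_recr/= IH wick_homogeneous//.
have -> : truncate N.+1 f = lin_comb 1 (truncate N f) (homogeneous N f).
  apply/funext => s; rewrite /lin_comb /truncate /homogeneous mul1r ltnS.
  by case: ltngtP; rewrite ?addr0 ?add0r.
have -> : expD (- (1 / 2)) (lin_comb 1 (truncate N f) (homogeneous N f)) =
    lin_comb 1 (expD (- (1 / 2)) (truncate N f)) (expD (- (1 / 2)) (homogeneous N f)).
  by apply/funext => s; exact: (contraction_exp_lin_comb ci beta0 beta1 r0 rb hK _ _ _ gt gh).
by rewrite (diag_sum_lin_comb ci beta0 x 1 (gE _ gt) (gE _ gh)) [1 * diag_sum _ _]mul1r.
Qed.

End Wick.

(** * The decomposition *)

Section PointwiseWick.
Context (R : realType) (A : operator R) (B : L2R R -> L2R R) (e : nat -> L2R R) (rho : R).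
Hypothesis ci : contractive_inverse A B e rho.
Variable beta : R.
Hypotheses (beta0 : 0 <= beta) (beta1 : beta <= 1).
Variable r : nat.
Hypotheses (r0 : (0 < r)%N) (rb : r%:R * (1 - beta) <= 2).
Variable K : functional A r.
Hypothesis hK : dual_tensor K.
Local Notation E' := (distr A).
Local Notation in_gamma := (in_gamma e beta).
Local Notation gnorm2 := (gnorm2 e beta).
Local Notation expD := (contraction_exp K).
Implicit Types (f g : seq E' -> R[i]).

Lemma contraction_exp_lin_combE a b f g : in_gamma f -> in_gamma g ->
  expD a (lin_comb b f g) = lin_comb b (expD a f) (expD a g).
Proof. by move=> gf gg; apply/funext => s; exact: (contraction_exp_lin_comb ci beta0 beta1 r0 rb hK). Qed.

Lemma contraction_expK a f : in_gamma f -> expD (- a) (expD a f) = f.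
Proof. by move=> gf; apply/funext => s; exact: (contraction_exp_inv ci beta0 beta1 r0 rb hK). Qed.

Lemma gnorm2_tail_cvg0 (z : nat -> R[i]) (c : R) p f : in_gamma f -> 0 <= c ->
  (forall N, (sqnormc (z N) <= c%:E * gnorm2 p (lin_comb (-1)%R (truncate N f) f))%E) ->
  (fun N => normc (z N)) @ \oo --> (0 : R).
Proof.
move=> gf c0 zc; pose v N := gnorm2 p (lin_comb (-1)%R (truncate N f) f).
have vfin N : v N \is a fin_num.
  rewrite ge0_fin_numE ?gnorm2_ge0//.
  suff [_] : in_gamma (lin_comb (-1)%R (truncate N f) f) by apply.
  by apply: (in_gamma_lin_comb beta0) => //; apply: (in_gamma_truncate ci beta0); exact: gf.1.
have t : (fun N => Num.sqrt (c * fine (v N))) @ \oo --> (0 : R).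
  rewrite -(sqrtr0 R); apply: (@continuous_cvg _ _ _ _ _ _ (@Num.sqrt R)).
    exact: sqrt_continuous.
  rewrite -[X in _ --> X](mulr0 c); apply: cvgM; first exact: cvg_cst.
  exact: (fine_cvg (gnorm2_tail beta0 p gf)).
apply: (@squeeze_cvgr _ _ _ _ (fun=> 0) (fun N => Num.sqrt (c * fine (v N)))).
- apply: nearW => N.
  rewrite normc_ge0/= -[leLHS]ger0_norm ?normc_ge0// -sqrtr_sqr ler_wsqrtr//.
  by rewrite -lee_fin [X in (_ <= X)%E]EFinM fineK//; exact: zc.
- exact: cvg_cst.
- exact: t.
Qed.

(** By [wick_sum] the partial sums are the values of exp (- D_K / 2) on the
    truncations of f, which tend to f. *)
Lemma pointwise_wick f : in_gamma f ->
  pointwise_sum (fun n x => wick K x (word_form (n := n) f)) (fun x => diag_sum x (expD (- (1 / 2)) f)).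
Proof.
move=> gf x.
have gE g : in_gamma g -> in_gamma (expD (- (1 / 2)) g) by exact: (in_gamma_contraction_exp ci beta0 beta1 r0 rb hK).
have [P hP] := diag_sum_bound ci beta0 x.
have [P' hP'] := contraction_exp_bound ci beta0 beta1 r0 rb hK (- (1 / 2)) P.
apply: (@gnorm2_tail_cvg0 _ (2 * 8) P' f gf) => [//|N].
rewrite (wick_sum ci r0 hK beta0 beta1 rb)//; last exact: gf.1.
have gt : in_gamma (truncate N f) by apply: (in_gamma_truncate ci beta0); exact: gf.1.
have gd : in_gamma (lin_comb (-1) (truncate N f) f) by exact: (in_gamma_lin_comb beta0).
rewrite {2}(truncate_split N f) contraction_exp_lin_combE// (diag_sum_lin_comb ci beta0 x 1 (gE _ gt) (gE _ gd)).
rewrite [1 * diag_sum _ _]mul1r opprD addrA subrr add0r.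
have -> : sqnormc (- diag_sum x (expD (- (1 / 2)) (lin_comb (-1) (truncate N f) f))) =
  sqnormc (diag_sum x (expD (- (1 / 2)) (lin_comb (-1) (truncate N f) f))) by rewrite /sqnormc normcN.
apply: le_trans (hP _ (gE _ gd)) _.
by rewrite EFinM -muleA lee_wpmul2l ?lee_fin//; exact: hP'.
Qed.

Lemma gnorm2_opp p f g : (forall s, f s = - g s) -> gnorm2 p f = gnorm2 p g.
Proof.
move=> fg; apply: eq_eseriesr => n _; congr (_ * _)%E; apply: eq_isum => s _.
by rewrite /at_level fg /sqnormc normcN.
Qed.

End PointwiseWick.

Section Decomposition.
Context (R : realType) (A : operator R) (B : L2R R -> L2R R) (e : nat -> L2R R) (rho : R).
Hypothesis ci : contractive_inverse A B e rho.
Variable beta : R.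
Hypotheses (beta0 : 0 <= beta) (beta1 : beta <= 1).
Variable r : nat.
Hypotheses (r0 : (0 < r)%N) (rb : r%:R * (1 - beta) <= 2).
Variables (tau : functional A 2) (K : functional A r).
Hypotheses (htau : dual_tensor tau) (hK : dual_tensor K).
Local Notation E' := (distr A).
Local Notation symtensor := (symtensor e).
Local Notation in_gamma := (in_gamma e beta).
Local Notation gnorm2 := (gnorm2 e beta).
Local Notation expK := (contraction_exp K).
Local Notation expT := (contraction_exp tau).
Local Notation h := (1 / 2).
Implicit Types (f g : seq E' -> R[i]).

Let rb2 : 2%:R * (1 - beta) <= 2.
Proof. by rewrite ler_piMr// lerBlDr lerDl. Qed.

Let gT a f : in_gamma f -> in_gamma (expT a f).
Proof. exact: (in_gamma_contraction_exp ci beta0 beta1 (isT : 0 < 2)%N rb2 htau). Qed.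

Let gK a f : in_gamma f -> in_gamma (expK a f).
Proof. exact: (in_gamma_contraction_exp ci beta0 beta1 r0 rb hK). Qed.

Let TK a f : in_gamma f -> expT (- a) (expT a f) = f.
Proof. exact: (contraction_expK ci beta0 beta1 (isT : 0 < 2)%N rb2 htau). Qed.

Let KK a f : in_gamma f -> expK (- a) (expK a f) = f.
Proof. exact: (contraction_expK ci beta0 beta1 r0 rb hK). Qed.

(** By the group law, exp (- D_tau / 2) maps these chaos coefficients back to the
    Taylor coefficients g. *)
Lemma chaos_diag_sum g : in_gamma g -> chaos tau beta (fun x => diag_sum x g) (fun n => word_form (expT h g)).
Proof.
move=> gg; have [tT fT] := gT h gg; split=> [n|p|].
- exact/(sym_tensor_word_form ci).
- by rewrite (chaos_norm2E ci).
- have := pointwise_wick ci beta0 beta1 (isT : 0 < 2)%N rb2 htau (gT h gg).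
  by rewrite TK.
Qed.

Lemma chaos_word phi (f0 : forall n, nform A n) : chaos tau beta phi f0 ->
  in_gamma (word_fun f0) /\ phi = fun x => diag_sum x (expT (- h) (word_fun f0)).
Proof.
move=> [sf nf pf].
have tf n : symtensor n (word_fun f0) by apply/(sym_tensor_word_form ci); rewrite word_funK.
have fE : f0 = fun n => word_form (word_fun f0).
  by apply: functional_extensionality_dep => n; rewrite word_funK.
have gf : in_gamma (word_fun f0).
  by split=> // p; rewrite -(chaos_norm2E ci)// -fE.
split=> //; apply/funext => x.
have p1 := pf x; have p2 := pointwise_wick ci beta0 beta1 (isT : 0 < 2)%N rb2 htau gf x.
rewrite fE in p1; exact: ccvg_unique p1 p2.
Qed.

Lemma wick_sumE psi N : (forall n, symtensor n psi) ->
  (fun x => \sum_(n < N) wick K x (word_form (n := n) psi)) =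
  (fun x => diag_sum x (expK (- h) (truncate N psi))).
Proof.
by move=> tp; apply/funext => x; exact: (wick_sum ci r0 hK beta0 beta1 rb).
Qed.

Lemma diag_sum_sub psi g N x : (forall n, symtensor n psi) -> in_gamma g ->
  diag_sum x (expK (- h) (truncate N psi)) - diag_sum x g = diag_sum x (lin_comb (-1) g (expK (- h) (truncate N psi))).
Proof.
move=> tp gg; have gt : in_gamma (expK (- h) (truncate N psi)) by apply: gK; exact: (in_gamma_truncate ci beta0).
by rewrite (diag_sum_lin_comb ci beta0 x (-1) gg gt) mulN1r addrC.
Qed.

(** The difference of the N-th partial sum and phi has the chaos coefficients
    exp (D_tau / 2) exp (- D_K / 2) applied to the truncation of psi minus psi. *)
Lemma wick_decomposition_cvg phi g psi : in_gamma g -> in_gamma psi -> expK (- h) psi = g ->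
  phi = (fun x => diag_sum x g) ->
  test_cvg tau beta (fun N x => \sum_(n < N) wick K x (word_form (n := n) psi)) phi.
Proof.
move=> gg gp psig phiE; have tp := gp.1.
have gt N : in_gamma (truncate N psi) by exact: (in_gamma_truncate ci beta0).
split=> [N|p].
  by rewrite wick_sumE//; eexists; apply: chaos_diag_sum; exact: gK.
have [P hP] := contraction_exp_bound ci beta0 beta1 (isT : 0 < 2)%N rb2 htau h p.
have [P' hP'] := contraction_exp_bound ci beta0 beta1 r0 rb hK (- h) P.
have t := cvgeZl (isT : (8 * 8)%:E \is a fin_num) (gnorm2_tail beta0 P' gp).
rewrite mule0 in t; apply: squeeze_cvge (cvg_cst 0%E) t; apply: nearW => N.
apply/andP; split.
  apply: le_ereal_inf_tmp => _ [f0 cf0 <-]; have [gf _] := chaos_word cf0.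
  have -> : f0 = fun n => word_form (word_fun f0).
    by apply: functional_extensionality_dep => n; rewrite word_funK.
  by rewrite (chaos_norm2E ci) ?gnorm2_ge0//; exact: gf.1.
have gd : in_gamma (lin_comb (-1) psi (truncate N psi)) by exact: (in_gamma_lin_comb beta0).
have -> : (fun x => \sum_(n < N) wick K x (word_form (n := n) psi)) - phi =
    (fun x => diag_sum x (expK (- h) (lin_comb (-1) psi (truncate N psi)))).
  rewrite wick_sumE// phiE; apply/funext => x; rewrite fctE/= diag_sum_sub// -psig.
  by rewrite (contraction_exp_lin_combE ci beta0 beta1 r0 rb hK (- h) (-1) gp (gt N)).
apply: le_trans (ereal_inf_lbound _) _.
  by eexists; [apply: chaos_diag_sum; exact: gK|reflexivity].
rewrite (chaos_norm2E ci); last by move=> n; exact: (gT _ (gK _ gd)).1.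
apply: le_trans (hP _ (gK _ gd)) _.
rewrite EFinM -muleA lee_wpmul2l ?lee_fin//.
have <- : gnorm2 P' (lin_comb (-1)%R psi (truncate N psi)) = gnorm2 P' (lin_comb (-1)%R (truncate N psi) psi).
  by apply: gnorm2_opp => s; rewrite /lin_comb; ring.
exact: hP'.
Qed.

(** Let v be the chaos coefficients of the difference of the N-th partial sum and
    phi. Since Taylor coefficients are unique, exp (D_K / 2) exp (- D_tau / 2) v is the
    truncation of psi' minus psi. Its component of a fixed degree is constant for large N,
    and it is bounded by a norm of v, which tends to 0. *)
Lemma wick_decomposition_unique phi g psi psi' : in_gamma g -> in_gamma psi ->
  expK (- h) psi = g -> phi = (fun x => diag_sum x g) -> (forall n, symtensor n psi') ->
  test_cvg tau beta (fun N x => \sum_(n < N) wick K x (word_form (n := n) psi')) phi ->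
  psi' = psi.
Proof.
move=> gg gp psig phiE tp' [_ cvg']; apply/funext => s; apply/eqP; rewrite -subr_eq0; apply/eqP.
have gt N : in_gamma (truncate N psi') by exact: (in_gamma_truncate ci beta0).
have [p [c [c0 hc]]] := in_gamma_word_bound ci beta0 s.
have [P hP] := contraction_exp_bound ci beta0 beta1 r0 rb hK h p.
have [P' hP'] := contraction_exp_bound ci beta0 beta1 (isT : 0 < 2)%N rb2 htau (- h) P.
(* The bound of v by two exponentials; 1 is added to make d positive. *)
pose d := c * (8 * 8) + 1; have d0 : 0 < d by rewrite ltr_wpDl ?mulr_ge0.
have low N : (size s < N)%N -> ((normc (psi' s - psi s) ^+ 2 / d)%:E <= test_norm2 tau beta P'
    ((fun x => \sum_(n < N) wick K x (word_form (n := n) psi')) - phi)%R)%E.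
  move=> sN; apply: le_ereal_inf_tmp => _ [v0 cv0 <-].
  have [gv ve] := chaos_word cv0; set v := word_fun v0 in gv ve.
  have -> : v0 = fun n => word_form v.
    by apply: functional_extensionality_dep => n; rewrite word_funK.
  rewrite (chaos_norm2E ci); last exact: gv.1.
  have gd : in_gamma (lin_comb (-1) psi (truncate N psi')) by exact: (in_gamma_lin_comb beta0).
  have E : expT (- h) v = expK (- h) (lin_comb (-1) psi (truncate N psi')).
    set F := expK _ _.
    suff key w : lin_comb (-1) (expT (- h) v) F w = 0.
      apply/funext => w; apply/eqP; rewrite eq_sym -subr_eq0; apply/eqP.
      by have := key w; rewrite /lin_comb mulN1r addrC.
    move: w; apply: (diag_sum_inj ci beta0); first by apply: (in_gamma_lin_comb beta0); [exact: gT|exact: gK].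
    move=> x; rewrite (diag_sum_lin_comb ci beta0 x (-1) (gT _ gv) (gK _ gd)).
    have := congr1 (fun F => F x) ve; rewrite /= => <-.
    rewrite wick_sumE// phiE fctE/= diag_sum_sub// -psig.
    by rewrite -(contraction_exp_lin_combE ci beta0 beta1 r0 rb hK (- h) (-1) gp (gt N)) mulN1r addNr.
  have -> : psi' s - psi s = expK h (expT (- h) v) s.
    rewrite E -{1}(opprK h) KK// /lin_comb /truncate sN; ring.
  have := hc _ (gK h (gT (- h) gv)).
  move=> /le_trans/(_ (lee_wpmul2l _ (hP _ (gT (- h) gv)))); rewrite lee_fin => /(_ c0) h1.
  have h2 : (sqnormc (expK h (expT (- h) v) s) <= d%:E * gnorm2 P' v)%E.
    apply: le_trans h1 _; apply: (@le_trans _ _ ((c * (8 * 8))%:E * gnorm2 P' v)%E).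
      rewrite !EFinM -!muleA lee_wpmul2l ?lee_fin// lee_wpmul2l ?lee_fin//.
      exact: hP'.
    by rewrite lee_wpmul2r ?gnorm2_ge0// lee_fin /d lerDl.
  by rewrite mulrC EFinM lee_pdivrMl.
have le0 : ((normc (psi' s - psi s) ^+ 2 / d)%:E <= 0)%E.
  apply: (cvge_to_ge (cvg' P')); near=> N; apply: low.
  by near: N; exact: nbhs_infty_gt.
apply: Normc.eq0_normc; apply/eqP; rewrite -sqrf_eq0 eq_le sqr_ge0 andbT.
by move: le0; rewrite lee_fin pmulr_lle0// invr_gt0.
Unshelve. all: by end_near. Qed.

End Decomposition.

Theorem theorem6p6 (R : realType) (A : operator R)
    (hA : white_noise_operator A)
    (tau : functional A 2) (htau : trace_spec tau)
    (r : nat) (hr : (0 < r)%N)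
    (beta : R) (hbeta : Num.max 0 (r%:R - 2) / r%:R <= beta) (hbeta1 : beta < 1)
    (kappa : functional A r) (hkappa : sym_dual_tensor kappa)
    (phi : distr A -> R[i]) (hphi : test_space tau beta phi) :
  exists! psi : forall n : nat, nform A n,
    [/\ forall n : nat, sym_tensor (psi n),
        pointwise_sum (fun n x => wick kappa x (psi n)) phi &
        test_cvg tau beta
          (fun (N : nat) (x : distr A) => \sum_(n < N) wick kappa x (psi n)) phi].
Proof.
have [B [e [rho ci]]] := contractive_inverse_exists hA.
have [dtau _] := htau; have [dkappa _] := hkappa.
have rpos : 0 < r%:R :> R by rewrite ltr0n.
have beta0 : 0 <= beta.
  by apply: le_trans hbeta; rewrite divr_ge0// le_max lexx.
have beta1 : beta <= 1 by exact: ltW.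
have rb : r%:R * (1 - beta) <= 2.
  have : r%:R - 2 <= beta * r%:R.
    by rewrite -ler_pdivrMr//; apply: le_trans hbeta; rewrite ler_pM2r ?invr_gt0// le_max lexx orbT.
  by rewrite mulrBr mulr1 mulrC; lra.
have rb2 : 2%:R * (1 - beta) <= 2 by rewrite ler_piMr// lerBlDr lerDl.
have [f0 cf0] := hphi.
have [gf phiE] := chaos_word ci beta0 beta1 dtau cf0.
set g := contraction_exp tau (- (1 / 2)) (word_fun f0) in phiE.
have gg : in_gamma e beta g by exact: (in_gamma_contraction_exp ci beta0 beta1 (isT : 0 < 2)%N rb2 dtau).
set psi := contraction_exp kappa (1 / 2) g.
have gp : in_gamma e beta psi by exact: (in_gamma_contraction_exp ci beta0 beta1 hr rb dkappa).
have psig : contraction_exp kappa (- (1 / 2)) psi = g by exact: (contraction_expK ci beta0 beta1 hr rb dkappa).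
exists (fun n => word_form psi); split.
  split.
  - by move=> n; apply/(sym_tensor_word_form ci); exact: gp.1.
  - have := pointwise_wick ci beta0 beta1 hr rb dkappa gp; by rewrite psig -phiE.
  - exact: (wick_decomposition_cvg ci beta0 beta1 hr rb dtau dkappa gg gp psig phiE).
move=> psi' [sp' _ cp'].
have pE : psi' = fun n => word_form (word_fun psi').
  by apply: functional_extensionality_dep => n; rewrite word_funK.
have tp' n : symtensor e n (word_fun psi') by apply/(sym_tensor_word_form ci); rewrite word_funK.
rewrite pE in cp'.
have <- := wick_decomposition_unique ci beta0 beta1 hr rb dtau dkappa gg gp psig phiE tp' cp'.
by rewrite -pE.
Qed.
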